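(* Let $0\le \mu\le 0.5$. If the $\mu$-R3SAT hardness assumption holds, then there exists no efficient learning algorithm that learns the class $\mathcal{H}_{n,3}$ using $O\left(\frac{n^{1+\mu}}{\epsilon^2}\right)$ examples.
   Context: For $n,k\in\mathbb{N}$ let $C_{n,k}=\{x\in\{-1,1,0\}^n : |\{i: x_i\neq 0\}|\le k\}$ and let $\mathcal{H}_{n,k}=\{h_{w,b}:C_{n,k}\to\{\pm1\} \mid h_{w,b}(x)=\mathrm{sign}(\langle w,x\rangle+b),\ w\in\mathbb{R}^n,\ b\in\mathbb{R}\}$ (halfspaces over $k$-sparse vectors). For $h:C_{n,3}\to\{\pm1\}$ and a distribution $\mathcal{D}$ on $C_{n,3}\times\{\pm1\}$, $\mathrm{Err}_{\mathcal{D}}(h)=\Pr_{(x,y)\sim\mathcal{D}}(h(x)\neq y)$, and for a class $\mathcal{H}$, $\mathrm{Err}_{\mathcal{D}}(\mathcal{H})=\min_{h\in\mathcal{H}}\mathrm{Err}_{\mathcal{D}}(h)$. A learning algorithm $L$ receives a sample $S\in(C_{n,3}\times\{\pm1\})^m$ and returns a hypothesis $L(S):C_{n,3}\to\{\pm1\}$. $L$ learns $\mathcal{H}_{n,3}$ using $m(n,\epsilon)$ examples if for every $n$, every $\epsilon>0$, every distribution $\mathcal{D}$ on $C_{n,3}\times\{\pm1\}$ and a sample $S$ of more than $m(n,\epsilon)$ i.i.d. examples from $\mathcal{D}$, $\Pr_S\big(\mathrm{Err}_{\mathcal{D}}(L(S))>\mathrm{Err}_{\mathcal{D}}(\mathcal{H}_{n,3})+\epsilon\big)<\frac{1}{10}$.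 $L$ is efficient if it runs in time polynomial in the sample size and returns a hypothesis that can be evaluated in polynomial time. Boolean variables take values in $\{\pm1\}$ and negation is denoted by $-$. An $n$-variable 3CNF clause is $C(x)=(-1)^{j_1}x_{i_1}\vee(-1)^{j_2}x_{i_2}\vee(-1)^{j_3}x_{i_3}$, $x\in\{\pm1\}^n$; a 3CNF formula is a conjunction $\phi=\wedge_{i=1}^m C_i$ of such clauses; $\mathrm{3CNF}_{n,m}$ is the set of such formulas with $n$ variables and $m$ clauses. The value $\mathrm{val}(\phi)$ is the maximal fraction of clauses of $\phi$ that can be simultaneously satisfied. For $\Delta:\mathbb{N}\to\mathbb{N}$ and $0\le\epsilon<\frac14$, an efficient (randomized) algorithm $A$ $\epsilon$-refutes random 3CNF with ratio $\Delta$ if its input is $\phi\in\mathrm{3CNF}_{n,n\Delta(n)}$, its output is ''typical'' or ''exceptional'', and: (soundness) if $\mathrm{val}(\phi)\ge 1-\epsilon$ then $\Pr_{\text{coins of }A}(A(\phi)=\text{''exceptional''})\ge\frac34$; (completeness) for every $n$, $\Pr_{\text{coins of }A,\ \phi\sim\mathrm{Uni}(\mathrm{3CNF}_{n,n\Delta(n)})}(A(\phi)=\text{''typical''})\ge 1-o(1)$. The $\mu$-R3SAT hardness assumption: for every $\epsilon>0$ there is $\Delta_0(\epsilon)$ such that for every integer $\Delta>\Delta_0(\epsilon)$ there exists no efficient algorithm that $\epsilon$-refutes random 3CNF with ratio $\Delta\cdot n^{\mu}$. *)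

(* Defs.v *)
From HB Require Import structures.
From mathcomp Require Import all_boot all_order all_algebra.
From mathcomp Require Import all_classical all_reals all_analysis.
Set Implicit Arguments. Unset Strict Implicit. Unset Printing Implicit Defensive.
Import Order.TTheory GRing.Theory Num.Theory.
Import numFieldNormedType.Exports.
Local Open Scope classical_set_scope.
Local Open Scope ring_scope.

(* 1. A model of computation: single-tape Turing machines over the     *)
(*    alphabet {0,1,blank}, with one random coin read at every step     *)
(*    (probabilistic TM).  A deterministic run feeds constant coins.   *)

Record TM := {
  tm_k : nat;
  tm_delta : 'I_tm_k.+1 -> option bool -> bool ->
             'I_tm_k.+1 * option bool * bool;   (* new state, written symbol, move right? *)
  tm_halt : 'I_tm_k.+1 }.                        (* start state is ord0 *)

(* configuration: state, left part (reversed), scanned cell, right part *)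
Definition config (M : TM) :=
  ('I_(tm_k M).+1 * seq (option bool) * option bool * seq (option bool))%type.

Definition init_config (M : TM) (w : seq bool) : config M :=
  (ord0, [::], head None (map Some w), behead (map Some w)).

Definition step (M : TM) (coin : bool) (c : config M) : config M :=
  let: (q, l, a, r) := c in
  if q == tm_halt M then c else
  let: (q', b, mv) := tm_delta q a coin in
  if mv then (q', b :: l, head None r, behead r)
  else (q', behead l, head None l, b :: r).

Fixpoint run_from (M : TM) (t i : nat) (coins : seq bool) (c : config M)
  : config M :=
  match t with
  | 0 => c
  | t'.+1 => run_from t' i.+1 coins (step (nth false coins i) c)
  end.

Definition run (M : TM) (t : nat) (w coins : seq bool) : config M :=
  run_from t 0 coins (init_config M w).

Definition halted (M : TM) (c : config M) : bool := c.1.1.1 == tm_halt M.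

Fixpoint read_bits (s : seq (option bool)) : seq bool :=
  match s with
  | Some b :: s' => b :: read_bits s'
  | _ => [::]
  end.
Definition output (M : TM) (c : config M) : seq bool :=
  let: (_, _, a, r) := c in read_bits (a :: r).

(* deterministic runs: all coins are [false] *)
Definition det_halts_within (M : TM) (w : seq bool) (t : nat) : Prop :=
  halted (run M t w [::]).
Definition det_output (M : TM) (w : seq bool) (t : nat) : seq bool :=
  output (run M t w [::]).

Definition halts_within (M : TM) (w : seq bool) (t : nat) : Prop :=
  forall r : t.-tuple bool, halted (run M t w r).

Definition poly (c k len : nat) : nat := c * len.+1 ^ k.

Fixpoint nbits_aux (fuel n : nat) : seq bool :=
  match fuel with
  | 0 => [::]
  | f.+1 => if n is 0 then [::] else odd n :: nbits_aux f n./2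
  end.
Definition nbits (n : nat) : seq bool := nbits_aux n n.

Definition delim (s : seq bool) : seq bool :=
  flatten [seq [:: true; b] | b <- s] ++ [:: false; false].
Definition enc_nat (n : nat) : seq bool := delim (nbits n).
Definition enc_pair (u v : seq bool) : seq bool := delim u ++ v.

(* literal (i, j) stands for (-1)^j x_i; an assignment x : 'I_n -> bool   *)
(* (true = the value "true"); the literal is true iff x_i xor j.          *)
Definition literal (n : nat) := ('I_n * bool)%type.
Definition clause (n : nat) := 3.-tuple (literal n).
Definition formula (n m : nat) := m.-tuple (clause n).

Definition lit_sat n (x : {ffun 'I_n -> bool}) (l : literal n) : bool :=
  x l.1 (+) l.2.
Definition clause_sat n (x : {ffun 'I_n -> bool}) (C : clause n) : bool :=
  has (lit_sat x) C.
Definition nsat n m (x : {ffun 'I_n -> bool}) (phi : formula n m) : nat :=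
  count (clause_sat x) phi.

Definition val_ge (R : realType) n m (phi : formula n m) (a : R) : Prop :=
  exists x : {ffun 'I_n -> bool}, a * m%:R <= (nsat x phi)%:R.

Definition enc_lit n (l : literal n) : seq bool := enc_nat l.1 ++ [:: l.2].
Definition enc_formula n m (phi : formula n m) : seq bool :=
  enc_nat n ++ enc_nat m ++
  flatten [seq flatten [seq enc_lit l | l <- tval C] | C <- tval phi].

(* probability over the coins (t coins suffice for a t-step run) that
   the output is "exceptional" (first output bit true) *)
Definition Pr_exceptional (R : realType) (A : TM) (t : nat) (w : seq bool) : R :=
  #|[set r : t.-tuple bool | head false (output (run A t w r))]|%:R / (2 ^ t)%:R.

(* A eps-refutes random 3CNF with mcl n = n*Delta(n) clauses *)
Definition refutes (R : realType) (A : TM) (eps : R) (mcl : nat -> nat) : Prop :=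
  exists c k : nat,
    let T n (phi : formula n (mcl n)) := poly c k (size (enc_formula phi)) in
    (forall n (phi : formula n (mcl n)),
        halts_within A (enc_formula phi) (T n phi)) /\
    (forall n (phi : formula n (mcl n)), val_ge phi (1 - eps) ->
        3 / 4 <= Pr_exceptional R A (T n phi) (enc_formula phi)) /\
    (exists f : nat -> R, f n @[n --> \oo] --> 0 /\
       forall n,
         1 - f n <=
         (#|{: formula n (mcl n)}|%:R)^-1 *
         \sum_(phi : formula n (mcl n))
            (1 - Pr_exceptional R A (T n phi) (enc_formula phi))).

(* number of clauses n * (Delta * n^mu), rounded down to an integer *)
Definition nclauses (R : realType) (Delta : nat) (mu : R) (n : nat) : nat :=
  Num.truncn (Delta%:R * (n%:R `^ (1 + mu))).

Definition R3SAT_hardness (R : realType) (mu : R) : Prop :=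
  forall eps : R, 0 < eps -> eps < 1 / 4 ->
  exists Delta0 : R, forall Delta : nat, Delta0 < Delta%:R ->
    ~ exists A : TM, refutes A eps (nclauses Delta mu).

Definition coordval (R : realType) (t : 'I_3) : R := t%:R - 1.

(* C_{n,3}: at most 3 nonzero coordinates *)
Definition sparse3 n (x : {ffun 'I_n -> 'I_3}) : bool :=
  (#|[set i | val (x i) != 1%N]| <= 3)%N.
Definition Cn3 (n : nat) := {x : {ffun 'I_n -> 'I_3} | sparse3 x}.
(* labels in {+-1}: true = +1 *)
Definition example (n : nat) := (Cn3 n * bool)%type.

(* h_{w,b}(x) = sign(<w,x> + b), with the convention sign(0) = +1 *)
Definition halfspace (R : realType) n (w : 'I_n -> R) (b : R) (x : Cn3 n) : bool :=
  0 <= \sum_i w i * coordval R (val x i) + b.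

Definition is_distr (R : realType) (T : finType) (D : T -> R) : Prop :=
  (forall z, 0 <= D z) /\ \sum_z D z = 1.

Definition Err (R : realType) n (D : example n -> R) (h : Cn3 n -> bool) : R :=
  \sum_z D z * (h z.1 != z.2)%:R.

Definition OptErr (R : realType) n (D : example n -> R) : R :=
  inf [set e | exists (w : 'I_n -> R) (b : R), e = Err D (halfspace w b)].

Definition Pr_sample (R : realType) n (D : example n -> R) (m : nat)
  (P : m.-tuple (example n) -> bool) : R :=
  \sum_(S : m.-tuple (example n)) (\prod_(i < m) D (tnth S i)) * (P S)%:R.
Arguments Pr_sample {R n} D m P.

Definition enc_trit (t : 'I_3) : seq bool := [:: val t == 1%N; val t == 2%N].
Definition enc_point n (x : Cn3 n) : seq bool :=
  enc_nat n ++ flatten [seq enc_trit (val x i) | i <- enum 'I_n].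
Definition enc_sample n m (S : m.-tuple (example n)) : seq bool :=
  enc_nat n ++ enc_nat m ++
  flatten [seq flatten [seq enc_trit (val z.1 i) | i <- enum 'I_n] ++ [:: z.2]
          | z : example n <- tval S].

(* A learner is a pair (L, Ev) of machines: L maps the encoded sample to a
   description z of the hypothesis (in time poly in |S|); Ev evaluates the
   hypothesis: on input <z, x> it outputs the label (first bit, true = +1)
   in time poly in the input size. *)
Definition hyp (L Ev : TM) (c k c' k' : nat) n m (S : m.-tuple (example n))
  (x : Cn3 n) : bool :=
  let sS := enc_sample S in
  let z := det_output L sS (poly c k (size sS)) in
  head false (det_output Ev (enc_pair z (enc_point x))
                         (poly c' k' (size sS + size (enc_point x)))).

Definition efficiently_learns (R : realType) (L Ev : TM) (mfun : nat -> R -> R)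
  : Prop :=
  exists c k c' k' : nat,
    (forall n m (S : m.-tuple (example n)),
        det_halts_within L (enc_sample S) (poly c k (size (enc_sample S)))) /\
    (forall n m (S : m.-tuple (example n)) (x : Cn3 n),
        let sS := enc_sample S in
        let z := det_output L sS (poly c k (size sS)) in
        det_halts_within Ev (enc_pair z (enc_point x))
          (poly c' k' (size sS + size (enc_point x)))) /\
    (forall n (eps : R), 0 < eps ->
     forall D : example n -> R, is_distr D ->
     forall m : nat, mfun n eps < m%:R ->
       Pr_sample D m (fun S => OptErr D + eps < Err D (hyp L Ev c k c' k' S))
         < 1 / 10).

Definition bigO_sample (R : realType) (mu : R) (mfun : nat -> R -> R) : Prop :=
  exists (C : R) (N0 : nat) (eps0 : R), 0 < eps0 /\
    forall n (eps : R), (N0 <= n)%N -> 0 < eps -> eps < eps0 ->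
      mfun n eps <= C * (n%:R `^ (1 + mu)) / eps ^+ 2.

(* Main.v *)
(* A learner yields a refuter.  Turn a clause C into sixteen labelled points:
   eight copies of (C, +1), and (C', -1) for each of the eight ways C' of signing
   the variables of C, the three literals being written in disjoint blocks of
   coordinates.  An assignment psi satisfying C gives the halfspace
   sign(<psi, x> + 2), which is right on 9 of the 16 points, as it rejects exactly
   one C'.  So if nearly all the clauses can be satisfied, some halfspace has error
   at most about 7/16, hence so does the learnt hypothesis.  If the formula is
   random and the sample touches at most 1/32 of the clauses, the signs of the
   other clauses are independent of the hypothesis, whose score on them has mean 0
   and, by a second moment bound, is o(m) with high probability.  Comparing the
   score of the hypothesis over all the clauses with m/2 thus refutes; a large
   ratio Delta makes m/32 exceed the number of examples the learner asks for.

   That this refuter is a polynomial-time Turing machine is shown by writing it as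
   a program over stacks of bits, compiled to a single tape; the learner and the
   evaluator are simulated on a pair of stacks each. *)
Require Import Defs.
From HB Require Import structures.
From mathcomp Require Import all_boot all_order all_algebra.
From mathcomp Require Import all_classical all_reals all_analysis.
From mathcomp Require Import zify ring lra.
Import Order.TTheory GRing.Theory Num.Theory.
Import numFieldNormedType.Exports.
Set Implicit Arguments. Unset Strict Implicit. Unset Printing Implicit Defensive.
Local Open Scope nat_scope.

(** * A language of stack programs *)

(** The eight positive copies balance the eight negative signings, so under random signs a fixed
    hypothesis has mean score 0 on every clause. Disjoint blocks keep this true when a variable
    occurs twice in a clause. Fair coins cannot draw uniformly among [m] clauses: [K] of them, with
    [m < 2 ^ K <= 2 * m], select an entry of a list padded with zero vectors of score 0, which at
    most halves the advantage. Hence the constants: with 31/32 of the clauses satisfied, some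
    halfspace scores at least 3m/4, the learner may lose m/4 of it, and m/2 remains as the
    threshold, out of reach of the touched clauses, which bring at most 7m/32. The drawn indices
    depend on the coins alone, and learner and evaluator are deterministic, so the bound for random
    formulas holds for each fixed coin string. The machine reads a coin at every step, the program
    only when it asks for one. The two probabilities can be compared because the number of coins
    that the program consumes depends on [m] only. Numbers are kept in unary on the stacks; this
    stays polynomial because [n <= m] and [m] is at most the length of the input. *)

Inductive src := SPop of nat | SIn | SCoin.

Inductive cmd :=
| CSkip
| CPush of nat & bool
| CSeq of cmd & cmd
| CCase of src & cmd & cmd & cmd
| CLoop of nat & cmd & cmd.

Record st := St { stk : nat -> seq bool; inp : seq bool; coins : seq bool }.

Definition upd T (f : nat -> T) (j : nat) (x : T) : nat -> T :=
  fun i => if i == j then x else f i.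

Definition setk (s : st) j x := St (upd (stk s) j x) (inp s) (coins s).

Lemma updE T (f : nat -> T) j x i : upd f j x i = if i == j then x else f i.
Proof. by []. Qed.

Lemma upd_id T (f : nat -> T) j : upd f j (f j) = f.
Proof. by apply: funext => i; rewrite updE; case: eqP => [->|]. Qed.

(* Popping an empty stack is allowed and yields [None]; reading past the end
   of the input, or past the end of the coins, is stuck. *)
Definition fetch (x : src) (s : st) : option (option bool * st) :=
  match x with
  | SPop j => Some (ohead (stk s j), setk s j (behead (stk s j)))
  | SIn => if inp s is b :: i then Some (Some b, St (stk s) i (coins s)) else None
  | SCoin => if coins s is b :: r then Some (Some b, St (stk s) (inp s) r) else None
  end.

Definition choose3 A (v : option bool) (an a0 a1 : A) : A :=
  match v with None => an | Some false => a0 | Some true => a1 end.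

(** The cost counts flat instructions: sequencing is free, a test costs one. This is what lets
    [comp_correct] give an exact number of steps. *)
Inductive exec : cmd -> st -> st -> nat -> Prop :=
| ex_skip s : exec CSkip s s 1
| ex_push j b s : exec (CPush j b) s (setk s j (b :: stk s j)) 1
| ex_seq c1 c2 s s' s'' t1 t2 :
    exec c1 s s' t1 -> exec c2 s' s'' t2 -> exec (CSeq c1 c2) s s'' (t1 + t2)
| ex_case x cn c0 c1 s v s' s'' t :
    fetch x s = Some (v, s') -> exec (choose3 v cn c0 c1) s' s'' t ->
    exec (CCase x cn c0 c1) s s'' t.+1
| ex_loop0 j c0 c1 s :
    stk s j = [::] -> exec (CLoop j c0 c1) s s 1
| ex_loop1 j c0 c1 s b l s' s'' t1 t2 :
    stk s j = b :: l -> exec (if b then c1 else c0) (setk s j l) s' t1 ->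
    exec (CLoop j c0 c1) s' s'' t2 -> exec (CLoop j c0 c1) s s'' (t1 + t2).+1.

(** * Compilation to flat code *)

Inductive instr :=
| IPush of nat & bool & nat
| IGet of src & nat & nat & nat
| IJmp of nat
| IOut of bool.

Fixpoint csize (c : cmd) : nat :=
  match c with
  | CSkip => 1
  | CPush _ _ => 1
  | CSeq c1 c2 => csize c1 + csize c2
  | CCase _ cn c0 c1 => (csize cn + csize c0 + csize c1).+1
  | CLoop _ c0 c1 => (csize c0 + csize c1).+1
  end.

(** [base] is the address of the first instruction and [next] the continuation; the bodies of a loop
    continue at its own test. Even [CSkip] takes one instruction, a jump, so that no command
    compiles to empty code. *)
Fixpoint comp (c : cmd) (base next : nat) : seq instr :=
  match c with
  | CSkip => [:: IJmp next]
  | CPush j b => [:: IPush j b next]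
  | CSeq c1 c2 => comp c1 base (base + csize c1) ++ comp c2 (base + csize c1) next
  | CCase x cn c0 c1 =>
      let a := base.+1 in let b := a + csize cn in let d := b + csize c0 in
      IGet x a b d :: comp cn a next ++ comp c0 b next ++ comp c1 d next
  | CLoop j c0 c1 =>
      let b := base.+1 in let d := b + csize c0 in
      IGet (SPop j) next b d :: comp c0 b base ++ comp c1 d base
  end.

Lemma size_comp c base next : size (comp c base next) = csize c.
Proof.
elim: c base next => //= [c1 IH1 c2 IH2|x cn IHn c0 IH0 c1 IH1|j c0 IH0 c1 IH1] base next;
  by rewrite !size_cat ?IH1 ?IH2 ?IHn ?IH0 //= ?addnA.
Qed.

Definition instr_at (code : seq instr) pc := nth (IOut false) code pc.

Definition fstep (code : seq instr) (u : nat * st) : option (nat * st) :=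
  match instr_at code u.1 with
  | IPush j b nx => Some (nx, setk u.2 j (b :: stk u.2 j))
  | IGet x nn n0 n1 =>
      if fetch x u.2 is Some (v, s') then Some (choose3 v nn n0 n1, s') else None
  | IJmp nx => Some (nx, u.2)
  | IOut _ => None
  end.

Fixpoint fsteps code (t : nat) (u : nat * st) : option (nat * st) :=
  if t is t'.+1 then obind (fsteps code t') (fstep code u) else Some u.

Lemma fsteps_add code t1 t2 u v :
  fsteps code t1 u = Some v -> fsteps code (t1 + t2) u = fsteps code t2 v.
Proof.
elim: t1 u => [|t1 IH] u /=; first by case=> ->.
by case: (fstep code u) => //= u' /IH.
Qed.

Definition code_at (code : seq instr) base (c : seq instr) :=
  forall i, i < size c -> instr_at code (base + i) = instr_at c i.

Lemma code_at_cat code base c1 c2 :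
  code_at code base (c1 ++ c2) ->
  code_at code base c1 /\ code_at code (base + size c1) c2.
Proof.
move=> H; split=> i Hi.
  by rewrite H ?size_cat ?ltn_addr // /instr_at nth_cat Hi.
rewrite -addnA H ?size_cat ?ltn_add2l // /instr_at nth_cat ltnNge leq_addr /=.
by rewrite addKn.
Qed.

Lemma code_at_cons code base x c :
  code_at code base (x :: c) -> instr_at code base = x /\ code_at code base.+1 c.
Proof.
move=> H; split; first by rewrite -[base]addn0 H.
by move=> i Hi; rewrite addSnnS H.
Qed.

(** Induction is on the execution rather than on the command, since a loop runs the same code again
    after each pass. *)
Lemma comp_correct c s s' t : exec c s s' t ->
  forall code base next, code_at code base (comp c base next) ->
  fsteps code t (base, s) = Some (next, s').
Proof.
elim=> {c s s' t}.
- by move=> s code base next /= /code_at_cons [H _]; rewrite /fstep /= H.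
- by move=> j b s code base next /= /code_at_cons [H _]; rewrite /fstep /= H.
- move=> c1 c2 s s' s'' t1 t2 _ IH1 _ IH2 code base next /= /code_at_cat [H1 H2].
  rewrite (fsteps_add _ (IH1 _ _ _ H1)); apply: IH2.
  by rewrite size_comp in H2.
- move=> x cn c0 c1 s v s' s'' t Hf _ IH code base next /=.
  move=> /code_at_cons [H0 /code_at_cat [Hn /code_at_cat [Ha Hb]]].
  rewrite !size_comp in Ha Hb.
  rewrite /fstep /= H0 Hf /=.
  by case: v Hf IH => [[]|] _ IH /=; exact: IH.
- move=> j c0 c1 s Hs code base next /= /code_at_cons [H _]; rewrite /fstep /= H /= Hs /=.
  by congr Some; congr pair; rewrite -Hs /setk upd_id; case: (s).
- move=> j c0 c1 s b l s' s'' t1 t2 Hs _ IH1 _ IH2 code base next H.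
  have := H; rewrite /= => /code_at_cons [H0 /code_at_cat [Ha Hb]].
  rewrite size_comp in Hb.
  rewrite /fstep /= H0 /= Hs /=.
  rewrite (@fsteps_add _ _ _ _ (base, s')).
    exact: IH2.
  by case: b Hs IH1 => Hs IH1; exact: IH1.
Qed.

(** * Programs on a single tape *)

(* Tape positions grow to the left.  A non-blank marker sits at the base [B]; with [W = K + 1], the [d]-th bottommost element
   of stack [j < K] sits at [B + d * W + 1 + j], and the cells [B + d * W] for
   [d > 0] stay blank, so that a head walking home in strides of [W] recognises
   the base.  The unread input lies to the right of the base, separated from it
   by the blanks left by the symbols already read. *)
Definition mst := (nat * nat * nat)%type.
Notation phase q := q.1.2.

Section TuringMachine.
Variables (code : seq instr) (K : nat).

(* A state is (address, phase, distance left to walk).  Phases: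
   0 dispatch at the base; 1 walk to the first free cell of a stack;
   2 walk home; 3 step back onto the base; 4 walk from the free cell to the
   marker column; 5 walk to the top element; 6 look for the input;
   7 return from it; 8 and 9 halt; 10 and 11 set up the base marker. *)
Definition mdelta (q : mst) (a : option bool) (coin : bool) :
    mst * option bool * bool :=
  let: (pc, ph, cn) := q in
  match ph with
  | 0 => match instr_at code pc with
         | IPush j _ _ => ((pc, 1, j), a, false)
         | IJmp nx => ((nx, 3, 0), a, false)
         | IOut b => ((0, 8, 0), Some b, false)
         | IGet (SPop j) _ _ _ => ((pc, 1, j), a, false)
         | IGet SIn _ _ _ => ((pc, 6, 0), a, true)
         | IGet SCoin _ n0 n1 => ((if coin then n1 else n0, 3, 0), a, false)
         end
  | 1 => if cn is c.+1 then ((pc, 1, c), a, false) else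
         if a is Some _ then ((pc, 1, K), a, false) else
         match instr_at code pc with
         | IPush j b nx => ((nx, 2, j), Some b, true)
         | IGet (SPop j) _ _ _ => ((pc, 4, j), None, true)
         | _ => ((0, 9, 0), a, true)
         end
  | 2 => if cn is c.+1 then ((pc, 2, c), a, true) else
         if a is Some _ then ((pc, 3, 0), a, false) else ((pc, 2, K), a, true)
  | 3 => ((pc, 0, 0), a, true)
  | 4 => if cn is c.+1 then ((pc, 4, c), a, true) else
         match instr_at code pc with
         | IGet (SPop j) nn _ _ =>
             if a is Some _ then ((nn, 3, 0), a, false)
             else ((pc, 5, K - j.+1), a, true)
         | _ => ((0, 9, 0), a, true)
         end
  | 5 => if cn is c.+1 then ((pc, 5, c), a, true) else
         match instr_at code pc with
         | IGet (SPop j) nn n0 n1 => ((choose3 a nn n0 n1, 2, j), None, true)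
         | _ => ((0, 9, 0), a, true)
         end
  | 6 => if a is Some _ then
           match instr_at code pc with
           | IGet _ nn n0 n1 => ((choose3 a nn n0 n1, 7, 0), None, false)
           | _ => ((0, 9, 0), a, true)
           end
         else ((pc, 6, 0), a, true)
  | 7 => if a is Some _ then ((pc, 3, 0), a, false) else ((pc, 7, 0), a, false)
  | 8 => ((0, 9, 0), a, true)
  | 10 => ((0, 11, 0), a, false)
  | 11 => ((0, 3, 0), Some true, false)
  | _ => ((0, 9, 0), a, true)
  end.

(** These are the only states whose move depends on the coin. *)
Definition flips (q : mst) : bool :=
  (phase q == 0) && (if instr_at code q.1.1 is IGet SCoin _ _ _ then true else false).

Lemma mdelta_coin q a b b' : ~~ flips q -> mdelta q a b = mdelta q a b'.
Proof. by case: q => [[pc [|ph]] cn] //=; rewrite /flips /=; case: instr_at => // -[]. Qed.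

Definition targets (i : instr) : seq nat :=
  match i with
  | IPush _ _ nx => [:: nx]
  | IGet _ nn n0 n1 => [:: nn; n0; n1]
  | IJmp nx => [:: nx]
  | IOut _ => [::]
  end.
Definition uses (i : instr) : seq nat :=
  match i with
  | IPush j _ _ => [:: j]
  | IGet (SPop j) _ _ _ => [:: j]
  | _ => [::]
  end.

(** Outside the code [instr_at] returns an [IOut], which has no target; so this bounds every address
    reached and the state set is finite. *)
Definition maxpc := \max_(i < size code) \max_(a <- targets (instr_at code i)) a.

Hypothesis usesK : all (fun i => all (fun j => j < K) (uses i)) code.

Lemma mem_targets pc a : a \in targets (instr_at code pc) -> a <= maxpc.
Proof.
case: (ltnP pc (size code)) => H; last by rewrite /instr_at nth_default.
move=> Ha; apply: leq_trans (leq_bigmax (Ordinal H)).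
exact: (@leq_bigmax_seq _ _ xpredT id a).
Qed.

Lemma mem_uses pc j : j \in uses (instr_at code pc) -> j < K.
Proof.
case: (ltnP pc (size code)) => H; last by rewrite /instr_at nth_default.
by move/(all_nthP (IOut false)): usesK => /(_ _ H) /allP; apply.
Qed.

Definition okst (q : mst) := [&& q.1.1 <= maxpc, phase q < 12 & q.2 <= K].

Lemma mdelta_ok q a b : okst q -> okst (mdelta q a b).1.1.
Proof.
case: q => [[pc ph] cn] /and3P /= [Hpc Hph Hcn].
have Ht := @mem_targets pc; have Hu := @mem_uses pc.
have Hch : forall v x nn n0 n1, instr_at code pc = IGet x nn n0 n1 ->
    choose3 v nn n0 n1 <= maxpc.
  by move=> v x nn n0 n1 E; apply: Ht; rewrite E !inE; case: v => [[]|] /=; rewrite eqxx ?orbT.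
have HK : forall j, j \in uses (instr_at code pc) -> j <= K by move=> j /Hu /ltnW.
rewrite /okst.
case: ph Hph => [|[|[|[|[|[|[|[|[|[|[|[|ph]]]]]]]]]]]] Hph //=.
all: try by rewrite ?leq0n ?Hpc.
- case E: (instr_at code pc) => [j c nx|[j| |] nn n0 n1|nx|c] //=; rewrite ?Hpc //.
  + by rewrite HK // E inE.
  + by rewrite HK // E inE.
  + by rewrite Ht // E !inE; case: b; rewrite eqxx ?orbT.
  + by rewrite Ht // E inE.
- case: cn Hcn => [|cn] Hcn /=; last by rewrite Hpc ltnW.
  case: a => [a|] /=; first by rewrite Hpc /=.
  case E: (instr_at code pc) => [j c nx|[j| |] nn n0 n1| |] //=.
    by rewrite Ht ?E ?inE //= HK // E inE.
  by rewrite Hpc HK // E inE.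
- case: cn Hcn => [|cn] Hcn /=; last by rewrite Hpc ltnW.
  by case: a => [a|] /=; rewrite Hpc ?leqnn.
- case: cn Hcn => [|cn] Hcn /=; last by rewrite Hpc ltnW.
  case E: (instr_at code pc) => [|[j| |] nn n0 n1| |] //=.
  case: a => [a|] /=; last by rewrite Hpc leq_subr.
  by rewrite Ht // E !inE eqxx.
- case: cn Hcn => [|cn] Hcn /=; last by rewrite Hpc ltnW.
  case E: (instr_at code pc) => [|[j| |] nn n0 n1| |] //=.
  by rewrite (Hch _ _ _ _ _ E) /= HK // E /= inE.
- case: a => [a|] /=; last by rewrite Hpc.
  case E: (instr_at code pc) => [| x nn n0 n1| |] //=.
  by rewrite -[X in X <= _]/(choose3 (Some a) nn n0 n1) (Hch _ _ _ _ _ E).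
- by case: a => [a|] /=; rewrite ?Hpc.
Qed.

Let state := ('I_maxpc.+1 * 'I_12 * 'I_K.+1)%type.

Definition menc0 (q : mst) : state := (inord q.1.1, inord (phase q), inord q.2).
Definition mdec0 (s : state) : mst := (s.1.1 : nat, s.1.2 : nat, s.2 : nat).
(** A [TM] starts in [ord0], so this index is set apart for phase 10 and the triples are numbered
    from 1 on. *)
Definition menc (q : mst) : 'I_#|{: state}|.+1 := lift ord0 (enum_rank (menc0 q)).
Definition mdec (i : 'I_#|{: state}|.+1) : mst :=
  if unlift ord0 i is Some k then mdec0 (enum_val k) else (0, 10, 0).

Lemma mencK q : okst q -> mdec (menc q) = q.
Proof.
case: q => [[pc ph] cn] /and3P /= [Hpc Hph Hcn].
by rewrite /mdec /menc liftK enum_rankK /mdec0 /menc0 /= !inordK.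
Qed.

Definition mkTM : TM := {|
  tm_k := #|{: state}|;
  tm_delta := fun i a coin =>
    let: (q, b, mv) := mdelta (mdec i) a coin in (menc q, b, mv);
  tm_halt := menc (0, 9, 0) |}.

End TuringMachine.

(** * Runs of the machine on an abstract tape, and their coins *)

Section Simulation.
Variables (code : seq instr) (K : nat).
Hypothesis usesK : all (fun i => all (fun j => j < K) (uses i)) code.
Let M := mkTM code K.
Let W := K.+1.
Notation okst := (okst code K).
Notation mdelta := (mdelta code K).
Notation flips := (flips code).
Definition qhalt : mst := (0, 9, 0).
Definition qstart : mst := (0, 10, 0).

Implicit Types (T : nat -> option bool).

(** Position 0 holds the last input symbol, and nothing is said of the cells to its right. The
    second alternative for [i] is the start state, whose index is not a value of [menc]. *)
Definition represents (c : config M) (q : mst) T (x : nat) : Prop :=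
  let: (i, l, a, r) := c in
  [/\ i = menc code K q \/ i = ord0 /\ q = qstart, a = T x,
      forall k, nth None l k = T (x + k).+1 &
      forall k, k < x -> nth None r k = T (x - k.+1)].

Definition acfg := (mst * (nat -> option bool) * nat * seq bool)%type.

(** The list in the configuration holds the coins of the program, consumed only where [flips] holds,
    whereas a real run reads one at every step. The condition [mv -> 0 < x] keeps the head on the
    part of the tape that [represents] describes. *)
Inductive areach : nat -> acfg -> acfg -> Prop :=
| ar0 u : areach 0 u u
| arS q T x r q' b mv t u :
    q != qhalt -> (flips q -> r != [::]) ->
    mdelta q (T x) (flips q && head false r) = (q', b, mv) -> (mv -> 0 < x) ->
    areach t (q', upd T x b, (if mv then x.-1 else x.+1),
              (if flips q then behead r else r)) u ->
    areach t.+1 (q, T, x, r) u.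

Lemma areach_trans t1 t2 u v w : areach t1 u v -> areach t2 v w -> areach (t1 + t2) u w.
Proof. by elim=> // q T x r q' b mv t u' Hq Hf Hd Hm _ IH /IH; exact: arS. Qed.

Lemma arS_phase q T x r q' b mv t u :
    phase q != 9 -> (flips q -> r != [::]) ->
    mdelta q (T x) (flips q && head false r) = (q', b, mv) -> (mv -> 0 < x) ->
    areach t (q', upd T x b, (if mv then x.-1 else x.+1),
              (if flips q then behead r else r)) u ->
    areach t.+1 (q, T, x, r) u.
Proof. by move=> Hq; apply: arS; apply: contraNneq Hq => ->. Qed.

Lemma arS_stay q T x r q' mv t u :
  phase q != 9 -> ~~ flips q -> mdelta q (T x) false = (q', T x, mv) ->
  (mv -> 0 < x) ->
  areach t (q', T, (if mv then x.-1 else x.+1), r) u ->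
  areach t.+1 (q, T, x, r) u.
Proof.
move=> Hq Hf Hd Hm H; apply: (arS_phase (q' := q') (b := T x) (mv := mv)) => //.
- by rewrite (negbTE Hf).
- by rewrite (negbTE Hf).
- by rewrite upd_id (negbTE Hf).
Qed.

Lemma okst_start : okst qstart. Proof. by []. Qed.

Lemma represents_mdec i l a r q T x :
  okst q -> represents (i, l, a, r) q T x -> mdec i = q.
Proof.
move=> Hok [[->|[-> ->]] _ _ _]; first by rewrite mencK.
by rewrite /mdec unlift_none.
Qed.

Lemma represents_halt (c : config M) q T x : okst q -> represents c q T x ->
  halted c = (q == qhalt).
Proof.
case: c => [[[i l] a] r] Hok H; have := represents_mdec Hok H.
rewrite /halted /= /M => Hd; apply/eqP/eqP => [E|E].
  by rewrite -Hd E mencK.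
by case: H => [[->|[_ H]] _ _ _]; [rewrite E | rewrite E in H].
Qed.

Lemma step_represents (c : config M) q T x coin q' b mv :
  okst q -> represents c q T x -> q != qhalt ->
  mdelta q (T x) coin = (q', b, mv) -> (mv -> 0 < x) ->
  okst q' /\ represents (step coin c) q' (upd T x b) (if mv then x.-1 else x.+1).
Proof.
move=> Hok Hr Hq Hd Hm.
split; first by have := mdelta_ok usesK (T x) coin Hok; rewrite Hd.
have Hh := represents_halt Hok Hr.
case: c Hr Hh => [[[i l] a] r] Hr; have Hi := represents_mdec Hok Hr.
case: Hr => [_ Ha Hl Hrr]; rewrite /halted /= (negbTE Hq) => Hh.
rewrite Hh Hi Ha Hd.
case: mv Hd Hm => Hd Hm.
  have Hx := Hm isT.
  split=> //; first by left.
  - by rewrite -nth0 Hrr // updE -subn1 ifF //; apply/eqP; lia.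
  - case=> [|k] /=; rewrite updE.
      by rewrite ifT //; apply/eqP; lia.
    by rewrite ifF; [rewrite Hl; congr T; lia|apply/eqP; lia].
  - move=> k Hk; rewrite nth_behead Hrr; last by lia.
    by rewrite updE ifF; [congr T; lia|apply/eqP; lia].
split=> //; first by left.
- by rewrite -nth0 Hl addn0 updE ifF //; apply/eqP; lia.
- move=> k; rewrite nth_behead Hl updE ifF; last by apply/eqP; lia.
  by congr T; lia.
- case=> [|k] Hk /=; rewrite updE.
    by rewrite ifT //; apply/eqP; lia.
  by rewrite ifF; [rewrite Hrr; [congr T; lia|lia]|apply/eqP; lia].
Qed.

Lemma run_from_cons (N : TM) t i b cs (c : config N) :
  run_from t i.+1 (b :: cs) c = run_from t i cs c.
Proof. by elim: t i c => //= t IH i c; rewrite IH. Qed.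

Lemma run_from_halted (N : TM) t i cs (c : config N) :
  halted c -> run_from t i cs c = c.
Proof.
elim: t i c => //= t IH i c Hc.
have -> : forall b, step b c = c; last exact: IH.
by move=> b; case: c Hc => [[[q l] a] r]; rewrite /halted /= => ->.
Qed.

Section Probability.
Variable R : realType.

Fixpoint avg (t : nat) (F : seq bool -> R) : R :=
  if t is t'.+1 then
    ((avg t' (fun r => F (true :: r)) + avg t' (fun r => F (false :: r))) / 2)%R
  else F [::].

Lemma eq_avg t F G : (forall r, size r = t -> F r = G r) -> avg t F = avg t G.
Proof.
elim: t F G => [|t IH] F G H /=; first exact: H.
by congr ((_ + _) / 2)%R; apply: IH => r Hr; apply: H; rewrite /= Hr.
Qed.

Lemma mean_id (x : R) : ((x + x) / 2 = x)%R.
Proof. by rewrite -mulr2n -[(x *+ 2)%R]mulr_natr mulfK ?pnatr_eq0. Qed.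

Lemma avg_const t x : avg t (fun=> x) = x.
Proof. by elim: t => //= t ->; exact: mean_id. Qed.

Lemma areach0 u v : areach 0 u v -> u = v.
Proof. by move E: 0 => t H; case: H E. Qed.

Lemma areach_halt t T x r u : areach t (qhalt, T, x, r) u -> u = (qhalt, T, x, r).
Proof.
move E: (qhalt, T, x, r) => v H; case: H E => // q T' x' r' q' b mv t' u' Hq _ _ _ _ [E].
by rewrite -E eqxx in Hq.
Qed.

Lemma areach_inv t q T x r T' x' r' : q != qhalt ->
  areach t (q, T, x, r) (qhalt, T', x', r') ->
  exists t1 q' b mv, [/\ t = t1.+1, flips q -> r != [::],
    mdelta q (T x) (flips q && head false r) = (q', b, mv), mv -> 0 < x &
    areach t1 (q', upd T x b, if mv then x.-1 else x.+1,
               if flips q then behead r else r) (qhalt, T', x', r')].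
Proof.
move=> Hq; move E: (q, T, x, r) => u; move E': (qhalt, T', x', r') => u' Hr.
case: Hr E E' => [v <- [Eq]|q1 T1 x1 r1 q1' b1 mv1 t1 v _ Hr1 Hd1 Hm1 Ha].
  by rewrite Eq eqxx in Hq.
by move=> [-> -> -> ->] _; exists t1, q1', b1, mv1.
Qed.

Lemma run_avg_halted t (c : config M) q T x Q (o : seq bool -> bool) :
  okst q -> represents c q T x -> q = qhalt ->
  (forall r, size r = Q -> exists t' T' x',
     [/\ t' <= t, areach t' (q, T, x, r) (qhalt, T', x', [::]) & T' x' = Some (o r)]) ->
  avg t (fun cs => ((head false (output (run_from t 0 cs c)))%:R)%R) =
  avg Q (fun r => ((o r)%:R)%R)
  /\ forall cs, size cs = t -> halted (run_from t 0 cs c).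
Proof.
move=> Hok Hrep Eq H.
have [t' [T' [x' [_ Hr HT]]]] := H (nseq Q false) (size_nseq _ _).
rewrite Eq in Hr; case: (areach_halt Hr) => ET Ex EQ.
(* The halting state reaches only itself, so no coin can be left to consume. *)
have Q0 : Q = 0 by move: (size_nseq Q false); rewrite -EQ.
have Hh : halted c by rewrite (represents_halt Hok Hrep) Eq.
split; last by move=> cs _; rewrite run_from_halted.
rewrite (@eq_avg _ _ (fun=> ((o [::])%:R)%R)) ?avg_const; last first.
  move=> cs _; rewrite run_from_halted //.
  rewrite ET Ex Q0 in HT; case: (c) Hrep => [[[i l] a] r'] [_ -> _ _] /=.
  by rewrite HT.
by rewrite Q0.
Qed.

(* A step that does not flip wastes its coin, so the coins of the machine and
   those of the program give the same average. *)
Lemma run_avg t (c : config M) q T x Q (o : seq bool -> bool) :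
  okst q -> represents c q T x ->
  (forall r, size r = Q -> exists t' T' x',
     [/\ t' <= t, areach t' (q, T, x, r) (qhalt, T', x', [::]) & T' x' = Some (o r)]) ->
  avg t (fun cs => ((head false (output (run_from t 0 cs c)))%:R)%R) =
  avg Q (fun r => ((o r)%:R)%R)
  /\ forall cs, size cs = t -> halted (run_from t 0 cs c).
Proof.
elim: t c q T x Q o => [|t IH] c q T x Q o Hok Hrep H.
  apply: (run_avg_halted Hok Hrep _ H).
  have [t' [T' [x' [Ht' Hr HT]]]] := H (nseq Q false) (size_nseq _ _).
  by move: Ht' Hr; rewrite leqn0 => /eqP -> /areach0 [].
have [Eq|Hq] := eqVneq q qhalt; first exact: (run_avg_halted Hok Hrep Eq H).
have run1 b cs : run_from t.+1 0 (b :: cs) c = run_from t 0 cs (step b c).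
  by rewrite /= run_from_cons.
(* This serves flipping and other steps alike: after the machine coin [b], [Q'] program coins
   remain, and each string [r] of them is what the step leaves of some [r']. *)
have main b Q' o' : (forall r, size r = Q' -> exists r', [/\ size r' = Q, o r' = o' r,
      forall a, mdelta q a (flips q && head false r') = mdelta q a b &
      (flips q -> r' != [::]) -> (if flips q then behead r' else r') = r]) ->
    avg t (fun cs => ((head false (output (run_from t 0 cs (step b c))))%:R)%R) =
      avg Q' (fun r => ((o' r)%:R)%R)
      /\ forall cs, size cs = t -> halted (run_from t 0 cs (step b c)).
  move=> Hr'; case Hd : (mdelta q (T x) b) => [[q' w] mv].
  have Hmv : mv -> 0 < x.
    have [r' [Hs _ Hb _]] := Hr' (nseq Q' false) (size_nseq _ _).
    have [t' [T' [x' [_ Hr _]]]] := H _ Hs.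
    have [t1 [q1 [b1 [mv1 [_ _ Hd1 Hm1 _]]]]] := areach_inv Hq Hr.
    by rewrite Hb Hd in Hd1; case: Hd1 => _ _ ->.
  have [Hok' Hrep'] := step_represents Hok Hrep Hq Hd Hmv.
  apply: (IH _ _ _ _ _ _ Hok' Hrep') => r Hr.
  have [r' [Hs Ho Hb Hbr]] := Hr' _ Hr.
  have [t' [T' [x' [Ht' Ha HT]]]] := H _ Hs.
  have [t1 [q1 [b1 [mv1 [Et Hfl Hd1 Hm1 Ha1]]]]] := areach_inv Hq Ha.
  rewrite Hb Hd in Hd1; case: Hd1 => E1 E2 E3; subst.
  by exists t1, T', x'; rewrite -Ho -(Hbr Hfl).
case: (boolP (flips q)) => Hf.
  case: Q H main => [|Q] H main.
    have [t' [T' [x' [_ Hr _]]]] := H [::] erefl.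
    have [t1 [q1 [b1 [mv1 [_ Hfl _ _ _]]]]] := areach_inv Hq Hr.
    by have := Hfl Hf.
  have {}main b := main b Q (fun r => o (b :: r)).
  have {}main b : avg t (fun cs => ((head false (output (run_from t 0 cs (step b c))))%:R)%R) =
      avg Q (fun r => ((o (b :: r))%:R)%R)
      /\ forall cs, size cs = t -> halted (run_from t 0 cs (step b c)).
    by apply: main => r Hr; exists (b :: r); rewrite /= Hr Hf.
  split.
    rewrite [RHS]/= -!(proj1 (main _)) [LHS]/=.
    by congr ((_ + _) / 2)%R; apply: eq_avg => r _; rewrite run_from_cons.
  by case=> // b cs [Hcs]; rewrite run1; apply: (proj2 (main b)).
have {}main b : avg t (fun cs => ((head false (output (run_from t 0 cs (step b c))))%:R)%R) =
      avg Q (fun r => ((o r)%:R)%R)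
      /\ forall cs, size cs = t -> halted (run_from t 0 cs (step b c)).
  by apply: main => r Hr; exists r; split=> // a; rewrite (negbTE Hf) //; exact: mdelta_coin.
split.
  rewrite -[RHS]mean_id -{1}(proj1 (main true)) -(proj1 (main false)) [LHS]/=.
  by congr ((_ + _) / 2)%R; apply: eq_avg => r _; rewrite run_from_cons.
by case=> // b cs [Hcs]; rewrite run1; apply: (proj2 (main b)).
Qed.

End Probability.
End Simulation.

(** * Single instructions carried out on the tape *)

Section FlatSimulation.
Variables (code : seq instr) (K : nat).
Hypothesis usesK : all (fun i => all (fun j => j < K) (uses i)) code.
Let W := K.+1.
Notation areach := (areach code K).
Notation mdelta := (mdelta code K).
Notation flips := (flips code).
Implicit Types (T : nat -> option bool).

Lemma areach_walk1 c pc T x r :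
  areach c ((pc, 1, c), T, x, r) ((pc, 1, 0), T, x + c, r).
Proof.
elim: c x => [|c IH] x; first by rewrite addn0; constructor.
by apply: (arS_stay (q' := (pc, 1, c)) (mv := false)) => //=; rewrite addnS -addSn.
Qed.

Lemma areach_walkR ph c pc T x r : ph \in [:: 2; 4; 5] -> c <= x ->
  areach c ((pc, ph, c), T, x, r) ((pc, ph, 0), T, x - c, r).
Proof.
move=> Hph; elim: c x => [|c IH] x Hx; first by rewrite subn0; constructor.
have -> : x - c.+1 = x.-1 - c by lia.
have Hx' : c <= x.-1 by lia.
move: (IH _ Hx') => {IH} IH; move: IH Hph.
by rewrite !inE => IH /or3P [] /eqP ?; subst ph;
  apply: (@arS_stay _ _ (_, _, _) _ _ _ _ true) (IH) => //= _; lia.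
Qed.

Lemma areach_climb d pc T x r : (forall i, i < d -> T (x + i * W) != None) ->
  areach (d * W) ((pc, 1, 0), T, x, r) ((pc, 1, 0), T, x + d * W, r).
Proof.
elim: d x => [|d IH] x H; first by rewrite mul0n addn0; constructor.
have -> : x + d.+1 * W = x + W + d * W by rewrite mulSn addnA.
have -> : d.+1 * W = (K + d * W).+1 by rewrite mulSn.
have H0 := H 0 isT; rewrite mul0n addn0 in H0.
apply: (arS_stay (q' := (pc, 1, K)) (mv := false)) => //.
  by rewrite /=; case: (T x) H0.
apply: areach_trans (areach_walk1 _ _ _ _ _) _.
have -> : x.+1 + K = x + W by rewrite addSn -addnS.
apply: IH => i Hi.
have -> : x + W + i * W = x + i.+1 * W by rewrite mulSn addnA.
exact: H.
Qed.

(** The head cannot stand still: at the base it steps off to the left and back, whence the [+ 2]. *)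
Lemma areach_home d pc T B r : T B != None ->
  (forall i, i < d -> T (B + i.+1 * W) = None) ->
  areach (d * W + 2) ((pc, 2, 0), T, B + d * W, r) ((pc, 0, 0), T, B, r).
Proof.
move=> HB; elim: d => [|d IH] H.
  rewrite mul0n add0n addn0.
  apply: (arS_stay (q' := (pc, 3, 0)) (mv := false)) => //.
    by rewrite /=; case: (T B) HB.
  by apply: (arS_stay (q' := (pc, 0, 0)) (mv := true)) => //; constructor.
have Hd := H d (leqnn _); rewrite mulSn in Hd.
have HW : W = K.+1 by [].
have -> : d.+1 * W + 2 = (K + (d * W + 2)).+1 by lia.
rewrite mulSn.
apply: (arS_stay (q' := (pc, 2, K)) (mv := true)) => //; first by rewrite /= Hd.
  by move=> _; lia.
apply: areach_trans (areach_walkR _ _ _ _ _) _ => //; first by lia.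
have -> : (B + (W + d * W)).-1 - K = B + d * W by lia.
by apply: IH => i Hi; apply: H; lia.
Qed.

Definition tape_of T (B : nat) (s : st) : Prop :=
  [/\ T B = Some true, forall d, T (B + d.+1 * W) = None,
      forall j d, j < K -> T (B + d * W + j.+1) = nth None (map Some (rev (stk s j))) d &
      size (inp s) <= B /\ forall i, i < B ->
        T (B - i.+1) = nth None (nseq (B - size (inp s)) None ++ map Some (inp s)) i].

(** Division with remainder by [W]: remainder 0 is the marker column, and each stack has one of the
    other remainders. *)
Lemma cell_inj d j d' j' : j < K -> j' < K ->
  d * W + j.+1 = d' * W + j'.+1 -> d = d' /\ j = j'.
Proof.
move=> Hj Hj' E.
have Hd : (d * W + j.+1) %/ W = d by rewrite divnMDl // divn_small ?addn0.
have Hd' : (d' * W + j'.+1) %/ W = d' by rewrite divnMDl // divn_small ?addn0.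
have Ed : d = d' by rewrite -Hd E Hd'.
by split=> //; move: E; rewrite Ed => /addnI [].
Qed.

Lemma cell_marker d j d' : j < K -> d * W + j.+1 <> d' * W.
Proof.
move=> Hj E; have := congr1 (fun x => x %% W) E.
by rewrite modnMDl modnMl modn_small.
Qed.

Lemma nth_None_map_Some (l : seq bool) i :
  (nth None (map Some l) i == None) = (size l <= i).
Proof.
case: ltnP => H; first by rewrite (nth_map false).
by rewrite nth_default ?size_map.
Qed.

Lemma tape_upd_stack T B s j d v l : j < K -> tape_of T B s ->
  (forall d', nth None (map Some (rev l)) d' =
     if d' == d then v else nth None (map Some (rev (stk s j))) d') ->
  tape_of (upd T (B + d * W + j.+1) v) B (setk s j l).
Proof.
move=> Hj [HB HM HS [Hi1 Hi2]] Hl; split.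
- by rewrite updE ifF //; apply/eqP; lia.
- move=> d'; rewrite updE ifF //; apply/eqP => E.
  by apply: (@cell_marker d j d'.+1 Hj); lia.
- move=> j' d' Hj'; rewrite updE [stk _ _]/= updE.
  case: (eqVneq j' j) => [->|Hne].
    rewrite Hl; case: (eqVneq d' d) => [->|Hne]; first by rewrite eqxx.
    rewrite ifF ?HS //; apply/eqP => E; case/eqP: Hne.
    by apply: (proj1 (@cell_inj d' j d j Hj Hj _)); lia.
  rewrite ifF ?HS //; apply/eqP => E; case/eqP: Hne.
  by apply: (proj2 (@cell_inj d' j' d j Hj' Hj _)); lia.
- split=> // i Hi; rewrite updE ifF ?Hi2 //; apply/eqP; lia.
Qed.

Lemma areach_find pc T B s j r : j < K -> tape_of T B s ->
  let d := size (stk s j) in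
  areach (j + d * W) ((pc, 1, j), T, B.+1, r) ((pc, 1, 0), T, B + d * W + j.+1, r)
  /\ T (B + d * W + j.+1) = None.
Proof.
move=> Hj [HB HM HS _] d; split; last first.
  by rewrite HS //; apply/eqP; rewrite nth_None_map_Some size_rev.
apply: areach_trans (areach_walk1 _ _ _ _ _) _.
have -> : B + d * W + j.+1 = (B.+1 + j) + d * W by lia.
apply: areach_climb => i Hi.
have -> : B.+1 + j + i * W = B + i * W + j.+1 by lia.
by rewrite HS // nth_None_map_Some size_rev -ltnNge.
Qed.

Lemma areach_push pc T B s r j b nx D : instr_at code pc = IPush j b nx ->
  tape_of T B s -> size (stk s j) <= D ->
  exists t T', [/\ t <= 2 * D * W + 2 * K + 4,
    areach t ((pc, 0, 0), T, B, r) ((nx, 0, 0), T', B, r) &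
    tape_of T' B (setk s j (b :: stk s j))].
Proof.
move=> HI HT HD.
have Hj : j < K by apply: (mem_uses usesK (pc := pc)); rewrite HI inE.
have Hfl ph cn : flips (pc, ph, cn) = false by rewrite /flips /= HI andbF.
have [Hfind Hnone] := areach_find pc r Hj HT.
set d := size (stk s j) in Hfind Hnone HD *.
set T' := upd T (B + d * W + j.+1) (Some b).
have HT' : tape_of T' B (setk s j (b :: stk s j)).
  apply: tape_upd_stack => // d'; rewrite rev_cons map_rcons nth_rcons size_map size_rev -/d.
  case: ltngtP => //.
  by move=> Hlt; rewrite nth_default // size_map size_rev ltnW.
have [HB HM _ _] := HT'.
exists ((j + d * W).+1 + (j + (d * W + 2)).+1), T'; split=> //.
  have : d * W <= D * W by rewrite leq_mul2r HD orbT.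
  lia.
apply: areach_trans (_ : areach _ _ ((pc, 1, 0), T, B + d * W + j.+1, r)) _.
  by apply: (arS_stay (q' := (pc, 1, j)) (mv := false)) => //;
    [rewrite Hfl | rewrite /= HI].
apply: (arS_phase (q' := (nx, 2, j)) (b := Some b) (mv := true)) => //.
- by rewrite Hfl /= Hnone HI.
- by move=> _; lia.
rewrite Hfl -/T'.
apply: areach_trans (areach_walkR _ _ _ _ _) _ => //; first by lia.
rewrite (_ : _ - j = B + d * W); last by lia.
by apply: areach_home => //; rewrite HB.
Qed.

(** The first free cell of the column lies at level [d], the height of the stack. A non-blank in the
    marker column of that level is the base, so the stack is empty; otherwise the top element, at
    level [d - 1], is [K - j] cells to the right of the marker column. *)
Lemma areach_pop pc T B s r j nn n0 n1 D : instr_at code pc = IGet (SPop j) nn n0 n1 ->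
  tape_of T B s -> size (stk s j) <= D ->
  exists t T', [/\ t <= 2 * D * W + 2 * K + 4,
    areach t ((pc, 0, 0), T, B, r) ((choose3 (ohead (stk s j)) nn n0 n1, 0, 0), T', B, r) &
    tape_of T' B (setk s j (behead (stk s j)))].
Proof.
move=> HI HT HD.
have Hj : j < K by apply: (mem_uses usesK (pc := pc)); rewrite HI inE.
have Hfl ph cn : flips (pc, ph, cn) = false by rewrite /flips /= HI andbF.
have [Hfind Hnone] := areach_find pc r Hj HT.
have [HB HM HS _] := HT.
set d := size (stk s j) in Hfind Hnone HD *.
have Hstart : areach (1 + (j + d * W) + 1 + j) ((pc, 0, 0), T, B, r) ((pc, 4, 0), T, B + d * W, r).
  rewrite (_ : 1 + _ + 1 + j = (j + d * W + j.+1).+1); last by lia.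
  apply: (arS_stay (q' := (pc, 1, j)) (mv := false)) => //.
  - by rewrite Hfl.
  - by rewrite /= HI.
  apply: areach_trans (Hfind) _.
  apply: (arS_stay (q' := (pc, 4, j)) (mv := true)) => //.
  - by rewrite /= Hnone HI.
  - by move=> _; lia.
  have Hw := @areach_walkR 4 j pc T (B + d * W + j.+1).-1 r isT.
  rewrite (_ : _ - j = B + d * W) in Hw; last by lia.
  by apply: Hw; lia.
case Es : (stk s j) => [|b l].
  have d0 : d = 0 by rewrite /d Es.
  exists (1 + (j + d * W) + 1 + j + 2), T; split=> /=.
  - by rewrite d0; lia.
  - apply: areach_trans Hstart _; rewrite d0 mul0n addn0.
    apply: (arS_stay (q' := (nn, 3, 0)) (mv := false)) => //.
    + by rewrite /= HI HB.
    by apply: (arS_stay (q' := (nn, 0, 0)) (mv := true)) => //; constructor.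
  - by rewrite -Es /setk upd_id; case: (s) HT.
have dS : d = (size l).+1 by rewrite /d Es.
set p := size l in dS.
set T' := upd T (B + p * W + j.+1) None.
have Hrev : rev (stk s j) = rcons (rev l) b by rewrite Es rev_cons.
have HT' : tape_of T' B (setk s j l).
  apply: tape_upd_stack => // d'; rewrite Hrev map_rcons nth_rcons size_map size_rev -/p.
  case: ltngtP => //.
    by move=> Hlt; rewrite nth_default // size_map size_rev ltnW.
  by move=> ->; rewrite nth_default // size_map size_rev.
have [HB' HM' _ _] := HT'.
exists (1 + (j + d * W) + 1 + j + (1 + (K - j.+1) + (j + (p * W + 2)).+1)), T'; split=> /=.
- have : d * W <= D * W by rewrite leq_mul2r HD orbT.
  by rewrite dS mulSn /W; lia.
- apply: areach_trans Hstart _; apply: areach_trans (_ : areach _ _ ((pc, 5, 0), T, B + p * W + j.+1, r)) _.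
    apply: (arS_stay (q' := (pc, 5, K - j.+1)) (mv := true)) => //.
    + by rewrite /= HI dS HM.
    + by rewrite dS mulSn /W; lia.
    have Hw := @areach_walkR 5 (K - j.+1) pc T (B + d * W).-1 r isT.
    rewrite (_ : _ - (K - _) = B + p * W + j.+1) in Hw; last by rewrite dS mulSn /W; lia.
    by apply: Hw; rewrite dS mulSn /W; lia.
  apply: (arS_phase (q' := (choose3 (Some b) nn n0 n1, 2, j)) (b := None) (mv := true)) => //.
  + have -> : T (B + p * W + j.+1) = Some b.
      by rewrite HS // Hrev map_rcons nth_rcons size_map size_rev ltnn eqxx.
    by rewrite Hfl /= HI.
  + by move=> _; lia.
  rewrite Hfl -/T'.
  apply: areach_trans (areach_walkR _ _ _ _ _) _ => //; first by lia.
  rewrite (_ : _ - j = B + p * W); last by lia.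
  by apply: areach_home => //; rewrite HB'.
- by [].
Qed.

Lemma areach_gap6 g pc T x r nn n0 n1 y : instr_at code pc = IGet SIn nn n0 n1 ->
  (forall i, i < g -> T (x - i) = None) -> g <= x -> y = x - g ->
  areach g ((pc, 6, 0), T, x, r) ((pc, 6, 0), T, y, r).
Proof.
move=> HI H Hg -> {y}; elim: g x H Hg => [|g IH] x H Hg; first by rewrite subn0; constructor.
have H0 := H 0 isT; rewrite subn0 in H0.
apply: (arS_stay (q' := (pc, 6, 0)) (mv := true)) => //.
- by rewrite /= H0.
- by move=> _; lia.
have -> : x - g.+1 = x.-1 - g by lia.
apply: IH; last by lia.
by move=> i Hi; rewrite -(H i.+1) //; congr T; lia.
Qed.

Lemma areach_gap7 g pc T x r :
  (forall i, i < g -> T (x + i) = None) ->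
  areach g ((pc, 7, 0), T, x, r) ((pc, 7, 0), T, x + g, r).
Proof.
elim: g x => [|g IH] x H; first by rewrite addn0; constructor.
have H0 := H 0 isT; rewrite addn0 in H0.
apply: (arS_stay (q' := (pc, 7, 0)) (mv := false)) => //.
- by rewrite /= H0.
rewrite -addSnnS; apply: IH => i Hi.
by rewrite -(H i.+1) //; congr T; lia.
Qed.

Lemma areach_read pc T B s r b l nn n0 n1 : instr_at code pc = IGet SIn nn n0 n1 ->
  tape_of T B s -> inp s = b :: l ->
  exists t T', [/\ t <= 2 * B + 4,
    areach t ((pc, 0, 0), T, B, r) ((choose3 (Some b) nn n0 n1, 0, 0), T', B, r) &
    tape_of T' B (St (stk s) l (coins s))].
Proof.
move=> HI [HB HM HS [Hi1 Hi2]] Ei.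
have Hfl ph cn : flips (pc, ph, cn) = false by rewrite /flips /= HI andbF.
rewrite Ei /= in Hi1 Hi2; set g := B - (size l).+1 in Hi2.
set T' := upd T (B - g.+1) None.
have Hblank i : i <= g -> T' (B - i.+1) = None.
  move=> Hi; rewrite /T' updE; case: eqP => // Hne.
  by rewrite Hi2 ?nth_cat ?nth_nseq ?size_nseq; [case: ltnP => // Hg; case: Hne; congr subn; lia|lia].
have HT'B : T' B = Some true by rewrite /T' updE ifF //; apply/eqP; lia.
have HT' : tape_of T' B (St (stk s) l (coins s)).
  split=> //.
  - by move=> d; rewrite /T' updE ifF //; apply/eqP; lia.
  - by move=> j d Hj; rewrite /T' updE ifF ?HS //; apply/eqP; lia.
  - split=> /= [|i Hi]; first by lia.
    have -> : B - size l = g.+1 by lia.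
    rewrite nth_cat nth_nseq size_nseq; case: ltnP => Hg.
      by apply: Hblank.
    rewrite /T' updE ifF; last by apply/eqP; lia.
    rewrite Hi2 // nth_cat size_nseq ltnNge (ltnW Hg) /=.
    by have -> : i - g = (i - g.+1).+1 by lia.
exists (1 + g + 1 + g.+1 + 2 - 1), T'; split=> //; first by lia.
have -> : 1 + g + 1 + g.+1 + 2 - 1 = (g + (g + 2).+1).+1 by lia.
apply: (arS_stay (q' := (pc, 6, 0)) (mv := true)) => //.
- by rewrite Hfl.
- by rewrite /= HI.
- by move=> _; lia.
apply: areach_trans (areach_gap6 (g := g) (y := B - g.+1) _ HI _ _ _) _.
- move=> i Hi; have -> : B.-1 - i = B - i.+1 by lia.
  by rewrite Hi2 ?nth_cat ?nth_nseq ?size_nseq ?Hi //; lia.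
- by lia.
- by lia.
apply: (arS_phase (q' := (choose3 (Some b) nn n0 n1, 7, 0)) (b := None) (mv := false)) => //.
- by rewrite Hfl /= Hi2 ?nth_cat ?size_nseq ?ltnn ?subnn ?HI //=; lia.
rewrite Hfl -/T' -subSn; last by lia.
rewrite subSS; apply: areach_trans (areach_gap7 (g := g) _ _ _) _.
  move=> i Hi; have -> : B - g + i = B - (g - i.+1).+1 by lia.
  by apply: Hblank; lia.
have -> : B - g + g = B by lia.
apply: (arS_stay (q' := (choose3 (Some b) nn n0 n1, 3, 0)) (mv := false)) => //.
  by rewrite /= HT'B.
by apply: (arS_stay (q' := (choose3 (Some b) nn n0 n1, 0, 0)) (mv := true)) => //; constructor.
Qed.

Lemma areach_fstep pc s pc' s' T B D : fstep code (pc, s) = Some (pc', s') ->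
  tape_of T B s -> (forall j, size (stk s j) <= D) ->
  exists t T', [/\ t <= 2 * D * W + 2 * K + 2 * B + 4,
    areach t ((pc, 0, 0), T, B, coins s) ((pc', 0, 0), T', B, coins s'),
    tape_of T' B s' & forall j, size (stk s' j) <= D.+1].
Proof.
rewrite /fstep /=; case HI: (instr_at code pc) => [j b nx|x nn n0 n1|nx|b] //.
- case=> <- <- HT HD.
  have [t [T' [Ht Ha HT']]] := areach_push (coins s) HI HT (HD j).
  exists t, T'; split=> //; first by lia.
  by move=> j'; rewrite /= updE; case: eqP => _ /=; [have := HD j|have := HD j']; lia.
- case: x HI => [j| |] HI /=.
  + case=> <- <- HT HD.
    have [t [T' [Ht Ha HT']]] := areach_pop (coins s) HI HT (HD j).
    exists t, T'; split=> //; first by lia.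
    move=> j'; rewrite /= updE; case: eqP => _; last by apply: leqW.
    by rewrite size_behead; have := HD j; lia.
  + case Ei: (inp s) => [//|b l] [<- <-] HT HD.
    have [t [T' [Ht Ha HT']]] := areach_read (coins s) HI HT Ei.
    exists t, T'; split=> //; first by lia.
    by move=> j'; apply: leqW (HD j').
  + case Ec: (coins s) => [//|b l] [<- <-] HT HD.
    exists 2, T; split=> //; first by lia.
      apply: (arS_phase (q' := (choose3 (Some b) nn n0 n1, 3, 0)) (b := T B) (mv := false)) => //.
        by rewrite /flips /= HI /=; case: b {Ec}.
      rewrite upd_id /= /flips /= HI /=.
      by apply: (arS_stay (q' := (choose3 (Some b) nn n0 n1, 0, 0)) (mv := true)) => //; constructor.
    by move=> j'; apply: leqW (HD j').
- case=> <- <- HT HD; exists 2, T; split=> //; first by lia.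
    apply: (arS_stay (q' := (nx, 3, 0)) (mv := false)) => //.
    + by rewrite /flips /= HI.
    + by rewrite /= HI.
    by apply: (arS_stay (q' := (nx, 0, 0)) (mv := true)) => //; constructor.
  by move=> j; apply: leqW (HD j).
Qed.

(** A stack grows by at most one per instruction, so all heights stay within [D + n], and an
    instruction costs one walk linear in the height and in [B]. *)
Lemma areach_fsteps n pc s pc' s' T B D : fsteps code n (pc, s) = Some (pc', s') ->
  tape_of T B s -> (forall j, size (stk s j) <= D) ->
  exists t T', [/\ t <= n * (2 * (D + n) * W + 2 * K + 2 * B + 4),
    areach t ((pc, 0, 0), T, B, coins s) ((pc', 0, 0), T', B, coins s') &
    tape_of T' B s'].
Proof.
elim: n pc s T D => [|n IH] pc s T D /=.
  by case=> -> -> HT _; exists 0, T; split=> //; constructor.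
case E: (fstep code (pc, s)) => [[pc1 s1]|] //= Hn HT HD.
have [t1 [T1 [Ht1 Ha1 HT1 HD1]]] := areach_fstep E HT HD.
have [t2 [T2 [Ht2 Ha2 HT2]]] := IH _ _ _ _ Hn HT1 HD1.
exists (t1 + t2), T2; split=> //; last exact: areach_trans Ha1 Ha2.
rewrite mulSn; apply: leq_add.
  apply: leq_trans Ht1 _; rewrite !leq_add2r leq_mul2r leq_mul2l leq_addr.
  by rewrite orbT.
by rewrite -[D + n.+1]addSnnS.
Qed.

Lemma areach_out pc b T B r : instr_at code pc = IOut b ->
  exists T', areach 2 ((pc, 0, 0), T, B, r) (qhalt, T', B, r) /\ T' B = Some b.
Proof.
move=> HI; exists (upd T B (Some b)); split; last by rewrite updE eqxx.
have Hfl : flips (pc, 0, 0) = false by rewrite /flips /= HI.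
apply: (arS_phase (q' := (0, 8, 0)) (b := Some b) (mv := false)) => //.
- by rewrite Hfl.
- by rewrite Hfl /= HI.
rewrite Hfl.
by apply: (arS_stay (q' := (0, 9, 0)) (mv := true)) => //; constructor.
Qed.

Definition initst (w r : seq bool) := St (fun=> [::]) w r.

Definition inittape (w : seq bool) : nat -> option bool :=
  fun x => if x < size w then nth None (map Some w) (size w - x.+1) else None.

(** The marker is written just to the left of the input. The start position [(size w).-1] is that of
    the first symbol only for a nonempty word; the last disjunct sets the empty one aside. *)
Lemma areach_init w r : exists T,
  areach 3 (qstart, inittape w, (size w).-1, r) ((0, 0, 0), T, size w, r) /\
  tape_of T (size w) (initst w r) \/ w = [::].
Proof.
case: w => [|b w]; first by exists (inittape [::]); right.
set v := b :: w; exists (upd (inittape v) (size v) (Some true)); left; split.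
  apply: (arS_stay (q' := (0, 11, 0)) (mv := false)) => //.
  apply: (arS_phase (q' := (0, 3, 0)) (b := Some true) (mv := false)) => //=.
  by apply: (arS_stay (q' := (0, 0, 0)) (mv := true)) => //; constructor.
split=> //.
- by rewrite updE eqxx.
- by move=> d; rewrite updE ifF ?/inittape ?ifF //; first apply/eqP; rewrite /W; lia.
- move=> j d Hj; rewrite updE ifF; last by apply/eqP; lia.
  by rewrite /inittape ifF ?nth_nil //; lia.
split=> [|i Hi]; first by [].
rewrite updE ifF; last by apply/eqP; lia.
rewrite /inittape ifT; last by lia.
by rewrite subnn cat0s [inp _]/=; congr nth; lia.
Qed.

End FlatSimulation.

(** * From stack programs to probabilistic Turing machines *)

Definition code_of (c : cmd) (out : nat) : seq instr :=
  let n := csize c in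
  comp c 0 n ++ [:: IGet (SPop out) n.+1 n.+1 n.+2; IOut false; IOut true].

Fixpoint cuses (K : nat) (c : cmd) : bool :=
  match c with
  | CSkip => true
  | CPush j _ => j < K
  | CSeq c1 c2 => cuses K c1 && cuses K c2
  | CCase x cn c0 c1 =>
      [&& if x is SPop j then j < K else true, cuses K cn, cuses K c0 & cuses K c1]
  | CLoop j c0 c1 => [&& j < K, cuses K c0 & cuses K c1]
  end.

Lemma comp_uses K c base next : cuses K c ->
  all (fun i => all (fun j => j < K) (uses i)) (comp c base next).
Proof.
elim: c base next => //= [j b base next ->//|c1 IH1 c2 IH2|x cn IHn c0 IH0 c1 IH1|j c0 IH0 c1 IH1] base next.
- by case/andP=> H1 H2; rewrite all_cat IH1 ?IH2.
- by case/and4P=> Hx Hn H0 H1; rewrite !all_cat IHn ?IH0 ?IH1 //; case: x Hx => //= j ->.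
- by case/and3P=> -> H0 H1; rewrite all_cat IH0 ?IH1.
Qed.

Definition machine (K out : nat) (c : cmd) : TM := mkTM (code_of c out) K.

Lemma tuple_fold (R : realType) t (F : seq bool -> R) :
  (\sum_(r : t.-tuple bool) F r = (2 ^ t)%:R * avg t F)%R.
Proof.
elim: t F => [|t IH] F.
  rewrite (big_pred1 [tuple]) ?expn0 ?mul1r //.
  by move=> r; apply/esym/eqP; exact: tuple0.
rewrite /= (reindex (fun p : bool * t.-tuple bool => [tuple of p.1 :: p.2])) /=; last first.
  exists (fun r : t.+1.-tuple bool => (thead r, [tuple of behead r])).
    by case=> b r _; congr pair; apply: val_inj.
  by move=> r _; rewrite [RHS]tuple_eta.
rewrite -(pair_bigA _ (fun b (r : t.-tuple bool) => F (b :: r))) /=.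
rewrite big_bool /= !(IH (fun r => F (_ :: r))) -mulrDr expnS mulnC natrM -[RHS]mulrA.
by congr (_ * _)%R; rewrite [RHS]mulrC divfK ?pnatr_eq0.
Qed.

(** The sets counted in [Pr_exceptional] and [sparse3] are classical ones, whose membership becomes
    boolean only through [asbool]. *)
Lemma card_classical_set (T : finType) (P : pred T) :
  #|([set x | P x])%classic| = \sum_x P x.
Proof.
rewrite -sum1_card big_mkcond /=; apply: eq_bigr => x _.
by rewrite -[LHS]/(if `[< P x >] then 1 else 0) asboolb; case: (P x).
Qed.

Lemma Pr_exceptional_avg (R : realType) A t w :
  Pr_exceptional R A t w =
  avg t (fun r => ((head false (output (run A t w r)))%:R)%R).
Proof.
rewrite /Pr_exceptional card_classical_set natr_sum.
have := tuple_fold t (fun r => ((head false (output (run A t w r)))%:R)%R : R).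
by move=> /= ->; rewrite mulrC mulKf // pnatr_eq0 -lt0n expn_gt0.
Qed.

(** That [Q] is the same for all coin strings makes [avg Q] the acceptance probability. In the time
    bound, 3 steps install the marker, one instruction beyond [N] pops the answer, and 2 steps write
    it. *)
Lemma machine_correct (R : realType) K out c w t Q N (o : seq bool -> bool) :
  w != [::] -> out < K -> cuses K c ->
  (forall r, size r = Q -> exists n s',
     [/\ n <= N, exec c (initst w r) s' n, coins s' = [::] &
         stk s' out = if o r then [:: true] else [::]]) ->
  3 + N.+1 * (2 * N.+1 * K.+1 + 2 * K + 2 * size w + 4) + 2 <= t ->
  halts_within (machine K out c) w t /\
  Pr_exceptional R (machine K out c) t w = avg Q (fun r => ((o r)%:R)%R).
Proof.
move=> Hw Hout Hc H Ht.
set code := code_of c out.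
have Hu : all (fun i => all (fun j => j < K) (uses i)) code.
  by rewrite /code /code_of all_cat comp_uses //= Hout.
have Hrep : represents (code := code) (K := K) (init_config (machine K out c) w)
    qstart (inittape w) (size w).-1.
  split=> /=; first by right.
  - by case: (w) Hw => //= b w' _; rewrite /inittape /= leqnn subnn.
  - by move=> k; rewrite nth_nil /inittape ifF //; lia.
  - move=> k Hk; rewrite nth_behead /inittape ifT; last by lia.
    by congr nth; lia.
have Hcode i : i < 3 -> instr_at code (csize c + i) =
    instr_at [:: IGet (SPop out) (csize c).+1 (csize c).+1 (csize c).+2; IOut false; IOut true] i.
  move=> Hi; rewrite /instr_at /code /code_of nth_cat size_comp ltnNge leq_addr /=.
  by rewrite addKn.
have Hcomp : code_at code 0 (comp c 0 (csize c)).
  by move=> i Hi; rewrite /instr_at /code /code_of nth_cat Hi.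
have [] := @run_avg code K Hu R t _ _ _ _ Q o (okst_start _ _) Hrep.
  move=> r Hr; have [n [s' [Hn He Hcs Ho]]] := H r Hr.
  have [T0 [[Ha0 HT0]|E]] := areach_init Hu w r; last by rewrite E in Hw.
  have Hf := comp_correct He Hcomp.
  have Hf2 : fsteps code n.+1 (0, initst w r) =
      Some (if o r then (csize c).+2 else (csize c).+1, setk s' out [::]).
    rewrite -addn1 (fsteps_add _ Hf) /= /fstep /=.
    rewrite -[X in instr_at _ X]addn0 Hcode //= Ho.
    by case: (o r).
  have [t1 [T1 [Ht1 Ha1 HT1]]] := areach_fsteps Hu Hf2 HT0 (D := 0) (fun=> leq0n _).
  have Hpc : instr_at code (if o r then (csize c).+2 else (csize c).+1) = IOut (o r).
    by case: (o r); [rewrite -addn2 Hcode|rewrite -addn1 Hcode].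
  have [T2 [Ha2 HT2]] := areach_out K T1 (size w) (coins (setk s' out [::])) Hpc.
  exists (3 + t1 + 2), T2, (size w); split=> //.
    apply: leq_trans Ht; rewrite leq_add2r leq_add2l; apply: leq_trans Ht1 _.
    rewrite add0n; apply: leq_mul; first by [].
    by rewrite !leq_add2r leq_mul2r leq_mul2l ltnS Hn orbT.
  rewrite -addnA; apply: areach_trans Ha0 _; apply: areach_trans Ha1 _.
  by rewrite /= Hcs in Ha2 *.
move=> Havg Hhalt; split; first by move=> r; apply: Hhalt; rewrite size_tuple.
by rewrite Pr_exceptional_avg.
Qed.

(** * The reduction as a stack program *)

Definition runs c s s' T := exists2 t, exec c s s' t & t <= T.

Lemma runs_conv c s s1 s' T1 T :
  runs c s s1 T1 -> s1 = s' -> T1 <= T -> runs c s s' T.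
Proof. by move=> [t H Ht] <- HT; exists t => //; apply: leq_trans HT. Qed.

Lemma runs_skip s : runs CSkip s s 1.
Proof. by exists 1 => //; constructor. Qed.

Lemma runs_push j b s : runs (CPush j b) s (setk s j (b :: stk s j)) 1.
Proof. by exists 1 => //; constructor. Qed.

Lemma runs_seq c1 c2 s s1 s2 T1 T2 :
  runs c1 s s1 T1 -> runs c2 s1 s2 T2 -> runs (CSeq c1 c2) s s2 (T1 + T2).
Proof.
move=> [t1 H1 Ht1] [t2 H2 Ht2]; exists (t1 + t2); last exact: leq_add.
exact: ex_seq H1 H2.
Qed.

Lemma setk_id s j : setk s j (stk s j) = s.
Proof. by rewrite /setk upd_id; case: s. Qed.

Lemma runs_pop0 j cn c0 c1 s s' T : stk s j = [::] ->
  runs cn s s' T -> runs (CCase (SPop j) cn c0 c1) s s' T.+1.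
Proof.
move=> Hj [t H Ht]; exists t.+1 => //.
apply: (ex_case (v := None) (s' := s)) => //.
by rewrite /fetch Hj; congr (Some (_, _)); rewrite -[behead _]/[::] -Hj setk_id.
Qed.

Lemma runs_pop1 j cn c0 c1 s s' T b l : stk s j = b :: l ->
  runs (if b then c1 else c0) (setk s j l) s' T ->
  runs (CCase (SPop j) cn c0 c1) s s' T.+1.
Proof.
move=> Hj [t H Ht]; exists t.+1 => //.
apply: (ex_case (v := Some b) (s' := setk s j l)); first by rewrite /= Hj.
by case: b {Hj} H.
Qed.

Lemma runs_read cn c0 c1 s s' T b l : inp s = b :: l ->
  runs (if b then c1 else c0) (St (stk s) l (coins s)) s' T ->
  runs (CCase SIn cn c0 c1) s s' T.+1.
Proof.
move=> Hj [t H Ht]; exists t.+1 => //.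
apply: (ex_case (v := Some b) (s' := St (stk s) l (coins s))); first by rewrite /= Hj.
by case: b {Hj} H.
Qed.

Lemma runs_flip cn c0 c1 s s' T b l : coins s = b :: l ->
  runs (if b then c1 else c0) (St (stk s) (inp s) l) s' T ->
  runs (CCase SCoin cn c0 c1) s s' T.+1.
Proof.
move=> Hj [t H Ht]; exists t.+1 => //.
apply: (ex_case (v := Some b) (s' := St (stk s) (inp s) l)); first by rewrite /= Hj.
by case: b {Hj} H.
Qed.

Lemma runs_loop0 j c0 c1 s : stk s j = [::] -> runs (CLoop j c0 c1) s s 1.
Proof. by move=> Hj; exists 1 => //; apply: ex_loop0. Qed.

Lemma runs_loop1 j c0 c1 s b l s1 s' T1 T2 : stk s j = b :: l ->
  runs (if b then c1 else c0) (setk s j l) s1 T1 ->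
  runs (CLoop j c0 c1) s1 s' T2 -> runs (CLoop j c0 c1) s s' (T1 + T2).+1.
Proof.
move=> Hj [t1 H1 Ht1] [t2 H2 Ht2]; exists (t1 + t2).+1; last by rewrite ltnS leq_add.
exact: ex_loop1 Hj H1 H2.
Qed.

Arguments upd T f j x i /.
Arguments setk s j x /.

(** Stores are functions, so they are compared pointwise, testing the index against each stack
    number that occurs. *)
Ltac upd_cases :=
  match goal with
  | i : nat |- context [?x == ?k] =>
      constr_eq x i;
      let E := fresh "E" in
      case: (eqVneq i k) => E; [rewrite ?E|try (by rewrite eqxx in E)]; clear E; simpl; try done; try upd_cases
  end.

Ltac st_eq :=
  simpl; congr St; try (apply: funext; let i := fresh "i" in move=> i; simpl; try done; try upd_cases).

Notation "c1 ;; c2" := (CSeq c1 c2) (at level 60, right associativity).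

Ltac sym1 :=
  lazymatch goal with
  | |- runs (CSeq _ _) _ _ _ => eapply runs_seq
  | |- runs (CPush _ _) _ _ _ => eapply runs_push
  | |- runs CSkip _ _ _ => eapply runs_skip
  end.
Ltac sym := repeat sym1.

Definition move j k := CLoop j (CPush k false) (CPush k true).
Definition clear j := CLoop j CSkip CSkip.
Definition nrep k (c : cmd) := iter k (CSeq c) CSkip.

Lemma runs_move j k s : j != k ->
  runs (move j k) s (setk (setk s j [::]) k (catrev (stk s j) (stk s k)))
    (2 * size (stk s j) + 1).
Proof.
move=> /negbTE Hjk; have Hkj : (k == j) = false by rewrite eq_sym.
move El: (stk s j) => l; elim: l s El => [|b l IH] s El.
  apply: runs_conv (runs_loop0 _ _ El) _ _ => //.
  by rewrite -[in LHS](setk_id s j) El -[in LHS](setk_id (setk s j [::]) k) /= Hkj.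
have Hb : (if b then CPush k true else CPush k false) = CPush k b by case: b {El}.
apply: runs_conv; first apply: (runs_loop1 El); first by rewrite Hb; apply: runs_push.
- apply: IH => /=.
  by rewrite Hjk eqxx.
- by st_eq; rewrite ?eqxx ?Hjk ?Hkj.
- by rewrite /=; lia.
Qed.

Lemma runs_clear j s :
  runs (clear j) s (setk s j [::]) (2 * size (stk s j) + 1).
Proof.
move El: (stk s j) => l; elim: l s El => [|b l IH] s El.
  by apply: runs_conv (runs_loop0 _ _ El) _ _ => //; rewrite -El setk_id.
apply: runs_conv; first apply: (runs_loop1 El).
- by rewrite (_ : (if b then _ else _) = CSkip); [apply: runs_skip|case: b {El}].
- by apply: IH => /=; rewrite eqxx.
- by st_eq.
- by rewrite /=; lia.
Qed.

(** * The stacks of the refuter; reading numbers *)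

Notation kB := 0 (only parsing).    (* a binary number, top bit on top *)
Notation kU := 1 (only parsing).    (* its unary value *)
Notation kV := 2 (only parsing).    (* scratch *)
Notation kNB := 3 (only parsing).   (* binary n *)
Notation kUN := 4 (only parsing).   (* unary n *)
Notation kUN2 := 5 (only parsing).  (* tokens of [kUN] already used *)
Notation kMQ := 6 (only parsing).   (* binary sample size *)
Notation kKB := 7 (only parsing).   (* binary m, read as the number of index coins *)
Notation kUM := 8 (only parsing).   (* unary m *)
Notation kUM2 := 9 (only parsing).  (* tokens of [kUM] already used *)
Notation kUQ := 10 (only parsing).  (* unary sample size *)
Notation kE := 11 (only parsing).   (* clauses already passed, reversed *)
Notation kP := 12 (only parsing).   (* clauses ahead *)
Notation kX := 13 (only parsing).   (* input under construction, reversed *)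
Notation kCS := 14 (only parsing).  (* signs to substitute *)
Notation kSQ := 15 (only parsing).  (* simulated machine: state in unary *)
Notation kGO := 16 (only parsing).  (* loop control *)
Notation kLT := 17 (only parsing).  (* its tape, left of the head *)
Notation kRT := 18 (only parsing).  (* its tape, from the head on *)
Notation kZ := 19 (only parsing).   (* hypothesis, reversed *)
Notation kSP := 20 (only parsing).  (* positive part of the score *)
Notation kSN := 21 (only parsing).  (* negative part of the score *)
Notation kOUT := 22 (only parsing).
Notation kT := 23 (only parsing).   (* scratch *)
Notation nstacks := 24 (only parsing).

Notation utrue k := (nseq k true).

Definition dbl := CLoop kU CSkip (CPush kV true ;; CPush kV true) ;; move kV kU.

Lemma catrev_nseq (T : Type) a b (x : T) : catrev (nseq a x) (nseq b x) = nseq (a + b) x.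
Proof. by elim: a b => //= a IH b; rewrite -[x :: nseq b x]/(nseq b.+1 x) IH addnS. Qed.

Lemma catrev_nseq0 (T : Type) a (x : T) : catrev (nseq a x) [::] = nseq a x.
Proof. by rewrite -[[::]]/(nseq 0 x) catrev_nseq addn0. Qed.

Lemma runs_dbl s a : stk s kU = utrue a -> stk s kV = [::] ->
  runs dbl s (setk s kU (utrue a.*2)) (7 * a + 2).
Proof.
move=> HU HV.
have Hloop : forall a s c, stk s kU = utrue a -> stk s kV = utrue c ->
    runs (CLoop kU CSkip (CPush kV true ;; CPush kV true)) s
      (setk (setk s kU [::]) kV (utrue (a.*2 + c))) (3 * a + 1).
  elim=> [|a' IH] s' c HU' HV'.
    apply: runs_conv (runs_loop0 _ _ HU') _ _ => //.
    by case: s' HU' HV' => f i r /= HU' HV'; st_eq.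
  apply: runs_conv; first apply: (runs_loop1 HU') => /=; first by sym.
  - by apply: (IH _ c.+2) => //=; rewrite HV'.
  - by st_eq; rewrite !addnS.
  - by lia.
apply: runs_conv; first apply: runs_seq.
- by apply: (Hloop a _ 0).
- by apply: runs_move.
- by st_eq; rewrite ?HV // addn0 catrev_nseq0.
- by rewrite /= addn0 size_nseq; lia.
Qed.

Definition bval a (l : seq bool) := foldl (fun a (b : bool) => a.*2 + b) a l.

Lemma bval_ge a l : a <= bval a l.
Proof. by elim: l a => //= b l IH a; apply: leq_trans (IH _); lia. Qed.

(* Horner's rule, from the top bit down. *)
Definition tounary := CLoop kB dbl (dbl ;; CPush kU true).

Lemma runs_tounary s a l : stk s kB = l -> stk s kU = utrue a -> stk s kV = [::] ->
  runs tounary s (setk (setk s kB [::]) kU (utrue (bval a l)))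
    (size l * (7 * bval a l + 4) + 1).
Proof.
elim: l a s => [|b l IH] a s HB HU HV.
  apply: runs_conv (runs_loop0 _ _ HB) _ _ => //.
  by case: s HB HU HV => f i r /= HB HU HV; st_eq.
apply: runs_conv; first apply: (runs_loop1 HB).
- instantiate (2 := setk (setk s kB l) kU (utrue (a.*2 + b))).
  instantiate (1 := 7 * a + 3).
  case: b HB => HB.
    apply: runs_conv; first apply: runs_seq; [by apply: runs_dbl => /=; [exact: HU|exact: HV]|by sym|by st_eq; rewrite addn1|lia].
  by apply: runs_conv; [by apply: runs_dbl => /=; [exact: HU|exact: HV]|st_eq; rewrite addn0|lia].
- by apply: IH.
- by st_eq.
- have := bval_ge (a.*2 + b) l; rewrite /= -/(bval _ _) => H.
  have : size l * (7 * bval (a.*2 + b) l + 4) = size l * (7 * bval (a.*2 + b) l + 4) by [].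
  by rewrite mulSn; lia.
Qed.

Definition pushes js b := foldr (fun j c => CPush j b ;; c) CSkip js.

Lemma runs_pushes js b s : uniq js ->
  runs (pushes js b) s
    (St (fun i => if has (eq_op i) js then b :: stk s i else stk s i) (inp s) (coins s))
    (size js + 1).
Proof.
elim: js s => [|j js IH] s /= Hu.
  by apply: runs_conv (runs_skip _) _ _ => //; case: s.
case/andP: Hu => Hj Hu.
apply: runs_conv; first apply: runs_seq; [by sym|by apply: IH| |by rewrite /=; lia].
congr St; apply: funext => i /=; case: (eqVneq i j) => [->|Hij] //=.
by rewrite ifF //; apply/hasP => -[k Hk /eqP E]; rewrite E Hk in Hj.
Qed.

(* Reads a self-delimited number and pushes its bits on all the stacks [js]. *)
Definition parse js :=
  CPush kGO true ;;
  CLoop kGO CSkip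
    (CCase SIn CSkip (CCase SIn CSkip CSkip CSkip)
       (CCase SIn CSkip (pushes js false ;; CPush kGO true)
                        (pushes js true ;; CPush kGO true))).

Lemma runs_parse js s l rest : uniq js -> ~~ has (eq_op kGO) js ->
  inp s = delim l ++ rest -> stk s kGO = [::] ->
  runs (parse js) s
    (St (fun i => if has (eq_op i) js then catrev l (stk s i) else stk s i)
        rest (coins s))
    (size l * (size js + 5) + 6).
Proof.
move=> Hu Hgo Hi HG.
have Hloop : forall l s, inp s = delim l ++ rest -> stk s kGO = [:: true] ->
    runs (CLoop kGO CSkip
      (CCase SIn CSkip (CCase SIn CSkip CSkip CSkip)
         (CCase SIn CSkip (pushes js false ;; CPush kGO true)
                          (pushes js true ;; CPush kGO true)))) s
    (St (fun i => if i == kGO then [::] else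
                  if has (eq_op i) js then catrev l (stk s i) else stk s i)
        rest (coins s))
    (size l * (size js + 5) + 5).
  move=> {s l Hi HG}; elim=> [|b l IH] s Hi HG.
    apply: runs_conv; first apply: (runs_loop1 HG) => /=.
    - apply: (@runs_read _ _ _ _ _ _ false (false :: rest)) => //=.
      by apply: (@runs_read _ _ _ _ _ _ false rest) => //=; sym.
    - exact: runs_loop0.
    - by st_eq; case: has.
    - by [].
  apply: runs_conv; first apply: (runs_loop1 HG) => /=.
  - apply: (@runs_read _ _ _ _ _ _ true (b :: delim l ++ rest)) => //=.
    apply: (@runs_read _ _ _ _ _ _ b (delim l ++ rest)) => //=.
    instantiate (2 := St (fun i => if i == kGO then [:: true] else
       if has (eq_op i) js then b :: stk s i else stk s i) (delim l ++ rest) (coins s)).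
    rewrite (_ : (if b then _ else _) = (pushes js b ;; CPush kGO true)); last by case: b {Hi}.
    apply: runs_conv; first apply: runs_seq; [by apply: runs_pushes|by sym| |exact: leqnn].
    by st_eq; rewrite (negbTE Hgo).
  - by apply: IH.
  - by st_eq; case: has.
  - by rewrite /= mulSn; lia.
apply: runs_conv; first apply: runs_seq; [by sym|by apply: (Hloop l) => //=; rewrite HG| |lia].
by st_eq; rewrite (negbTE Hgo) HG.
Qed.

(** * Binary numerals *)

Lemma nbits_auxE f n : n <= f -> nbits_aux f n = nbits n.
Proof.
rewrite /nbits; elim: f {-2}f n (leqnn f) => [|k IH] f n.
  by rewrite leqn0 => /eqP ->; case: n.
case: f => [_|f Hf]; first by case: n.
case: n => [|n] //= Hn.
by congr cons; rewrite !IH //; lia.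
Qed.

Lemma nbitsE n : 0 < n -> nbits n = odd n :: nbits n./2.
Proof.
case: n => // n _; rewrite {1}/nbits /=; congr cons.
by rewrite nbits_auxE //; lia.
Qed.

Lemma bval_rcons a l b : bval a (rcons l b) = (bval a l).*2 + b.
Proof. by rewrite /bval -cats1 foldl_cat. Qed.

Lemma bval_rev_nbits n : bval 0 (rev (nbits n)) = n.
Proof.
elim: n {-2}n (leqnn n) => [|k IH] n Hn; first by case: n Hn.
case: (posnP n) => [-> //|H0].
rewrite nbitsE // rev_cons bval_rcons IH; last by lia.
by rewrite -[RHS]odd_double_half addnC.
Qed.

Lemma size_nbits n : size (nbits n) <= n.
Proof.
elim: n {-2}n (leqnn n) => [|k IH] n Hn; first by case: n Hn.
case: (posnP n) => [-> //|H0].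
rewrite nbitsE //= ; have := IH n./2; lia.
Qed.

Lemma nbits_size_bounds n : 0 < n -> n < 2 ^ size (nbits n) <= 2 * n.
Proof.
elim: n {-2}n (leqnn n) => [|k IH] n Hn; first by case: n Hn.
move=> H0; rewrite nbitsE //=; case: (posnP n./2) => [H1|H1].
  by rewrite H1 /=; lia.
have Hk : n./2 <= k by lia.
have := IH _ Hk H1; rewrite expnS; lia.
Qed.

(** The program finds the sample size [m %/ 2 ^ e] in this way. *)
Lemma nbits_drop e n : nbits (n %/ 2 ^ e) = drop e (nbits n).
Proof.
elim: e n => [|e IH] n; first by rewrite divn1 drop0.
rewrite expnS divnMA IH divn2.
case: (posnP n) => [-> //|H0].
by rewrite [nbits n]nbitsE.
Qed.

(** This is why the dimension has the form [2 ^ a * n]: its code is written by putting [a] zeros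
    before the bits of [n], without any multiplication. *)
Lemma nbits_shift a n : 0 < n -> nbits (2 ^ a * n) = nseq a false ++ nbits n.
Proof.
move=> H0; elim: a => [|a IH]; first by rewrite mul1n.
rewrite expnS -mulnA nbitsE; last by rewrite muln_gt0 /= muln_gt0 expn_gt0.
by rewrite mul2n doubleK odd_double IH.
Qed.

(** * Sparse vectors as lists of bit pairs *)

Definition unp (v : seq (bool * bool)) := flatten [seq [:: p.1; p.2] | p <- v].
(** Pairs follow [enc_trit]: [(true, false)] is the entry 0, [(false, true)] is +1 and
    [(false, false)] is -1. The pair [(true, true)] codes no entry and so can mark the end of a
    vector. *)
Definition ztrit : bool * bool := (true, false).
Definition zeros k := nseq k ztrit.
Definition litv n i (j : bool) := zeros i ++ (false, ~~ j) :: zeros (n - i.+1).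

Lemma unp_cat u v : unp (u ++ v) = unp u ++ unp v.
Proof. by rewrite /unp map_cat flatten_cat. Qed.

Lemma cat_nseqS (T : Type) n (x : T) l : nseq n x ++ x :: l = x :: nseq n x ++ l.
Proof. by elim: n => //= n ->. Qed.

Definition emit0 := CPush kE true ;; CPush kE false.
Definition zloop := CLoop kUN CSkip (CPush kUN2 true ;; emit0).
Definition zblock := zloop ;; move kUN2 kUN.

Lemma runs_zloop n s : stk s kUN = utrue n ->
  runs zloop s (setk (setk (setk s kUN [::]) kUN2 (utrue n ++ stk s kUN2))
                  kE (catrev (unp (zeros n)) (stk s kE))) (4 * n + 1).
Proof.
elim: n s => [|n IH] s HU.
  by apply: runs_conv (runs_loop0 _ _ HU) _ _ => //; case: s HU => f i r /= HU; st_eq.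
apply: runs_conv; first apply: (runs_loop1 HU) => /=; first by rewrite /emit0; sym.
- by apply: IH.
- by st_eq; rewrite cat_nseqS.
- by lia.
Qed.

Lemma runs_zblock n s : stk s kUN = utrue n -> stk s kUN2 = [::] ->
  runs zblock s (setk s kE (catrev (unp (zeros n)) (stk s kE))) (6 * n + 2).
Proof.
move=> HU HU2; apply: runs_conv.
- by apply: runs_seq; [apply: runs_zloop HU|apply: runs_move].
- by st_eq; rewrite ?HU ?HU2 ?cats0 ?catrev_nseq0.
- by rewrite /= HU2 cats0 size_nseq; lia.
Qed.

Lemma runs_nzblock k n s : stk s kUN = utrue n -> stk s kUN2 = [::] ->
  runs (nrep k zblock) s (setk s kE (catrev (unp (zeros (k * n))) (stk s kE)))
    (k * (6 * n + 2) + 1).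
Proof.
elim: k s => [|k IH] s HU HU2.
  by apply: runs_conv (runs_skip _) _ _ => //; rewrite mul0n setk_id.
apply: runs_conv.
- by apply: runs_seq; [apply: runs_zblock HU HU2|apply: IH => /=; [exact: HU|exact: HU2]].
- by st_eq; rewrite mulSn /zeros nseqD unp_cat catrev_catl.
- by rewrite mulSn; lia.
Qed.

Definition popUN := CCase (SPop kUN) CSkip CSkip CSkip.
Definition litloop := CLoop kU CSkip (popUN ;; CPush kUN2 true ;; emit0).

Lemma runs_popUN n s : stk s kUN = utrue n.+1 ->
  runs popUN s (setk s kUN (utrue n)) 2.
Proof.
by move=> H; apply: (@runs_pop1 _ _ _ _ _ _ _ true (utrue n)) => //; exact: runs_skip.
Qed.

Lemma runs_litloop i n s : stk s kU = utrue i -> stk s kUN = utrue (i + n) ->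
  runs litloop s (setk (setk (setk (setk s kU [::]) kUN (utrue n))
      kUN2 (utrue i ++ stk s kUN2)) kE (catrev (unp (zeros i)) (stk s kE))) (6 * i + 1).
Proof.
elim: i s => [|i IH] s HU HN.
  by apply: runs_conv (runs_loop0 _ _ HU) _ _ => //; case: s HU HN => f k r /= HU HN; st_eq.
apply: runs_conv; first apply: (runs_loop1 HU) => /=.
- by apply: runs_seq; [exact: (@runs_popUN (i + n))|rewrite /emit0; sym].
- by apply: IH.
- by st_eq; rewrite cat_nseqS.
- by rewrite /=; lia.
Qed.

Definition lit :=
  parse [:: kB] ;; tounary ;; litloop ;; popUN ;; CPush kUN2 true ;;
  CPush kE false ;; CCase SIn CSkip (CPush kE true) (CPush kE false) ;; zblock.

Lemma runs_lit n i (j : bool) rest s : i < n -> inp s = enc_nat i ++ j :: rest ->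
  stk s kUN = utrue n -> stk s kUN2 = [::] ->
  stk s kB = [::] -> stk s kU = [::] -> stk s kV = [::] -> stk s kGO = [::] ->
  runs lit s (St (upd (stk s) kE (catrev (unp (litv n i j)) (stk s kE))) rest (coins s))
    (7 * n * n + 25 * n + 20).
Proof.
move=> Hi Hinp HN HN2 HB HU HV HG.
have E : n = i + (n - i.+1).+1 by lia.
have Hs := size_nbits i.
apply: runs_conv.
- apply: runs_seq; first by apply: (@runs_parse _ _ (nbits i) (j :: rest)).
  apply: runs_seq; first by apply: (@runs_tounary _ 0).
  rewrite [stk _ _]/= HB -[catrev _ _]/(rev (nbits i)) bval_rev_nbits.
  apply: runs_seq; first by apply: (@runs_litloop i (n - i.+1).+1) => //=; rewrite HN {1}E.
  apply: runs_seq; first by apply: (@runs_popUN (n - i.+1)).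
  apply: runs_seq; first by sym.
  apply: runs_seq; first by sym.
  apply: runs_seq.
    apply: (@runs_read _ _ _ _ _ _ j rest) => //=.
    rewrite (_ : (if j then _ else _) = CPush kE (~~ j)); last by case: j {Hinp}.
    exact: runs_push.
  apply: runs_seq; first by apply: (@runs_zloop (n - i.+1)).
  exact: runs_move.
- st_eq; rewrite ?HB ?HU ?HN2 ?cats0.
  + by rewrite -[true :: utrue i]/(utrue i.+1) -nseqD catrev_nseq0 HN; congr nseq; lia.
  + by rewrite /litv unp_cat catrev_catl.
- rewrite /= HB HN2 cats0 -[catrev (nbits i) [::]]/(rev (nbits i)) size_rev bval_rev_nbits.
  rewrite size_cat /= !size_nseq.
  have H : size (nbits i) * (7 * i + 4) <= n * (7 * n + 4) by apply: leq_mul; lia.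
  lia.
Qed.

Section Clauses.
Variables (A n : nat).

(** Separate blocks give exactly three nonzero entries even if a variable is repeated; the trailing
    zeros bring the dimension up to [A * n]. *)
Definition clausev (C : clause n) : seq (bool * bool) :=
  flatten [seq litv n (l.1 : nat) l.2 | l : literal n <- tval C] ++ zeros ((A - 3) * n).

Definition cstr (vs : seq (seq (bool * bool))) : seq bool :=
  flatten [seq unp v ++ [:: true; true] | v <- vs].

Lemma cstr_cat u v : cstr (u ++ v) = cstr u ++ cstr v.
Proof. by rewrite /cstr map_cat flatten_cat. Qed.

Definition emit1 := CPush kE true ;; CPush kE true.
Definition pclause :=
  CPush kUM2 true ;; lit ;; lit ;; lit ;; nrep (A - 3) zblock ;; emit1.

Definition Tlit := 7 * n * n + 25 * n + 20.
Definition Tzb k := k * (6 * n + 2) + 1.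

Definition ready (s : st) := [/\ stk s kUN = utrue n, stk s kUN2 = [::],
  stk s kB = [::] & [/\ stk s kU = [::], stk s kV = [::] & stk s kGO = [::]]].

Lemma runs_pclause (C : clause n) rest s :
  inp s = flatten [seq enc_lit l | l <- tval C] ++ rest -> ready s ->
  runs pclause s
    (St (upd (upd (stk s) kUM2 (true :: stk s kUM2))
           kE (catrev (cstr [:: clausev C]) (stk s kE))) rest (coins s))
    (3 * Tlit + Tzb (A - 3) + 3).
Proof.
case: C => [[|l1 [|l2 [|l3 [|? ?]]]] //= Hsz] Hi [HN HN2 HB [HU HV HG]].
have Hi' : inp s = enc_nat l1.1 ++ l1.2 :: (enc_lit l2 ++ enc_lit l3 ++ rest).
  by rewrite Hi /= /enc_lit cats0 -!catA.
apply: runs_conv.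
- apply: runs_seq; first by sym.
  apply: runs_seq; first by apply: (@runs_lit n l1.1 l1.2 (enc_lit l2 ++ enc_lit l3 ++ rest)).
  apply: runs_seq.
    apply: (@runs_lit n l2.1 l2.2 (enc_lit l3 ++ rest)) => //=.
    by rewrite /enc_lit -!catA.
  apply: runs_seq.
    apply: (@runs_lit n l3.1 l3.2 rest) => //=.
    by rewrite /enc_lit -!catA.
  apply: runs_seq; first by apply: (@runs_nzblock _ n).
  by rewrite /emit1; sym.
- by st_eq; rewrite /cstr /clausev /= !cats0 !unp_cat !catrev_catl.
- by rewrite /Tlit /Tzb; lia.
Qed.

Definition enc_clauses (Cs : seq (clause n)) :=
  flatten [seq flatten [seq enc_lit l | l <- tval C] | C <- Cs].

Lemma runs_pclauses (Cs : seq (clause n)) rest s :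
  inp s = enc_clauses Cs ++ rest -> ready s -> stk s kUM = utrue (size Cs) ->
  runs (CLoop kUM CSkip pclause) s
    (St (upd (upd (upd (stk s) kUM [::]) kUM2 (utrue (size Cs) ++ stk s kUM2))
           kE (catrev (cstr (map clausev Cs)) (stk s kE))) rest (coins s))
    (size Cs * (3 * Tlit + Tzb (A - 3) + 4) + 1).
Proof.
elim: Cs s => [|C Cs IH] s Hi Hr HM.
  apply: runs_conv (runs_loop0 _ _ HM) _ _ => //.
  by case: s Hi Hr HM => f i r /= -> _ HM; st_eq.
have [HN HN2 HB [HU HV HG]] := Hr.
apply: runs_conv; first apply: (runs_loop1 HM) => /=.
- apply: (@runs_pclause C (enc_clauses Cs ++ rest)) => //=.
  by rewrite Hi /enc_clauses /= catA.
- by apply: IH.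
- st_eq; rewrite ?cat_nseqS //.
  by rewrite -catrev_catl -cstr_cat.
- by rewrite /= mulSn; lia.
Qed.

Definition pzclause := CPush kUM2 true ;; nrep A zblock ;; emit1.

Lemma runs_pzclauses m s :
  ready s -> stk s kUM = utrue m ->
  runs (CLoop kUM CSkip pzclause) s
    (St (upd (upd (upd (stk s) kUM [::]) kUM2 (utrue m ++ stk s kUM2))
           kE (catrev (cstr (nseq m (zeros (A * n)))) (stk s kE))) (inp s) (coins s))
    (m * (Tzb A + 4) + 1).
Proof.
elim: m s => [|m IH] s Hr HM.
  apply: runs_conv (runs_loop0 _ _ HM) _ _ => //.
  by case: s Hr HM => f i r /= _ HM; st_eq.
have [HN HN2 HB [HU HV HG]] := Hr.
apply: runs_conv; first apply: (runs_loop1 HM) => /=.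
- apply: runs_seq; first by sym.
  apply: runs_seq; first by apply: (@runs_nzblock _ n).
  by rewrite /emit1; sym.
- by apply: IH.
- st_eq; rewrite ?cat_nseqS //.
  by rewrite [in RHS]/cstr /= -/(cstr _) -catA !catrev_catl.
- by rewrite /= mulSn /Tzb; lia.
Qed.

End Clauses.

(* Substitution of the signs [cs] for the successive nonzero entries. *)
Fixpoint subst_signs (cs : seq bool) (v : seq (bool * bool)) :=
  match v with
  | [::] => [::]
  | (true, y) :: v' => (true, y) :: subst_signs cs v'
  | (false, y) :: v' => (false, head false cs) :: subst_signs (behead cs) v'
  end.

Definition copied (md : option bool) cs v :=
  match md with None => [::] | Some true => v | Some false => subst_signs cs v end.

(* Passes over one clause, copying it to [kX] verbatim ([Some true]), with the
   signs on [kCS] substituted ([Some false]), or not at all ([None]). *)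
Definition cpX (md : option bool) (b : bool) := if md is Some _ then CPush kX b else CSkip.
Definition cpnz md y :=
  CPush kE false ;; CPush kE y ;; cpX md false ;;
  (if md is Some false
   then CCase (SPop kCS) (CPush kX false) (CPush kX false) (CPush kX true)
   else cpX md y) ;; CPush kGO true.
Definition ccopy md :=
  CPush kGO true ;;
  CLoop kGO CSkip
    (CCase (SPop kP) CSkip
      (CCase (SPop kP) CSkip (cpnz md false) (cpnz md true))
      (CCase (SPop kP) CSkip
         (CPush kE true ;; CPush kE false ;; cpX md true ;; cpX md false ;; CPush kGO true)
         (CPush kE true ;; CPush kE true))) ;;
  clear kCS.

Lemma runs_cpX md b s : runs (cpX md b) s
  (setk s kX (if md is Some _ then b :: stk s kX else stk s kX)) 1.
Proof. by case: md => [?|]; rewrite ?setk_id; [exact: runs_push|exact: runs_skip]. Qed.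

Lemma runs_cpnz md y s cs : stk s kCS = cs ->
  runs (cpnz md y) s
   (setk (setk (setk (setk s kE [:: y, false & stk s kE])
      kX (if md is Some b then [:: if b then y else head false cs, false & stk s kX] else stk s kX))
      kCS (if md is Some false then behead cs else cs)) kGO (true :: stk s kGO)) 6.
Proof.
move=> Hcs; apply: runs_conv.
- apply: runs_seq; first by sym.
  apply: runs_seq; first by sym.
  apply: runs_seq; first exact: runs_cpX.
  apply: runs_seq; last by sym.
  instantiate (1 := 2).
  instantiate (1 := (setk (setk (setk s kE [:: y, false & stk s kE])
      kX (if md is Some b then [:: if b then y else head false cs, false & stk s kX] else stk s kX))
      kCS (if md is Some false then behead cs else cs))).
  case: md => [[]|].
  + by apply: runs_conv; [exact: runs_cpX|st_eq|].
  + case: cs Hcs => [|b cs] Hcs.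
      by apply: runs_conv; [apply: runs_pop0 => //=; sym|st_eq|].
    by apply: runs_conv; [apply: (@runs_pop1 _ _ _ _ _ _ _ b cs) => //=;
      rewrite (_ : (if b then _ else _) = CPush kX b); [sym|case: b {Hcs}]|st_eq|].
  + by apply: runs_conv; [exact: runs_cpX|st_eq|].
- by st_eq.
- by [].
Qed.

Definition novv (v : seq (bool * bool)) := (true, true) \notin v.

Lemma runs_ccopy md v rest s : novv v -> stk s kGO = [::] ->
  stk s kP = unp v ++ [:: true, true & rest] ->
  runs (ccopy md) s
    (setk (setk (setk (setk s kP rest) kE (catrev (cstr [:: v]) (stk s kE)))
       kX (catrev (unp (copied md (stk s kCS) v)) (stk s kX))) kCS [::])
    (10 * size v + 10 + 2 * size (stk s kCS)).
Proof.
move=> Hv HG HP.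
(* A vector may have fewer nonzero entries than there are signs; [cs'] is what is left of them,
   removed by the final [clear]. *)
have Hloop : forall v s, novv v -> stk s kGO = [:: true] ->
  stk s kP = unp v ++ [:: true, true & rest] -> exists2 cs', size cs' <= size (stk s kCS) &
  runs (CLoop kGO CSkip
    (CCase (SPop kP) CSkip
      (CCase (SPop kP) CSkip (cpnz md false) (cpnz md true))
      (CCase (SPop kP) CSkip
         (CPush kE true ;; CPush kE false ;; cpX md true ;; cpX md false ;; CPush kGO true)
         (CPush kE true ;; CPush kE true)))) s
    (setk (setk (setk (setk (setk s kGO [::]) kP rest) kE (catrev (cstr [:: v]) (stk s kE)))
       kX (catrev (unp (copied md (stk s kCS) v)) (stk s kX))) kCS cs')
    (10 * size v + 6).
  move=> {v s Hv HG HP}; elim=> [|[x y] v IH] s Hv HG HP.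
    exists (stk s kCS) => //.
    apply: runs_conv; first apply: (runs_loop1 HG) => /=.
    + apply: (@runs_pop1 _ _ _ _ _ _ _ true (true :: rest)) => //=.
      by apply: (@runs_pop1 _ _ _ _ _ _ _ true rest) => //=; sym.
    + exact: runs_loop0.
    + by st_eq; case: md => [[]|].
    + by [].
  move: Hv; rewrite /novv inE negb_or => /andP [Hxy Hv].
  case: x Hxy HP => Hxy HP.
    have Hy : y = false by case: y Hxy {HP}.
    subst y.
    set s1 := setk (setk (setk (setk s kP (unp v ++ [:: true, true & rest]))
      kE [:: false, true & stk s kE])
      kX (if md is Some _ then [:: false, true & stk s kX] else stk s kX)) kGO [:: true].
    have [cs' Hcs' Hrun] := IH s1 Hv erefl erefl.
    exists cs' => //.
    apply: runs_conv; first apply: (runs_loop1 HG) => /=.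
    + apply: (@runs_pop1 _ _ _ _ _ _ _ true (false :: unp v ++ [:: true, true & rest])) => //=.
      apply: (@runs_pop1 _ _ _ _ _ _ _ false (unp v ++ [:: true, true & rest])) => //=.
      apply: runs_conv.
      * apply: runs_seq; first by sym.
        apply: runs_seq; first by sym.
        apply: runs_seq; first exact: runs_cpX.
        apply: runs_seq; first exact: runs_cpX.
        by sym.
      * by instantiate (1 := s1); rewrite /s1; st_eq; clear -HG; case: md => [?|].
      * exact: leqnn.
    + exact: Hrun.
    + by rewrite /s1; st_eq; clear; case: md => [[]|].
    + by rewrite /=; lia.
  set s1 := setk (setk (setk (setk (setk s kP (unp v ++ [:: true, true & rest]))
      kE [:: y, false & stk s kE])
      kX (if md is Some b then [:: if b then y else head false (stk s kCS), false & stk s kX] else stk s kX))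
      kCS (if md is Some false then behead (stk s kCS) else stk s kCS)) kGO [:: true].
  have [cs' Hcs' Hrun] := IH s1 Hv erefl erefl.
  exists cs'.
    apply: leq_trans Hcs' _; rewrite /s1 /=; case: (md) => [[]|] //.
    by rewrite size_behead leq_pred.
  apply: runs_conv; first apply: (runs_loop1 HG) => /=.
  + apply: (@runs_pop1 _ _ _ _ _ _ _ false (y :: unp v ++ [:: true, true & rest])) => //=.
    apply: (@runs_pop1 _ _ _ _ _ _ _ y (unp v ++ [:: true, true & rest])) => //=.
    rewrite (_ : (if y then _ else _) = cpnz md y); last by case: y {Hxy HP s1 Hcs' Hrun}.
    apply: runs_conv; first exact: runs_cpnz.
    * by instantiate (1 := s1); rewrite /s1; st_eq.
    * exact: leqnn.
  + exact: Hrun.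
  + by rewrite /s1; st_eq; clear; case: md => [[]|].
  + by rewrite /=; lia.
have [|cs' Hcs' Hrun] := Hloop v (setk s kGO [:: true]) Hv erefl; first by [].
apply: runs_conv.
- apply: runs_seq; first by sym.
  rewrite HG; apply: runs_seq; first exact: Hrun.
  exact: runs_clear.
- by st_eq.
- by rewrite /= in Hcs' *; lia.
Qed.

Lemma runs_skips us rest w s : all (fun v => novv v && (size v <= w)) us ->
  stk s kU = utrue (size us) -> stk s kGO = [::] -> stk s kCS = [::] ->
  stk s kP = cstr us ++ rest ->
  runs (CLoop kU CSkip (ccopy None)) s
    (setk (setk (setk s kU [::]) kP rest) kE (catrev (cstr us) (stk s kE)))
    (size us * (10 * w + 11) + 1).
Proof.
elim: us s => [|v us IH] s Hus HU HG HC HP.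
  apply: runs_conv (runs_loop0 _ _ HU) _ _ => //.
  by case: s HU HG HC HP => f i r /= HU HG HC HP; st_eq.
move: Hus => /= /andP [/andP [Hv Hw] Hus].
apply: runs_conv; first apply: (runs_loop1 HU) => /=.
- apply: (@runs_ccopy None v (cstr us ++ rest)) => //=.
  by rewrite HP /cstr /= -!catA.
- by apply: IH => //=.
- by st_eq; rewrite ?HC // -catrev_catl -cstr_cat.
- by rewrite /= HC [(size us).+1 * _]mulSn /=; lia.
Qed.

(** * Drawing a random sample *)

Definition kbit b := CPush kT b ;; dbl ;; CCase SCoin CSkip CSkip (CPush kU true).

Lemma runs_index cs l r a s : size cs = size l ->
  stk s kKB = l -> coins s = cs ++ r -> stk s kU = utrue a -> stk s kV = [::] ->
  runs (CLoop kKB (kbit false) (kbit true)) s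
    (St (upd (upd (upd (stk s) kKB [::]) kT (catrev l (stk s kT))) kU (utrue (bval a cs)))
       (inp s) r)
    (size l * (7 * bval a cs + 6) + 1).
Proof.
elim: l cs a s => [|b l IH] [|c cs] a s //= Hsz HK HC HU HV.
  apply: runs_conv (runs_loop0 _ _ HK) _ _ => //.
  by case: s HK HC HU HV => f i r' /= HK -> HU HV; st_eq.
case: Hsz => Hsz.
apply: runs_conv; first apply: (runs_loop1 HK).
- rewrite (_ : (if b then _ else _) = kbit b); last by case: b {HK}.
  instantiate (2 := St (upd (upd (upd (stk s) kKB l) kT (b :: stk s kT)) kU (utrue (a.*2 + c)))
    (inp s) (cs ++ r)).
  instantiate (1 := 7 * a + 5).
  apply: runs_conv.
  + apply: runs_seq; first by sym.
    apply: runs_seq; first by apply: runs_dbl => /=; [exact: HU|exact: HV].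
    apply: (@runs_flip _ _ _ _ (St (upd (upd (upd (stk s) kKB l) kT (b :: stk s kT)) kU (utrue (a.*2 + c)))
    (inp s) (cs ++ r)) 1 c (cs ++ r)) => //=.
    case: (c) => /=; apply: runs_conv; [by sym| | by []|by sym| |by []].
      by st_eq; rewrite addn1.
    by st_eq; rewrite addn0.
  + by [].
  + by lia.
- by apply: (IH cs).
- by st_eq.
- have := bval_ge (a.*2 + c) cs; rewrite /= -/(bval _ _) [(size l).+1 * _]mulSn; lia.
Qed.

Definition flipCS := CCase SCoin CSkip (CPush kCS false) (CPush kCS true).

Lemma runs_flipCS c r s : coins s = c :: r ->
  runs flipCS s (St (upd (stk s) kCS (c :: stk s kCS)) (inp s) r) 2.
Proof.
move=> Hc; apply: (@runs_flip _ _ _ _ _ _ c r) => //.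
by case: c {Hc}; apply: runs_conv; [sym|st_eq| |sym|st_eq|].
Qed.

Lemma exec_seq_inv c d s1 s3 t : exec (c ;; d) s1 s3 t ->
  exists s2 t1 t2, [/\ exec c s1 s2 t1, exec d s2 s3 t2 & t = t1 + t2].
Proof.
move E: (c ;; d) => e H; case: H E => // a b u u' u'' t1 t2 H1 H2 [-> ->].
by exists u', t1, t2.
Qed.

(** Programs are compared syntactically and nest to the right, so a prefix treated as one block has
    to be reassociated. *)
Lemma runs_seqA c1 c2 c3 s s' T :
  runs ((c1 ;; c2) ;; c3) s s' T -> runs (c1 ;; c2 ;; c3) s s' T.
Proof.
move=> [t /exec_seq_inv [s1 [t1 [t2 [/exec_seq_inv [s2 [t3 [t4 [H1 H2 ->]]]] H3 ->]]]] Ht].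
by exists (t3 + (t4 + t2)); [apply: ex_seq H1 (ex_seq H2 H3)|rewrite addnA].
Qed.

Lemma runs_seqR c1 c2 c3 c4 s s' T :
  runs (c1 ;; (c2 ;; c3) ;; c4) s s' T -> runs (c1 ;; c2 ;; c3 ;; c4) s s' T.
Proof.
move=> [t /exec_seq_inv [s1 [t1 [t2 [H1 H2 ->]]]] Ht].
have [|t3 H3 Ht3] := @runs_seqA c2 c3 c4 s1 s' t2; first by exists t2.
by exists (t1 + t3); [exact: ex_seq H1 H3|lia].
Qed.

Definition sample :=
  CLoop kKB (kbit false) (kbit true) ;; move kT kKB ;;
  CLoop kU CSkip (ccopy None) ;; flipCS ;; flipCS ;; flipCS ;;
  CCase SCoin CSkip (ccopy (Some false) ;; CPush kX false)
                    (ccopy (Some true) ;; CPush kX true) ;;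
  move kE kP.

(* The example drawn from the coins [ch]: [size ch = K + 4], the first [K] coins
   choose the clause, the next three the signs, the last one the label. *)
Definition exvec (vs : seq (seq (bool * bool))) K (ch : seq bool) :=
  let v := nth [::] vs (bval 0 (take K ch)) in
  let cs := drop K ch in
  if nth false cs 3 then v
  else subst_signs [:: nth false cs 2; nth false cs 1; nth false cs 0] v.
Definition exlab K (ch : seq bool) := nth false (drop K ch) 3.

Definition sready (s : st) := [/\ stk s kU = [::], stk s kV = [::], stk s kT = [::],
  stk s kGO = [::] & stk s kCS = [::] /\ stk s kE = [::]].

Lemma size_unp v : size (unp v) = 2 * size v.
Proof. by elim: v => //= p v IH; rewrite IH mulnS. Qed.

Lemma size_cstr w us : all (fun v => novv v && (size v <= w)) us ->
  size (cstr us) <= size us * (2 * w + 2).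
Proof.
elim: us => //= v us IH /andP [/andP [_ Hw] /IH {}IH].
by rewrite /cstr /= !size_cat size_unp -/(cstr us) mulSn /=; lia.
Qed.

Definition Tsample K N w := K * (7 * N + 6) + 2 * K + N * (14 * w + 15) + 10 * w + 30.

Lemma runs_sample vs K w ch r s : all (fun v => novv v && (size v <= w)) vs ->
  sready s -> size (stk s kKB) = K -> stk s kP = cstr vs ->
  coins s = ch ++ r -> size ch = K + 4 -> bval 0 (take K ch) < size vs ->
  runs sample s
    (St (upd (stk s) kX (catrev (unp (exvec vs K ch) ++ [:: exlab K ch]) (stk s kX)))
       (inp s) r) (Tsample K (size vs) w).
Proof.
move=> Hvs [HU HV HT HG [HC HE]] HK HP Hc Hch Hlt.
have [cs [c1 [c2 [c3 [c0 [Ech Hcs]]]]]] : exists cs c1 c2 c3 c0,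
    ch = cs ++ [:: c1; c2; c3; c0] /\ size cs = K.
  have Hd : size (drop K ch) = 4 by rewrite size_drop Hch addKn.
  have Ht : size (take K ch) = K by rewrite size_takel // Hch leq_addr.
  case E : (drop K ch) Hd => [|c1 [|c2 [|c3 [|c0 [|? ?]]]]] // _.
  by exists (take K ch), c1, c2, c3, c0; rewrite -E cat_take_drop.
have Htake : take K ch = cs by rewrite Ech take_size_cat.
have Hdrop : drop K ch = [:: c1; c2; c3; c0] by rewrite Ech drop_size_cat.
rewrite Htake in Hlt.
set i := bval 0 cs in Hlt.
set v := nth [::] vs i.
have Evs : vs = take i vs ++ v :: drop i.+1 vs.
  by rewrite -(drop_nth [::]) // cat_take_drop.
have Hall : all (fun v => novv v && (size v <= w)) (take i vs ++ v :: drop i.+1 vs) by rewrite -Evs.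
move: Hall; rewrite all_cat /= => /and3P [Htk /andP [Hv Hw] Hdr].
have Hst : size (take i vs) = i by rewrite size_takel // ltnW.
have Hcst := size_cstr Hvs.
set s1 := St (upd (upd (stk s) kP (cstr (v :: drop i.+1 vs))) kE (catrev (cstr (take i vs)) [::]))
  (inp s) (c1 :: c2 :: c3 :: c0 :: r).
have R1 : runs (CLoop kKB (kbit false) (kbit true) ;; move kT kKB ;; CLoop kU CSkip (ccopy None)) s s1
   (K * (7 * size vs + 6) + 1 + (2 * K + 1 + (size vs * (10 * w + 11) + 1))).
  apply: runs_conv.
  - apply: runs_seq; first by apply: (@runs_index cs (stk s kKB) (c1 :: c2 :: c3 :: c0 :: r) 0);
      rewrite ?Hcs ?HK // Hc Ech -catA.
    apply: runs_seq; first exact: runs_move.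
    apply: (@runs_skips (take i vs) (cstr (v :: drop i.+1 vs)) w) => //=.
      by rewrite Hst.
    by rewrite HP {1}Evs cstr_cat.
  - by rewrite /s1; st_eq; rewrite ?HE ?HU ?HT // -[catrev (stk s 7) [::]]/(rev (stk s 7)) -[catrev _ [::]]/(rev _) revK.
  - rewrite HK /= HT -[catrev (stk s 7) [::]]/(rev (stk s 7)) size_rev HK Hst -/i.
    have H1 : K * (7 * i + 6) <= K * (7 * size vs + 6) by rewrite leq_mul2l; apply/orP; right; lia.
    have H2 : i * (10 * w + 11) <= size vs * (10 * w + 11) by rewrite leq_mul2r ltnW // orbT.
    lia.
apply: runs_conv.
- rewrite /sample.
  have Hrun2 : runs (flipCS ;; flipCS ;; flipCS ;;
     CCase SCoin CSkip (ccopy (Some false) ;; CPush kX false)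
                    (ccopy (Some true) ;; CPush kX true) ;; move kE kP) s1
     (St (upd (stk s) kX (catrev (unp (exvec vs K ch) ++ [:: exlab K ch]) (stk s kX)))
       (inp s) r) (2 + (2 + (2 + (10 * w + 18 + (size vs * (4 * w + 4) + 1))))).
    apply: runs_conv.
    + apply: runs_seq; first exact: runs_flipCS.
      apply: runs_seq; first exact: runs_flipCS.
      apply: runs_seq; first exact: runs_flipCS.
      apply: runs_seq.
        apply: (@runs_flip _ _ _ _ _ _ c0 r) => //=.
        instantiate (2 := St (upd (upd (upd (stk s) kP (cstr (drop i.+1 vs)))
           kE (catrev (cstr (take i vs ++ [:: v])) [::]))
           kX (catrev (unp (exvec vs K ch) ++ [:: exlab K ch]) (stk s kX))) (inp s) r).
        instantiate (1 := 10 * w + 17).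
        rewrite /exvec /exlab Htake Hdrop [nth _ _ 3]/= -/i -/v.
        case: (c0) => /=.
          apply: runs_conv.
          * apply: runs_seq; last by sym.
            apply: (@runs_ccopy (Some true) v (cstr (drop i.+1 vs))) => //=.
            by rewrite /cstr /= -catA.
          * by st_eq; rewrite ?HC // ?cstr_cat !catrev_catl.
          * by rewrite /= HC /=; lia.
        apply: runs_conv.
        * apply: runs_seq; last by sym.
          apply: (@runs_ccopy (Some false) v (cstr (drop i.+1 vs))) => //=.
          by rewrite /cstr /= -catA.
        * by st_eq; rewrite ?HC // ?cstr_cat !catrev_catl.
        * by rewrite /= HC /=; lia.
      exact: runs_move.
    + st_eq; rewrite ?HE // -[catrev _ [::]]/(rev _) catrevE revK -cstr_cat -catA.
      by rewrite -Evs HP.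
    + rewrite /= -[catrev _ [::]]/(rev _) size_rev.
      have : size (cstr (take i vs ++ [:: v])) <= size (cstr vs).
        have -> : cstr vs = cstr (take i vs ++ [:: v]) ++ cstr (drop i.+1 vs).
          by rewrite -cstr_cat -catA -Evs.
        by rewrite [leqRHS]size_cat leq_addr.
      lia.
  have HA : forall a b d e, runs ((a ;; b ;; d) ;; e) s
      (St (upd (stk s) kX (catrev (unp (exvec vs K ch) ++ [:: exlab K ch]) (stk s kX)))
        (inp s) r) (Tsample K (size vs) w) ->
      runs (a ;; b ;; d ;; e) s
      (St (upd (stk s) kX (catrev (unp (exvec vs K ch) ++ [:: exlab K ch]) (stk s kX)))
        (inp s) r) (Tsample K (size vs) w).
    by move=> a b d e /runs_seqA H; apply: runs_seqR H.
  apply: HA; apply: runs_conv; first by apply: runs_seq; [exact: R1|exact: Hrun2].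
    by [].
  by rewrite /Tsample; lia.
- by [].
- exact: leqnn.
Qed.

Fixpoint chunks (k M : nat) (cs : seq bool) : seq (seq bool) :=
  if M is M'.+1 then take k cs :: chunks k M' (drop k cs) else [::].

Lemma bval_lt a l : bval a l < a.+1 * 2 ^ size l.
Proof.
elim: l a => [|b l IH] a /=; first by rewrite muln1.
apply: leq_trans (IH _) _; rewrite expnS mulnA leq_mul2r; apply/orP; right.
by case: b; lia.
Qed.

Lemma runs_samples vs K w M cs r s : all (fun v => novv v && (size v <= w)) vs ->
  sready s -> size (stk s kKB) = K -> stk s kP = cstr vs -> stk s kUQ = utrue M ->
  2 ^ K <= size vs -> coins s = cs ++ r -> size cs = M * (K + 4) ->
  runs (CLoop kUQ CSkip sample) s
    (St (upd (upd (stk s) kUQ [::]) kX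
       (catrev (flatten [seq unp (exvec vs K ch) ++ [:: exlab K ch] | ch <- chunks (K + 4) M cs])
          (stk s kX)))
       (inp s) r) (M * (Tsample K (size vs) w).+1 + 1).
Proof.
move=> Hvs; elim: M cs s => [|M IH] cs s Hs HK HP HQ H2 Hc Hsz.
  apply: runs_conv (runs_loop0 _ _ HQ) _ _ => //.
  by case: cs Hsz Hc => //; case: s Hs HK HP HQ => f i r' /= _ _ _ HQ _ ->; st_eq.
have Hch : size (take (K + 4) cs) = K + 4 by rewrite size_takel // Hsz mulSn leq_addr.
have [HU HV HT HG [HC HE]] := Hs.
apply: runs_conv; first apply: (runs_loop1 HQ) => /=.
- apply: (@runs_sample vs K w (take (K + 4) cs) (drop (K + 4) cs ++ r)) => //=.
    by rewrite catA cat_take_drop.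
  apply: leq_trans H2.
  have := bval_lt 0 (take K (take (K + 4) cs)); rewrite mul1n size_takel // Hch; exact: leq_addr.
- apply: (IH (drop (K + 4) cs)) => //=.
  by rewrite size_drop Hsz mulSn addKn.
- by st_eq; rewrite -catrev_catl.
- by rewrite /= [M.+1 * _]mulSn; lia.
Qed.

(* Appends to [kX] the self-delimiting code of the reverse of stack [j]. *)
Definition ehead j :=
  move j kV ;;
  CLoop kV (CPush kX true ;; CPush kX false ;; CPush j false)
           (CPush kX true ;; CPush kX true ;; CPush j true) ;;
  CPush kX false ;; CPush kX false.

Lemma runs_ehead j s : j != kV -> j != kX -> stk s kV = [::] ->
  runs (ehead j) s (setk s kX (catrev (delim (rev (stk s j))) (stk s kX)))
    (6 * size (stk s j) + 4).
Proof.
move=> HjV HjX HV.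
have EV : (kV == j) = false by rewrite eq_sym (negbTE HjV).
have EX : (kX == j) = false by rewrite eq_sym (negbTE HjX).
have Hloop : forall l s, stk s kV = l ->
  runs (CLoop kV (CPush kX true ;; CPush kX false ;; CPush j false)
           (CPush kX true ;; CPush kX true ;; CPush j true)) s
    (setk (setk (setk s kV [::]) kX (catrev (flatten [seq [:: true; b] | b <- l]) (stk s kX)))
       j (catrev l (stk s j))) (4 * size l + 1).
  move=> {HV s}; elim=> [|b l IH] s HV.
    apply: runs_conv (runs_loop0 _ _ HV) _ _ => //.
    by case: s HV => f i r /= HV; st_eq; rewrite ?E //; case: eqP => // <-.
  apply: runs_conv; first apply: (runs_loop1 HV).
  - rewrite (_ : (if b then _ else _) = (CPush kX true ;; CPush kX b ;; CPush j b)).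
      by sym.
    by case: b {HV}.
  - by apply: IH => /=; rewrite EV.
  - by st_eq; rewrite ?eqxx ?EX ?EV ?(negbTE HjX) ?(negbTE HjV).
  - by rewrite /=; lia.
apply: runs_conv.
- apply: runs_seq; first exact: runs_move.
  apply: runs_seq; first by apply: Hloop.
  by sym.
- st_eq; rewrite ?HV ?eqxx ?EX ?EV ?(negbTE HjX) ?(negbTE HjV) //.
  + by rewrite -[catrev (stk s j) [::]]/(rev _) /delim catrev_catl.
  + by rewrite -[catrev (stk s j) [::]]/(rev _) -[catrev _ [::]]/(rev _) revK.
- by rewrite /= HV -[catrev (stk s j) [::]]/(rev _) size_rev; lia.
Qed.

(** This writes the code of the dimension [2 ^ a * n], lowest bits first. *)
Definition hdr a := nrep a (CPush kX true ;; CPush kX false) ;; ehead kNB.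

Lemma runs_hdr a s : stk s kV = [::] ->
  runs (hdr a) s
    (setk s kX (catrev (delim (nseq a false ++ rev (stk s kNB))) (stk s kX)))
    (2 * a + 6 * size (stk s kNB) + 5).
Proof.
move=> HV.
have Hrep s' : runs (nrep a (CPush kX true ;; CPush kX false)) s'
    (setk s' kX (catrev (flatten [seq [:: true; b] | b <- nseq a false]) (stk s' kX))) (2 * a + 1).
  elim: a s' => [|a IH] s'.
    by apply: runs_conv (runs_skip _) _ _ => //; rewrite setk_id.
  apply: runs_conv; first by apply: runs_seq; [by sym|exact: IH].
    by st_eq.
  by lia.
apply: runs_conv.
- apply: runs_seq; first exact: Hrep.
  by apply: runs_ehead.
- by st_eq; rewrite /delim map_cat flatten_cat -[in RHS]catA [RHS]catrev_catl.
- by rewrite /=; lia.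
Qed.

(** * Simulating a Turing machine on two stacks *)

Definition ecell (c : option bool) := if c is Some b then [:: true; b] else [:: false; false].
Definition ecells (y : seq (option bool)) : seq bool := flatten (map ecell y).

Definition tocells :=
  CLoop kX (CPush kRT false ;; CPush kRT true) (CPush kRT true ;; CPush kRT true).

Lemma runs_tocells s :
  runs tocells s
    (setk (setk s kX [::]) kRT (ecells (map Some (rev (stk s kX))) ++ stk s kRT))
    (3 * size (stk s kX) + 1).
Proof.
move E : (stk s kX) => l; elim: l s E => [|b l IH] s HX.
  by apply: runs_conv (runs_loop0 _ _ HX) _ _ => //; case: s HX => f i r /= HX; st_eq.
apply: runs_conv; first apply: (runs_loop1 HX).
- rewrite (_ : (if b then _ else _) = (CPush kRT b ;; CPush kRT true)); first by sym.
  by case: b {HX}.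
- by apply: IH.
- by st_eq; rewrite rev_cons map_rcons /ecells -cats1 map_cat flatten_cat -catA.
- by rewrite /=; lia.
Qed.

Definition pushcell k (c : option bool) :=
  CPush k (odflt false c) ;; CPush k (isSome c).
(** An empty stack reads as a blank, so each half of the tape is in effect infinite. *)
Definition popcell k (f : option bool -> cmd) :=
  CCase (SPop k) (f None) (CCase (SPop k) CSkip (f None) (f None))
    (CCase (SPop k) CSkip (f (Some false)) (f (Some true))).

Lemma runs_pushcell k c y s : stk s k = ecells y ->
  runs (pushcell k c) s (setk s k (ecells (c :: y))) 2.
Proof.
move=> Hy; apply: runs_conv; first by rewrite /pushcell; sym.
  by st_eq; rewrite ?eqxx Hy; case: c.
by [].
Qed.

Lemma runs_popcell k f y s s' T : stk s k = ecells y ->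
  runs (f (head None y)) (setk s k (ecells (behead y))) s' T ->
  runs (popcell k f) s s' T.+2.
Proof.
case: y => [|[b|] y] Hy H.
- have Es : setk s k (ecells [::]) = s by rewrite -Hy setk_id.
  rewrite [behead _]/= Es in H.
  by apply: runs_conv; [apply: (runs_pop0 _ _ Hy); exact: H|by []|by []].
- apply: (@runs_pop1 _ _ _ _ _ _ _ true (b :: ecells y)) => //.
  apply: (@runs_pop1 _ _ _ _ _ _ _ b (ecells y)); first by rewrite /= eqxx.
  rewrite (_ : setk (setk s k _) k _ = setk s k (ecells y)); last first.
    by st_eq.
  by case: b {Hy} H.
- apply: (@runs_pop1 _ _ _ _ _ _ _ false (false :: ecells y)) => //.
  apply: (@runs_pop1 _ _ _ _ _ _ _ false (ecells y)); first by rewrite /= eqxx.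
  rewrite (_ : setk (setk s k _) k _ = setk s k (ecells y)); last first.
    by st_eq.
  exact: H.
Qed.

Section Simulator.
Variable M : TM.

Definition pushstate q := nrep q (CPush kSQ true) ;; CPush kGO true.
Definition act (q : nat) (b : option bool) (mv : bool) :=
  (if mv then pushcell kLT b else pushcell kRT b ;; popcell kLT (pushcell kRT)) ;;
  pushstate q.
(** The halting state pushes nothing on [kGO], which ends the loop. Elsewhere the coin is [false],
    as in a deterministic run. *)
Definition handler (q : 'I_(tm_k M).+1) :=
  if q == tm_halt M then CSkip else
  popcell kRT (fun c => let: (q', b, mv) := tm_delta q c false in act q' b mv).
(** Each token on [kSQ] passes over one handler, and the empty stack selects the next. *)
Definition dispatch (hs : seq cmd) :=
  foldr (fun h d => CCase (SPop kSQ) h CSkip d) CSkip hs.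
Definition simulate :=
  CPush kGO true ;;
  CLoop kGO CSkip (dispatch [seq handler q | q <- enum 'I_(tm_k M).+1]).

Lemma runs_pushstate q s : stk s kSQ = [::] ->
  runs (pushstate q) s (setk (setk s kSQ (utrue q)) kGO (true :: stk s kGO)) (q + 2).
Proof.
move=> HQ.
have Hrep : forall q s, runs (nrep q (CPush kSQ true)) s (setk s kSQ (utrue q ++ stk s kSQ)) (q + 1).
  move=> {q s HQ}; elim=> [|q IH] s.
    by apply: runs_conv (runs_skip _) _ _ => //; rewrite setk_id.
  apply: runs_conv; first by apply: runs_seq; [by sym|exact: IH].
    by st_eq; rewrite cat_nseqS.
  by lia.
apply: runs_conv.
- by apply: runs_seq; [exact: Hrep|sym].
- by st_eq; rewrite HQ cats0.
- by lia.
Qed.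

Lemma runs_dispatch hs q s s' T : stk s kSQ = utrue q -> q < size hs ->
  runs (nth CSkip hs q) (setk s kSQ [::]) s' T ->
  runs (dispatch hs) s s' (q + T.+1).
Proof.
elim: hs q s => [|h hs IH] [|q] s //= HQ Hq H.
- by apply: runs_pop0 => //; rewrite -(setk_id s kSQ) HQ.
- apply: (@runs_pop1 _ _ _ _ _ _ _ true (utrue q)) => //.
  apply: IH => //.
  by rewrite (_ : setk (setk s kSQ _) kSQ _ = setk s kSQ [::]); [exact: H|st_eq].
Qed.

(** Tape halves are compared through [nth None], since popping an empty half and pushing a blank may
    change the number of trailing blanks. *)
Definition simrep (c : config M) (s : st) yl yr : Prop :=
  let: (q, l, a, r) := c in
  [/\ stk s kSQ = utrue q, stk s kLT = ecells yl, stk s kRT = ecells yr,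
      nth None yl =1 nth None l & nth None yr =1 nth None (a :: r)].

Lemma head_nth (y z : seq (option bool)) : nth None y =1 nth None z -> head None y = head None z.
Proof. by move=> H; rewrite -!nth0 H. Qed.

Lemma behead_nth (y z : seq (option bool)) : nth None y =1 nth None z ->
  nth None (behead y) =1 nth None (behead z).
Proof. by move=> H i; rewrite !nth_behead H. Qed.

Lemma cons_nth (b : option bool) y z : nth None y =1 nth None z ->
  nth None (b :: y) =1 nth None (b :: z).
Proof. by move=> H [|i] //=. Qed.

Lemma cons_head_behead_nth (y : seq (option bool)) :
  nth None (head None y :: behead y) =1 nth None y.
Proof. by case: y => [|c y] [|i] //=; rewrite nth_nil. Qed.

Definition Tstep := 2 * (tm_k M).+1 + 12.

Lemma runs_simstep (c : config M) s yl yr : ~~ halted c -> simrep c s yl yr ->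
  exists yl' yr',
    [/\ runs (dispatch [seq handler q | q <- enum 'I_(tm_k M).+1]) s
          (setk (setk (setk (setk s kSQ (utrue (step false c).1.1.1)) kLT (ecells yl'))
            kRT (ecells yr')) kGO (true :: stk s kGO)) Tstep,
        simrep (step false c)
          (setk (setk (setk (setk s kSQ (utrue (step false c).1.1.1)) kLT (ecells yl'))
            kRT (ecells yr')) kGO (true :: stk s kGO)) yl' yr',
        size yl' <= (size yl).+1 & size yr' <= (size yr).+2].
Proof.
case: c => [[[q l] a] r]; rewrite /halted /= => /negbTE Hq [HQ HL HR Hl Hr].
rewrite Hq.
have Ha : head None yr = a by rewrite (head_nth Hr).
case Ed : (tm_delta q a false) => [[q' b] mv].
have Hdisp s' T : runs (act q' b mv)
    (setk (setk s kSQ [::]) kRT (ecells (behead yr))) s' T -> T <= (tm_k M).+1 + 8 ->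
    runs (dispatch [seq handler q | q <- enum 'I_(tm_k M).+1]) s s' Tstep.
  move=> H HT; apply: runs_conv.
  - apply: (@runs_dispatch _ q) => //; first by rewrite size_map size_enum_ord.
    rewrite (nth_map q) ?size_enum_ord // nth_ord_enum /handler Hq.
    apply: runs_popcell; first exact: HR.
    by rewrite Ha Ed; exact: H.
  - by [].
  - by rewrite /Tstep; have := ltn_ord q; lia.
have Hq' : q' <= (tm_k M) by rewrite -ltnS.
case: mv Ed Hdisp => Ed Hdisp /=.
  exists (b :: yl), (behead yr); split=> //.
  - apply: Hdisp.
    + apply: runs_conv.
      * apply: runs_seq; first by apply: (@runs_pushcell _ _ yl).
        exact: runs_pushstate.
      * by st_eq.
      * exact: leqnn.
    + by lia.
  - split=> //=; first exact: cons_nth.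
    move=> i; rewrite (behead_nth Hr) [behead _]/=.
    by rewrite cons_head_behead_nth.
  - by rewrite size_behead; lia.
exists (behead yl), (head None yl :: b :: behead yr); split=> //.
- apply: Hdisp.
  + apply: runs_conv.
    * apply: runs_seq.
        apply: runs_seq; first by apply: (@runs_pushcell _ _ (behead yr)).
        apply: (@runs_popcell _ _ yl); first exact: HL.
        by apply: (@runs_pushcell _ _ (b :: behead yr)).
      exact: runs_pushstate.
    * by st_eq.
    * exact: leqnn.
  + by lia.
- split=> //=; first exact: behead_nth.
  rewrite (head_nth Hl); apply: cons_nth; apply: cons_nth; exact: (behead_nth Hr).
- by rewrite size_behead; lia.
- by rewrite /= size_behead; lia.
Qed.

Lemma run_from_nil t i j (c : config M) : run_from t i [::] c = run_from t j [::] c.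
Proof. by elim: t i j c => //= t IH i j c; rewrite !nth_nil (IH i.+1 j.+1). Qed.

(** There are at most [t] moves, and one more pass that meets the halting state. *)
Lemma runs_simloop t (c : config M) s yl yr : halted (run_from t 0 [::] c) ->
  stk s kGO = [:: true] -> simrep c s yl yr ->
  exists yl' yr', let c' := run_from t 0 [::] c in
    [/\ runs (CLoop kGO CSkip (dispatch [seq handler q | q <- enum 'I_(tm_k M).+1])) s
          (setk (setk (setk (setk s kSQ [::]) kGO [::]) kLT (ecells yl')) kRT (ecells yr'))
          (t.+1 * Tstep.+1 + 1),
        nth None yr' =1 nth None (c'.1.2 :: c'.2),
        size yl' <= size yl + t & size yr' <= size yr + 2 * t].
Proof.
elim: t c s yl yr => [|t IH] c s yl yr Hh HG Hrep; case: (boolP (halted c)) => Hc.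
(* The cases where [c] has already halted, one for each form of [t], are settled together. *)
1,3: rewrite run_from_halted //; exists yl, yr.
1,2: case: c Hc Hrep {Hh} => [[[q l] a] r] Hc [HQ HL HR Hl Hr].
1,2: split=> //; try by rewrite leq_addr.
1,2: apply: runs_conv; first apply: (runs_loop1 HG).
1,5: apply: (@runs_dispatch _ q) => //; first by rewrite size_map size_enum_ord.
1,2: rewrite (nth_map q) ?size_enum_ord // nth_ord_enum /handler;
     rewrite /halted /= in Hc; rewrite Hc; exact: runs_skip.
1,4: exact: runs_loop0.
1,3: by st_eq.
1,2: rewrite /Tstep; have := ltn_ord q; lia.
- by rewrite /= (negbTE Hc) in Hh.
have Hh' : halted (run_from t 0 [::] (step false c)).
  by rewrite /= (run_from_nil _ 1 0) in Hh.
have [yl1 [yr1 [Hrun Hrep1 Hyl1 Hyr1]]] := @runs_simstep c (setk s kGO [::]) yl yr Hc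
  (ltac:(by case: c Hrep {Hh Hc Hh'} => [[[q l] a] r])).
have [yl2 [yr2 [Hrun2 Hr2 Hyl2 Hyr2]]] := IH _ (setk (setk (setk (setk (setk s kGO [::]) kSQ (utrue (step false c).1.1.1)) kLT (ecells yl1))
            kRT (ecells yr1)) kGO [:: true]) _ _ Hh' erefl Hrep1.
exists yl2, yr2; rewrite /= (run_from_nil _ 1 0); split=> //; try lia.
apply: runs_conv; first apply: (runs_loop1 HG) => /=; first exact: Hrun.
- exact: Hrun2.
- by st_eq.
- by lia.
Qed.

Lemma read_bits_nth y z : nth None y =1 nth None z -> read_bits y = read_bits z.
Proof.
elim: y z => [|c y IH] z H.
  by case: z H => [|[b|] z] // /(_ 0).
case: z H => [|c' z] H; first by case: c {IH} H => // b /(_ 0).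
have := H 0; rewrite /= => ->; case: c' {H} (fun i => H i.+1) => // b H.
by rewrite (IH z).
Qed.

Lemma runs_simulate t s :
  let w := rev (stk s kX) in
  det_halts_within M w t ->
  stk s kGO = [::] -> stk s kSQ = [::] -> stk s kLT = [::] -> stk s kRT = [::] ->
  exists yl yr,
    [/\ runs (tocells ;; simulate) s
          (setk (setk (setk s kX [::]) kLT (ecells yl)) kRT (ecells yr))
          (3 * size w + t.+1 * Tstep.+1 + 3),
        read_bits yr = det_output M w t,
        size yl <= t & size yr <= size w + 2 * t].
Proof.
move=> w Hh HG HQ HL HR.
set s1 := setk (setk (setk s kX [::]) kRT (ecells (map Some w))) kGO [:: true].
have Hrep : simrep (init_config M w) s1 [::] (map Some w).
  rewrite /init_config /simrep; split=> //.
  by move=> i; rewrite cons_head_behead_nth.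
have [yl [yr [Hrun Hr Hyl Hyr]]] := runs_simloop Hh (erefl : stk s1 kGO = _) Hrep.
exists yl, yr; split=> //.
- apply: runs_conv.
  + apply: runs_seq; first exact: runs_tocells.
    apply: runs_seq; first by sym.
    rewrite /= HG HR cats0; exact: Hrun.
  + by rewrite /s1; st_eq; rewrite ?HG ?HQ.
  + by rewrite /w size_rev; lia.
- rewrite (read_bits_nth Hr) /det_output /output /run.
  by case: (run_from _ _ _ _) => [[[? ?] ?] ?].
- by rewrite size_map in Hyr.
Qed.

End Simulator.

Definition collect :=
  CPush kGO true ;;
  CLoop kGO CSkip
    (CCase (SPop kRT) CSkip (CCase (SPop kRT) CSkip CSkip CSkip)
       (CCase (SPop kRT) CSkip (CPush kZ false ;; CPush kGO true)
                               (CPush kZ true ;; CPush kGO true))) ;;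
  clear kRT ;; clear kLT.

Lemma size_ecells y : size (ecells y) = 2 * size y.
Proof. by elim: y => //= c y IH; rewrite /ecells /= size_cat IH mulnS; case: c. Qed.

Lemma runs_collect yl yr s : stk s kGO = [::] ->
  stk s kLT = ecells yl -> stk s kRT = ecells yr ->
  runs collect s
    (setk (setk (setk s kZ (catrev (read_bits yr) (stk s kZ))) kRT [::]) kLT [::])
    (9 * size yr + 4 * size yl + 9).
Proof.
move=> HG HL HR.
have Hloop : forall y s, stk s kGO = [:: true] -> stk s kRT = ecells y ->
  exists2 l, size l <= 2 * size y & runs (CLoop kGO CSkip
    (CCase (SPop kRT) CSkip (CCase (SPop kRT) CSkip CSkip CSkip)
       (CCase (SPop kRT) CSkip (CPush kZ false ;; CPush kGO true)
                               (CPush kZ true ;; CPush kGO true)))) s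
    (setk (setk (setk s kGO [::]) kRT l) kZ (catrev (read_bits y) (stk s kZ)))
    (5 * size y + 5).
  move=> {s yl yr HG HL HR}; elim=> [|[b|] y IH] s HG HR.
  - exists [::] => //; apply: runs_conv; first apply: (runs_loop1 HG) => /=.
    + by apply: runs_pop0 => //=; exact: runs_skip.
    + exact: runs_loop0.
    + by st_eq.
    + by [].
  - have [l Hl Hrun] := IH (setk (setk (setk s kRT (ecells y)) kZ (b :: stk s kZ)) kGO [:: true]) erefl erefl.
    exists l; first by rewrite /=; lia.
    apply: runs_conv; first apply: (runs_loop1 HG) => /=.
    + apply: (@runs_pop1 _ _ _ _ _ _ _ true (b :: ecells y)) => //=.
      apply: (@runs_pop1 _ _ _ _ _ _ _ b (ecells y)) => //=.
      rewrite (_ : (if b then _ else _) = (CPush kZ b ;; CPush kGO true)); last by case: b {HR Hrun}.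
      by apply: runs_conv; [by sym| |exact: leqnn];
        instantiate (1 := setk (setk (setk s kRT (ecells y)) kZ (b :: stk s kZ)) kGO [:: true]); st_eq.
    + exact: Hrun.
    + by st_eq.
    + by rewrite /=; lia.
  - exists (ecells y); first by rewrite size_ecells /=; lia.
    apply: runs_conv; first apply: (runs_loop1 HG) => /=.
    + apply: (@runs_pop1 _ _ _ _ _ _ _ false (false :: ecells y)) => //=.
      by apply: (@runs_pop1 _ _ _ _ _ _ _ false (ecells y)) => //=; exact: runs_skip.
    + exact: runs_loop0.
    + by st_eq.
    + by rewrite /=; lia.
have [l Hl Hrun] := Hloop yr (setk s kGO [:: true]) erefl HR.
apply: runs_conv.
- apply: runs_seq; first by sym.
  rewrite HG; apply: runs_seq; first exact: Hrun.
  apply: runs_seq; exact: runs_clear.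
- by st_eq; rewrite HG.
- by rewrite /= HL size_ecells; lia.
Qed.

Definition reward tok k :=
  CCase (SPop kRT) CSkip (CCase (SPop kRT) CSkip CSkip CSkip)
    (CCase (SPop kRT) CSkip CSkip (nrep k (CPush tok true))) ;;
  clear kRT ;; clear kLT.

Lemma runs_tokens tok k s : runs (nrep k (CPush tok true)) s
  (setk s tok (utrue k ++ stk s tok)) (k + 1).
Proof.
elim: k s => [|k IH] s.
  by apply: runs_conv (runs_skip _) _ _ => //; rewrite setk_id.
apply: runs_conv; first by apply: runs_seq; [by sym|exact: IH].
  by st_eq; rewrite ?eqxx cat_nseqS.
by lia.
Qed.

Lemma runs_reward tok k yl yr s : tok != kRT -> tok != kLT ->
  stk s kLT = ecells yl -> stk s kRT = ecells yr ->
  runs (reward tok k) s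
    (setk (setk (setk s tok (utrue (if head false (read_bits yr) then k else 0) ++ stk s tok))
       kRT [::]) kLT [::])
    (4 * size yr + 4 * size yl + k + 6).
Proof.
move=> HtR HtL HL HR.
have ER : (kRT == tok) = false by rewrite eq_sym (negbTE HtR).
have EL : (kLT == tok) = false by rewrite eq_sym (negbTE HtL).
have [l Hl Hrun] : exists2 l, size l <= 2 * size yr & runs (CCase (SPop kRT) CSkip (CCase (SPop kRT) CSkip CSkip CSkip)
    (CCase (SPop kRT) CSkip CSkip (nrep k (CPush tok true)))) s
    (setk (setk s kRT l) tok (utrue (if head false (read_bits yr) then k else 0) ++ stk s tok)) (k + 3).
  case: yr HR => [|[[]|] y] HR.
  - exists [::] => //; apply: runs_conv; first by apply: runs_pop0 => //=; exact: runs_skip.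
      by case: s HL HR => f i r /= HL HR; st_eq; rewrite ?ER ?HR.
    by lia.
  - exists (ecells y); first by rewrite size_ecells /=; lia.
    apply: runs_conv.
    + apply: (@runs_pop1 _ _ _ _ _ _ _ true (true :: ecells y)) => //=.
      by apply: (@runs_pop1 _ _ _ _ _ _ _ true (ecells y)) => //=; exact: runs_tokens.
    + by st_eq; rewrite ?(negbTE HtR).
    + by lia.
  - exists (ecells y); first by rewrite size_ecells /=; lia.
    apply: runs_conv.
    + apply: (@runs_pop1 _ _ _ _ _ _ _ true (false :: ecells y)) => //=.
      by apply: (@runs_pop1 _ _ _ _ _ _ _ false (ecells y)) => //=; exact: runs_skip.
    + by st_eq; rewrite ?ER ?(negbTE HtR).
    + by lia.
  - exists (ecells y); first by rewrite size_ecells /=; lia.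
    apply: runs_conv.
    + apply: (@runs_pop1 _ _ _ _ _ _ _ false (false :: ecells y)) => //=.
      by apply: (@runs_pop1 _ _ _ _ _ _ _ false (ecells y)) => //=; exact: runs_skip.
    + by st_eq; rewrite ?ER ?(negbTE HtR).
    + by lia.
apply: runs_conv.
- apply: runs_seq; first exact: Hrun.
  apply: runs_seq; exact: runs_clear.
- by st_eq; rewrite ?(negbTE HtR) ?(negbTE HtL).
- rewrite /= ER EL HL size_ecells; lia.
Qed.

(** * Scoring the hypothesis clause by clause *)

Section Evaluation.
Variables (Ev : TM) (a tE : nat).

Definition pushCS (cs : seq bool) := foldr (fun c d => d ;; CPush kCS c) CSkip cs.

Lemma runs_pushCS cs s : runs (pushCS cs) s (setk s kCS (cs ++ stk s kCS)) (size cs + 1).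
Proof.
elim: cs => [|c cs IH].
  by apply: runs_conv (runs_skip _) _ _ => //; rewrite setk_id.
apply: runs_conv; first by apply: runs_seq; [exact: IH|sym].
  by st_eq.
by rewrite /=; lia.
Qed.

Definition evalv md cs tok k :=
  ehead kZ ;; hdr a ;; pushCS cs ;; ccopy md ;; move kE kP ;;
  (tocells ;; simulate Ev) ;; reward tok k.

Definition evin nb z v := delim z ++ delim (nseq a false ++ nb) ++ unp v.
Definition evout nb z v := head false (det_output Ev (evin nb z v) tE).

Definition eready (s : st) :=
  [/\ stk s kV = [::], stk s kGO = [::], stk s kSQ = [::],
      [/\ stk s kLT = [::], stk s kRT = [::] & stk s kX = [::]] &
      stk s kCS = [::] /\ stk s kE = [::]].

Lemma size_delim l : size (delim l) = 2 * size l + 2.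
Proof. by rewrite /delim size_cat; congr (_ + _); elim: l => //= b l ->; rewrite mulnS. Qed.

Lemma size_subst cs v : size (subst_signs cs v) = size v.
Proof. by elim: v cs => //= -[[] y] v IH cs /=; rewrite IH. Qed.

Lemma size_copied md cs v : size (copied md cs v) <= size v.
Proof. by case: md => [[]|] //=; rewrite size_subst. Qed.

Definition Teval zs nbs w k :=
  7 * (2 * zs + 2 + (2 * (a + nbs) + 2 + 2 * w)) + 6 * zs + 2 * a + 6 * nbs
  + 14 * w + (tE.+1 * (Tstep Ev).+1 + 12 * tE) + k + 60.

Lemma runs_evalv md cs tok k v rest s :
  novv v -> eready s -> stk s kP = unp v ++ [:: true, true & rest] -> size cs <= 3 ->
  tok \in [:: kSP; kSN] ->
  let nb := rev (stk s kNB) in let z := rev (stk s kZ) in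
  let v' := copied md cs v in
  det_halts_within Ev (evin nb z v') tE ->
  runs (evalv md cs tok k) s
    (setk s tok (utrue (if evout nb z v' then k else 0) ++ stk s tok))
    (Teval (size z) (size nb) (size v) k).
Proof.
move=> Hv [HV HG HQ [HL HR HX] [HC HE]] HP Hcs Htok nb z v' Hh.
set s1 := setk s kX (rev (evin nb z v')).
have R1 : runs (ehead kZ ;; hdr a ;; pushCS cs ;; ccopy md ;; move kE kP) s s1
   (6 * size z + 4 + (2 * a + 6 * size nb + 5 + (4 + (10 * size v + 16 + (4 * size v + 5))))).
  apply: runs_conv.
  - apply: runs_seq; first by apply: runs_ehead.
    apply: runs_seq; first by apply: runs_hdr.
    apply: runs_seq; first exact: runs_pushCS.
    apply: runs_seq; first by apply: (@runs_ccopy md v rest).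
    exact: runs_move.
  - rewrite /s1 /evin; st_eq; rewrite ?HC ?HE ?HX ?cats0 //.
      by rewrite !catrevE cats0 revK HP /cstr /= cats0 -catA.
    by rewrite -/z -/nb -/v' !catrevE !rev_cat -!catA cats0.
  - rewrite /= HC HE cats0 !catrevE cats0 /cstr /= cats0 size_rev size_cat size_unp /=.
    by rewrite !size_rev; lia.
have Hw : rev (stk s1 kX) = evin nb z v' by rewrite /s1 /= revK.
have [yl [yr [Hrun Hr Hyl Hyr]]] := @runs_simulate Ev tE s1
  (ltac:(by rewrite Hw)) HG HQ HL HR.
rewrite Hw in Hrun Hr Hyr.
have [E1 E2 E3 E4] : [/\ tok != kRT, tok != kLT, tok != kX & tok != kE].
  by move: Htok; rewrite !inE => /orP [] /eqP ->.
have R2 : runs ((tocells ;; simulate Ev) ;; reward tok k) s1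
   (setk s tok (utrue (if evout nb z v' then k else 0) ++ stk s tok))
   (3 * size (evin nb z v') + tE.+1 * (Tstep Ev).+1 + 3 + (4 * size yr + 4 * size yl + k + 6)).
  apply: runs_conv.
  - apply: runs_seq; first exact: Hrun.
    by apply: (@runs_reward tok k yl yr).
  - rewrite /evout -Hr /s1; move: Htok; rewrite !inE => /orP [] /eqP ->;
      by st_eq; rewrite ?HX ?HL ?HR.
  - exact: leqnn.
have Hsz : size (evin nb z v') <= 2 * size z + 2 + (2 * (a + size nb) + 2 + 2 * size v).
  rewrite /evin size_cat size_delim size_cat size_delim size_cat size_nseq size_unp.
  by have := size_copied md cs v; rewrite -/v'; lia.
have HA : forall c1 c2 c3 c4 c5 c6 s' T,
   runs ((c1 ;; c2 ;; c3 ;; c4 ;; c5) ;; c6) s s' T ->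
   runs (c1 ;; c2 ;; c3 ;; c4 ;; c5 ;; c6) s s' T.
  move=> c1 c2 c3 c4 c5 c6 s' T [t /exec_seq_inv [u1 [t1 [t2 [H1 H2 ->]]]] Ht].
  move: H1 Ht => /exec_seq_inv [u2 [t3 [t4 [H3 + ->]]]].
  move=> /exec_seq_inv [u3 [t5 [t6 [H5 + ->]]]].
  move=> /exec_seq_inv [u4 [t7 [t8 [H7 + ->]]]].
  move=> /exec_seq_inv [u5 [t9 [t10 [H9 H10 ->]]]] Ht.
  exists (t3 + (t5 + (t7 + (t9 + (t10 + t2))))); last by lia.
  by do 4 (apply: ex_seq; first eassumption); apply: ex_seq; eassumption.
apply: HA; apply: runs_conv.
- by apply: runs_seq; [exact: R1|exact: R2].
- by [].
- by rewrite /Teval; lia.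
Qed.

Definition patterns : seq (seq bool) :=
  [seq b :: p | b <- [:: false; true],
     p <- [:: [:: false; false]; [:: false; true]; [:: true; false]; [:: true; true]]].

Definition tests (ps : seq (seq bool)) :=
  foldr (fun cs c => evalv (Some false) cs kSN 2 ;; c) CSkip ps.

(** The weights 16 and 2 are twice the coefficients 8 and 1 of the score, so that the threshold
    [m / 2] for the total becomes the integer [m]. *)
Definition testclause :=
  CPush kUM2 true ;; evalv (Some true) [::] kSP 16 ;; tests patterns ;;
  ccopy None ;; clear kE.

Lemma runs_tests ps v rest s :
  novv v -> eready s -> stk s kP = unp v ++ [:: true, true & rest] ->
  all (fun cs => size cs <= 3) ps ->
  let nb := rev (stk s kNB) in let z := rev (stk s kZ) in
  (forall cs, cs \in ps -> det_halts_within Ev (evin nb z (subst_signs cs v)) tE) ->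
  runs (tests ps) s
    (setk s kSN (utrue (2 * count (fun cs => evout nb z (subst_signs cs v)) ps) ++ stk s kSN))
    (size ps * Teval (size z) (size nb) (size v) 2 + 1).
Proof.
elim: ps s => [|cs ps IH] s Hv Hs HP Hps nb z Hh.
  by apply: runs_conv (runs_skip _) _ _ => //; rewrite setk_id.
move: Hps => /= /andP [Hcs Hps].
apply: runs_conv.
- apply: runs_seq.
    apply: (@runs_evalv (Some false) cs kSN 2 v rest) => //.
    by apply: Hh; rewrite inE eqxx.
  apply: IH => //.
  by move=> cs' Hcs'; apply: Hh; rewrite inE Hcs' orbT.
- st_eq; rewrite -/nb -/z catA -nseqD; congr (nseq _ _ ++ _).
  by case: evout; lia.
- by rewrite /= -/nb -/z mulSn; lia.
Qed.

Lemma runs_testclause v rest s :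
  novv v -> eready s -> stk s kP = unp v ++ [:: true, true & rest] ->
  let nb := rev (stk s kNB) in let z := rev (stk s kZ) in
  det_halts_within Ev (evin nb z v) tE ->
  (forall cs, cs \in patterns -> det_halts_within Ev (evin nb z (subst_signs cs v)) tE) ->
  runs testclause s
    (setk (setk (setk (setk s kUM2 (true :: stk s kUM2))
      kSP (utrue (16 * evout nb z v) ++ stk s kSP))
      kSN (utrue (2 * count (fun cs => evout nb z (subst_signs cs v)) patterns) ++ stk s kSN))
      kP rest)
    (9 * Teval (size z) (size nb) (size v) 16 + 14 * size v + 20).
Proof.
move=> Hv Hs HP nb z Hh Hhs; have [HV HG HQ [HL HR HX] [HC HE]] := Hs.
apply: runs_conv.
- apply: runs_seq; first by sym.
  apply: runs_seq; first by apply: (@runs_evalv (Some true) [::] kSP 16 v rest).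
  apply: runs_seq; first by apply: (@runs_tests patterns v rest).
  apply: runs_seq; first by apply: (@runs_ccopy None v rest).
  exact: runs_clear.
- st_eq; rewrite ?HC ?HE //.
  by rewrite -/nb -/z; case: evout.
- rewrite /= /nb /z HC HE !catrevE cats0 !size_rev /cstr /= cats0 size_cat size_unp /=.
  by rewrite /Teval; lia.
Qed.

Lemma runs_testclauses vs rest w s :
  all (fun v => novv v && (size v <= w)) vs -> eready s -> stk s kUM = utrue (size vs) ->
  stk s kP = cstr vs ++ rest ->
  let nb := rev (stk s kNB) in let z := rev (stk s kZ) in
  (forall v, v \in vs -> det_halts_within Ev (evin nb z v) tE /\
     forall cs, cs \in patterns -> det_halts_within Ev (evin nb z (subst_signs cs v)) tE) ->
  runs (CLoop kUM CSkip testclause) s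
    (setk (setk (setk (setk (setk s kUM [::]) kUM2 (utrue (size vs) ++ stk s kUM2))
      kSP (utrue (16 * count (evout nb z) vs) ++ stk s kSP))
      kSN (utrue (2 * \sum_(v <- vs) count (fun cs => evout nb z (subst_signs cs v)) patterns)
             ++ stk s kSN))
      kP rest)
    (size vs * (9 * Teval (size z) (size nb) w 16 + 14 * w + 21) + 1).
Proof.
elim: vs s => [|v vs IH] s Hvs Hs HM HP nb z Hh.
  apply: runs_conv (runs_loop0 _ _ HM) _ _ => //; rewrite big_nil /=.
  by move: HM HP; clear; case: s => f k r /= HM HP; st_eq.
move: Hvs => /= /andP [/andP [Hv Hw] Hvs].
have [Hv0 Hv1] := Hh v (mem_head _ _).
apply: runs_conv; first apply: (runs_loop1 HM) => /=.
- apply: (@runs_testclause v (cstr vs ++ rest)) => //.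
  by rewrite [stk _ _]/= HP /cstr /= -!catA.
- apply: IH => //.
  by move=> v' Hv'; apply: Hh; rewrite inE Hv' orbT.
- st_eq; rewrite ?cat_nseqS // -/nb -/z catA -nseqD ?big_cons; congr (nseq _ _ ++ _); lia.
- rewrite [(size vs).+1 * _]mulSn /= -/nb -/z.
  have : Teval (size z) (size nb) (size v) 16 <= Teval (size z) (size nb) w 16 by rewrite /Teval; lia.
  by rewrite -/nb -/z; lia.
Qed.

End Evaluation.

Definition popSN := CCase (SPop kSN) CSkip CSkip CSkip.
(** A truncated subtraction: [kSN] receives [m] further tokens and loses one for each token of
    [kSP]. It ends empty exactly when the threshold is reached. *)
Definition verdict :=
  CLoop kUM2 CSkip (CPush kSN true) ;; CLoop kSP CSkip popSN ;;
  CCase (SPop kSN) (CPush kOUT true) CSkip CSkip.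

Lemma runs_verdict m p q s : stk s kUM2 = utrue m -> stk s kSP = utrue p ->
  stk s kSN = utrue q -> stk s kOUT = [::] ->
  exists2 s', runs verdict s s' (2 * m + 3 * p + 4) &
    coins s' = coins s /\ stk s' kOUT = if q + m <= p then [:: true] else [::].
Proof.
move=> HM HP HN HO.
have L1 : forall m s q, stk s kUM2 = utrue m -> stk s kSN = utrue q ->
   runs (CLoop kUM2 CSkip (CPush kSN true)) s
     (setk (setk s kUM2 [::]) kSN (utrue (m + q))) (2 * m + 1).
  move=> {m p q s HM HP HN HO}; elim=> [|m IH] s q HM HN.
    apply: runs_conv (runs_loop0 _ _ HM) _ _ => //.
    by case: s HM HN => f i r /= HM HN; st_eq.
  apply: runs_conv; first apply: (runs_loop1 HM) => /=; first by sym.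
  - by apply: (IH _ q.+1) => //=; rewrite HN.
  - by st_eq; rewrite addnS.
  - by lia.
have L2 : forall p s q, stk s kSP = utrue p -> stk s kSN = utrue q ->
   runs (CLoop kSP CSkip popSN) s
     (setk (setk s kSP [::]) kSN (utrue (q - p))) (3 * p + 1).
  move=> {m p q s HM HP HN HO L1}; elim=> [|p IH] s q HP HN.
    apply: runs_conv (runs_loop0 _ _ HP) _ _ => //.
    by case: s HP HN => f i r /= HP HN; st_eq; rewrite subn0.
  apply: runs_conv; first apply: (runs_loop1 HP) => /=.
  - instantiate (2 := setk (setk s kSP (utrue p)) kSN (utrue q.-1)).
    instantiate (1 := 2).
    case: q HN => [|q] HN.
      apply: runs_conv; [by apply: runs_pop0 => //=; sym| |by []].
      by case: s HP HN => f i r /= HP HN; st_eq.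
    apply: runs_conv; [by apply: (@runs_pop1 _ _ _ _ _ _ _ true (utrue q)) => //=; sym| |by []].
    by st_eq.
  - by apply: (IH _ q.-1).
  - by st_eq; congr nseq; lia.
  - by lia.
set s1 := setk (setk (setk (setk s kUM2 [::]) kSN (utrue (m + q))) kSP [::]) kSN (utrue (m + q - p)).
have R1 := L1 m s q HM HN.
have R2 := L2 p (setk (setk s kUM2 [::]) kSN (utrue (m + q))) (m + q) HP erefl.
case: leqP => Hle.
  exists (setk s1 kOUT [:: true]); last by rewrite /s1 /=.
  apply: runs_conv.
  - apply: runs_seq; first exact: R1.
    apply: runs_seq; first exact: R2.
    have E0 : m + q - p = 0 by lia.
    by apply: runs_pop0 => /=; [rewrite E0|sym].
  - by rewrite /s1; st_eq; rewrite HO.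
  - by lia.
exists (setk s1 kSN (utrue (m + q - p).-1)); last by rewrite /s1 /= HO.
apply: runs_conv.
- apply: runs_seq; first exact: R1.
  apply: runs_seq; first exact: R2.
  have E1 : utrue (m + q - p) = true :: utrue (m + q - p).-1.
    by rewrite -[in LHS](prednK (_ : 0 < m + q - p)) //; lia.
  by apply: (@runs_pop1 _ _ _ _ _ _ _ true (utrue (m + q - p).-1)) => //=; sym.
- by rewrite /s1; st_eq.
- by lia.
Qed.

(** * The six phases of the refuter *)

Definition stf (l : seq (nat * seq bool)) : nat -> seq bool :=
  fun i => foldr (fun p acc => if i == p.1 then p.2 else acc) [::] l.
Arguments stf l i /.

Lemma runs_tounary_nbits k s : stk s kB = rev (nbits k) -> stk s kU = [::] ->
  stk s kV = [::] ->
  runs tounary s (setk (setk s kB [::]) kU (utrue k)) (size (nbits k) * (7 * k + 4) + 1).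
Proof.
move=> HB HU HV; have := @runs_tounary s 0 (rev (nbits k)) HB HU HV.
by rewrite bval_rev_nbits size_rev.
Qed.

Definition phase1 :=
  parse [:: kB; kNB] ;; tounary ;; move kU kUN ;;
  parse [:: kB; kKB; kMQ] ;; tounary ;; move kU kUM.

Definition Tphase1 n m :=
  n * 7 + 6 + (n * (7 * n + 4) + 1) + (2 * n + 1)
  + (m * 8 + 6) + (m * (7 * m + 4) + 1) + (2 * m + 1).

Lemma runs_phase1 n m rest r :
  runs phase1 (initst (enc_nat n ++ enc_nat m ++ rest) r)
    (St (stf [:: (kNB, rev (nbits n)); (kUN, utrue n); (kKB, rev (nbits m));
                 (kMQ, rev (nbits m)); (kUM, utrue m)]) rest r) (Tphase1 n m).
Proof.
have Hn := size_nbits n; have Hm := size_nbits m.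
apply: runs_conv.
- apply: runs_seq; first by apply: (@runs_parse _ _ (nbits n) (enc_nat m ++ rest)).
  apply: runs_seq; first by apply: (@runs_tounary_nbits n).
  apply: runs_seq; first exact: runs_move.
  apply: runs_seq; first by apply: (@runs_parse _ _ (nbits m) rest).
  apply: runs_seq; first by apply: (@runs_tounary_nbits m).
  exact: runs_move.
- by st_eq; rewrite catrev_nseq0.
- rewrite /= ?catrevE ?cats0 ?size_rev ?size_nseq /Tphase1.
  have H1 : size (nbits n) * (7 * n + 4) <= n * (7 * n + 4) by rewrite leq_mul2r Hn orbT.
  have H2 : size (nbits m) * (7 * m + 4) <= m * (7 * m + 4) by rewrite leq_mul2r Hm orbT.
  lia.
Qed.

Definition popV := CCase (SPop kV) CSkip CSkip CSkip.
(** Once reversed on [kV], the numeral of [m] has its low bits on top, and dropping [e] of them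
    divides by [2 ^ e]. *)
Definition phase2 e :=
  move kMQ kV ;; nrep e popV ;;
  CLoop kV (pushes [:: kMQ; kB] false) (pushes [:: kMQ; kB] true) ;;
  tounary ;; move kU kUQ.

Lemma runs_npopV e s : runs (nrep e popV) s (setk s kV (drop e (stk s kV))) (2 * e + 1).
Proof.
elim: e s => [|e IH] s.
  by apply: runs_conv (runs_skip _) _ _ => //; rewrite drop0 setk_id.
apply: runs_conv.
- apply: runs_seq; last exact: IH.
  instantiate (2 := setk s kV (behead (stk s kV))); instantiate (1 := 2).
  case E : (stk s kV) => [|b l].
    by apply: runs_conv; [apply: runs_pop0 => //; sym| |by []]; rewrite [behead _]/= -E setk_id.
  apply: (runs_conv (T1 := 2)); [apply: (@runs_pop1 _ _ _ _ _ _ _ b l) => //| |by []].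
    by case: (b); exact: runs_skip.
  by [].
- by st_eq; case: (stk s kV).
- by lia.
Qed.

Lemma runs_dup l s : stk s kV = l ->
  runs (CLoop kV (pushes [:: kMQ; kB] false) (pushes [:: kMQ; kB] true)) s
    (setk (setk (setk s kV [::]) kMQ (catrev l (stk s kMQ))) kB (catrev l (stk s kB)))
    (4 * size l + 1).
Proof.
elim: l s => [|b l IH] s HV.
  apply: runs_conv (runs_loop0 _ _ HV) _ _ => //.
  by case: s HV => f k r /= HV; st_eq.
apply: runs_conv; first apply: (runs_loop1 HV).
- rewrite (_ : (if b then _ else _) = pushes [:: kMQ; kB] b); last by case: (b).
  exact: runs_pushes.
- by apply: IH.
- by st_eq.
- by rewrite /=; lia.
Qed.

Definition Tphase2 e m := m * (7 * m + 4) + 8 * m + 2 * e + 5.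

Lemma runs_phase2 e n m i r :
  runs (phase2 e)
    (St (stf [:: (kNB, rev (nbits n)); (kUN, utrue n); (kKB, rev (nbits m));
                 (kMQ, rev (nbits m)); (kUM, utrue m)]) i r)
    (St (stf [:: (kNB, rev (nbits n)); (kUN, utrue n); (kKB, rev (nbits m));
                 (kMQ, rev (nbits (m %/ 2 ^ e))); (kUM, utrue m);
                 (kUQ, utrue (m %/ 2 ^ e))]) i r) (Tphase2 e m).
Proof.
have Hm := size_nbits m; have Hd := size_nbits (m %/ 2 ^ e).
have Hq : m %/ 2 ^ e <= m by rewrite leq_div.
apply: runs_conv.
- apply: runs_seq; first exact: runs_move.
  apply: runs_seq; first exact: runs_npopV.
  apply: runs_seq.
    apply: (@runs_dup (nbits (m %/ 2 ^ e))).
    by rewrite /= catrevE cats0 revK nbits_drop.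
  apply: runs_seq; first by apply: (@runs_tounary_nbits (m %/ 2 ^ e)).
  exact: runs_move.
- by st_eq; rewrite catrev_nseq0.
- rewrite /= ?catrevE ?cats0 ?size_rev ?size_nseq /Tphase2.
  have H2 : size (nbits (m %/ 2 ^ e)) * (7 * (m %/ 2 ^ e) + 4) <= m * (7 * m + 4).
    by apply: leq_mul; lia.
  lia.
Qed.

Definition phase3 A :=
  CLoop kUM CSkip (pclause A) ;; move kUM2 kUM ;;
  CLoop kUM CSkip (pzclause A) ;; move kUM2 kUM ;; move kE kP.

(* The [m] zero vectors bring the length to [2 * m >= 2 ^ K], so that any [K]
   index coins select an entry; their score is 0. *)
Definition clauses A n m (phi : formula n m) : seq (seq (bool * bool)) :=
  map (clausev (n := n) A) phi ++ nseq m (zeros (A * n)).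

Lemma novv_zeros k : novv (zeros k).
Proof. by rewrite /novv mem_nseq andbF. Qed.

Lemma novv_cat u v : novv (u ++ v) = novv u && novv v.
Proof. by rewrite /novv mem_cat negb_or. Qed.

Lemma novv_litv n i j : novv (litv n i j).
Proof. by rewrite /litv -cat1s !novv_cat !novv_zeros andbT. Qed.

Lemma novv_clausev A n (C : clause n) : novv (clausev A C).
Proof.
rewrite /clausev novv_cat novv_zeros andbT.
by elim: (tval C) => //= l s IH; rewrite novv_cat novv_litv.
Qed.

Lemma size_zeros k : size (zeros k) = k. Proof. exact: size_nseq. Qed.

Lemma size_litv n i j : i < n -> size (litv n i j) = n.
Proof. by move=> Hi; rewrite /litv size_cat /= !size_zeros; lia. Qed.

Lemma size_clausev A n (C : clause n) : 3 <= A -> size (clausev A C) = A * n.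
Proof.
move=> HA; rewrite /clausev size_cat size_zeros.
have -> : size (flatten [seq litv n (l.1 : nat) l.2 | l : literal n <- tval C]) = size C * n.
  by elim: (tval C) => //= l s IH; rewrite size_cat size_litv // IH mulSn.
by rewrite size_tuple -mulnDl subnKC.
Qed.

Lemma clauses_ok A n m (phi : formula n m) : 3 <= A ->
  all (fun v => novv v && (size v <= A * n)) (clauses A phi).
Proof.
move=> HA; rewrite /clauses all_cat; apply/andP; split.
  by apply/allP => v /mapP [C _ ->]; rewrite novv_clausev size_clausev /=.
by apply/allP => v; rewrite mem_nseq => /andP [_ /eqP ->]; rewrite novv_zeros size_zeros /=.
Qed.

Lemma size_clauses A n m (phi : formula n m) : size (clauses A phi) = 2 * m.
Proof. by rewrite /clauses size_cat size_map size_nseq size_tuple mul2n addnn. Qed.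

Definition Tphase3 A n m :=
  m * (3 * Tlit n + Tzb n (A - 3) + 4) + m * (Tzb n A + 4) + 4 * m
  + 2 * (2 * m * (2 * (A * n) + 2)) + 5.

Lemma runs_phase3 A n m (phi : formula n m) nb kb mq uq r : 3 <= A ->
  runs (phase3 A)
    (St (stf [:: (kNB, nb); (kUN, utrue n); (kKB, kb); (kMQ, mq); (kUM, utrue m); (kUQ, uq)])
      (enc_clauses phi) r)
    (St (stf [:: (kNB, nb); (kUN, utrue n); (kKB, kb); (kMQ, mq); (kUM, utrue m); (kUQ, uq);
        (kP, cstr (clauses A phi))]) [::] r) (Tphase3 A n m).
Proof.
move=> HA.
have Hs := size_cstr (clauses_ok phi HA); rewrite size_clauses in Hs.
apply: runs_conv.
- apply: runs_seq.
    apply: (@runs_pclauses A n phi [::]) => //=; first by rewrite cats0.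
    by rewrite size_tuple.
  apply: runs_seq; first exact: runs_move.
  apply: runs_seq.
    apply: (@runs_pzclauses A n m) => //=.
    by rewrite size_tuple cats0 catrev_nseq0.
  apply: runs_seq; exact: runs_move.
- by st_eq; rewrite ?cats0 ?catrev_nseq0 // -catrev_catl -cstr_cat !catrevE !cats0 revK.
- rewrite /= -catrev_catl -cstr_cat -/(clauses A phi) catrevE !cats0 size_rev size_tuple !size_nseq.
  by rewrite /Tphase3; lia.
Qed.

Definition phase4 a := hdr a ;; ehead kMQ ;; CLoop kUQ CSkip sample.

Definition samplestr a n m (phi : formula n m) M K r :=
  delim (nseq a false ++ nbits n) ++ delim (nbits M) ++
  flatten [seq unp (exvec (clauses (2 ^ a) phi) K ch) ++ [:: exlab K ch] | ch <- chunks (K + 4) M r].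

Definition Tphase4 a n m K M :=
  2 * a + 6 * n + 5 + (6 * M + 4) + (M * (Tsample K (2 * m) (2 ^ a * n)).+1 + 1).

Lemma runs_phase4 a n m (phi : formula n m) M r :
  let K := size (nbits m) in 0 < m -> 3 <= 2 ^ a -> size r = M * (K + 4) ->
  runs (phase4 a)
    (St (stf [:: (kNB, rev (nbits n)); (kUN, utrue n); (kKB, rev (nbits m));
        (kMQ, rev (nbits M)); (kUM, utrue m); (kUQ, utrue M);
        (kP, cstr (clauses (2 ^ a) phi))]) [::] r)
    (St (stf [:: (kNB, rev (nbits n)); (kUN, utrue n); (kKB, rev (nbits m));
        (kMQ, rev (nbits M)); (kUM, utrue m);
        (kP, cstr (clauses (2 ^ a) phi)); (kX, rev (samplestr a phi M K r))]) [::] [::])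
    (Tphase4 a n m K M).
Proof.
move=> K Hm HA Hr.
have Hn := size_nbits n; have HM := size_nbits M.
apply: runs_conv.
- apply: runs_seq; first by apply: runs_hdr.
  apply: runs_seq; first by apply: runs_ehead.
  apply: (@runs_samples (clauses (2 ^ a) phi) K (2 ^ a * n) M r [::]) => //=.
  + exact: clauses_ok.
  + by rewrite size_rev.
  + rewrite size_clauses; by have /andP [] := nbits_size_bounds Hm.
  + by rewrite cats0.
- by st_eq; rewrite !revK !catrevE /samplestr !rev_cat !cats0 catA.
- rewrite /= !size_rev size_clauses /Tphase4; lia.
Qed.

Definition phase5 L := (tocells ;; simulate L) ;; collect.

Definition Tphase5 L sz t := 3 * sz + t.+1 * (Tstep L).+1 + 3 + (9 * (sz + 2 * t) + 4 * t + 9).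

Lemma runs_phase5 L t nb un kb mq um p w r :
  det_halts_within L w t ->
  runs (phase5 L)
    (St (stf [:: (kNB, nb); (kUN, un); (kKB, kb); (kMQ, mq); (kUM, um); (kP, p); (kX, rev w)]) [::] r)
    (St (stf [:: (kNB, nb); (kUN, un); (kKB, kb); (kMQ, mq); (kUM, um); (kP, p);
       (kZ, rev (det_output L w t))]) [::] r)
    (Tphase5 L (size w) t).
Proof.
move=> Hh.
set s := St _ _ _.
have Hw : rev (stk s kX) = w by rewrite /s /= revK.
have [yl [yr [Hrun Hr Hyl Hyr]]] := @runs_simulate L t s
  (ltac:(by rewrite Hw)) erefl erefl erefl erefl.
rewrite Hw in Hrun Hr Hyr.
apply: runs_conv.
- apply: runs_seq; first exact: Hrun.
  by apply: (@runs_collect yl yr).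
- by st_eq; rewrite Hr catrevE cats0.
- by rewrite /Tphase5; lia.
Qed.

Definition phase6 Ev a := CLoop kUM CSkip (testclause Ev a) ;; verdict.

Definition score_pos (h : seq (bool * bool) -> bool) vs := 16 * count h vs.
Definition score_neg (h : seq (bool * bool) -> bool) vs :=
  2 * \sum_(v <- vs) count (fun cs => h (subst_signs cs v)) patterns.

Definition Tphase6 Ev a t zs n m :=
  m * (9 * Teval Ev a t zs n (2 ^ a * n) 16 + 14 * (2 ^ a * n) + 21) + 1
  + (2 * m + 48 * m + 4).

Lemma runs_phase6 Ev a t n m (phi : formula n m) un kb mq z : 3 <= 2 ^ a ->
  let vs := map (clausev (n := n) (2 ^ a)) phi in
  (forall v, v \in vs -> det_halts_within Ev (evin a (nbits n) z v) t /\
     forall cs, cs \in patterns -> det_halts_within Ev (evin a (nbits n) z (subst_signs cs v)) t) ->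
  exists2 s',
  runs (phase6 Ev a)
    (St (stf [:: (kNB, rev (nbits n)); (kUN, un); (kKB, kb); (kMQ, mq); (kUM, utrue m);
       (kP, cstr (clauses (2 ^ a) phi)); (kZ, rev z)]) [::] [::]) s'
    (Tphase6 Ev a t (size z) n m) & coins s' = [::] /\
    stk s' kOUT = if score_neg (evout Ev a t (nbits n) z) vs + m
                     <= score_pos (evout Ev a t (nbits n) z) vs then [:: true] else [::].
Proof.
move=> HA vs Hh.
set s := St _ _ _.
have Hvs : all (fun v => novv v && (size v <= 2 ^ a * n)) vs.
  by have := clauses_ok phi HA; rewrite /clauses all_cat => /andP [].
have Hsz : size vs = m by rewrite size_map size_tuple.
have Hnb : rev (stk s kNB) = nbits n by rewrite /= revK.
have Hz : rev (stk s kZ) = z by rewrite /= revK.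
have H1 : eready s by [].
have H2 : stk s kUM = utrue (size vs) by rewrite Hsz.
have H3 : stk s kP = cstr vs ++ cstr (nseq m (zeros (2 ^ a * n))) by rewrite /= -cstr_cat.
have R1 := @runs_testclauses Ev a t vs _ _ s Hvs H1 H2 H3.
rewrite Hnb Hz in R1; have {}R1 := R1 Hh.
set s1 := setk _ _ _ in R1.
have [||||s' R2 Hs'] := @runs_verdict m (score_pos (evout Ev a t (nbits n) z) vs)
   (score_neg (evout Ev a t (nbits n) z) vs) s1.
- by rewrite /s1 /= Hsz cats0.
- by rewrite /s1 /= cats0.
- by rewrite /s1 /= cats0.
- by [].
exists s'; last by case: Hs' => -> ->.
apply: runs_conv.
- by apply: runs_seq; [exact: R1|exact: R2].
- by [].
- have Hc : count (evout Ev a t (nbits n) z) vs <= m by rewrite -Hsz count_size.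
  rewrite Hsz /Tphase6 /score_pos.
  have : Teval Ev a t (size z) (size (nbits n)) (2 ^ a * n) 16 <= Teval Ev a t (size z) n (2 ^ a * n) 16.
    by have := size_nbits n; rewrite /Teval; lia.
  move=> H; rewrite leq_add //; last by lia.
  by rewrite leq_add2r leq_mul2l; apply/orP; right; lia.
Qed.

(* For [m = 0] the answer is immediate: as [nbits 0] is empty, the header written
   by [hdr] is not the code of [2 ^ a * n] when [n = 0]. *)
Definition program L Ev a e :=
  phase1 ;;
  CCase (SPop kUM) (CPush kOUT true) CSkip
    (CPush kUM true ;; phase2 e ;; phase3 (2 ^ a) ;; phase4 a ;; phase5 L ;; phase6 Ev a).

Definition Tprogram L Ev a e n m K M ts zs tL tE :=
  Tphase1 n m + (Tphase2 e m + Tphase3 (2 ^ a) n m + Tphase4 a n m K M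
   + Tphase5 L ts tL + Tphase6 Ev a tE zs n m) + 3.

Lemma enc_formulaE n m (phi : formula n m) :
  enc_formula phi = enc_nat n ++ enc_nat m ++ enc_clauses phi.
Proof. by []. Qed.

Lemma program_correct0 L Ev a e n (phi : formula n 0) r : size r = 0 ->
  exists t s', [/\ t <= Tphase1 n 0 + 2,
    exec (program L Ev a e) (initst (enc_formula phi) r) s' t,
    coins s' = [::] & stk s' kOUT = [:: true]].
Proof.
case: r => // _.
set s := St (stf [:: (kNB, rev (nbits n)); (kUN, utrue n); (kKB, rev (nbits 0));
                 (kMQ, rev (nbits 0)); (kUM, utrue 0)]) (enc_clauses phi) [::].
have [t Ht Hl] : runs (program L Ev a e) (initst (enc_formula phi) [::])
    (setk s kOUT (true :: stk s kOUT)) (Tphase1 n 0 + 2).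
  apply: runs_seq; first exact: (@runs_phase1 n 0).
  by apply: runs_pop0 => //; exact: runs_push.
by exists t, (setk s kOUT (true :: stk s kOUT)).
Qed.

Lemma program_correct L Ev a e n m (phi : formula n m) r tL tE :
  let K := size (nbits m) in let M := m %/ 2 ^ e in
  let w := samplestr a phi M K r in let z := det_output L w tL in
  let vs := map (clausev (n := n) (2 ^ a)) phi in
  0 < m -> 3 <= 2 ^ a -> size r = M * (K + 4) ->
  det_halts_within L w tL ->
  (forall v, v \in vs -> det_halts_within Ev (evin a (nbits n) z v) tE /\
     forall cs, cs \in patterns -> det_halts_within Ev (evin a (nbits n) z (subst_signs cs v)) tE) ->
  exists t s', [/\ t <= Tprogram L Ev a e n m K M (size w) (size z) tL tE,
    exec (program L Ev a e) (initst (enc_formula phi) r) s' t,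
    coins s' = [::] &
    stk s' kOUT = if score_neg (evout Ev a tE (nbits n) z) vs + m
                     <= score_pos (evout Ev a tE (nbits n) z) vs then [:: true] else [::]].
Proof.
move=> K M w z vs Hm HA Hr HL HE.
have [s' R6 [Hc Ho]] := runs_phase6 (utrue n) (rev (nbits m)) (rev (nbits M)) HA HE.
have [t Ht Hl] : runs (program L Ev a e) (initst (enc_formula phi) r) s'
    (Tprogram L Ev a e n m K M (size w) (size z) tL tE).
  apply: runs_conv.
  - apply: runs_seq; first exact: runs_phase1.
    apply: (@runs_pop1 _ _ _ _ _ _ _ true (utrue m.-1)).
      by rewrite /=; case: (m) Hm.
    apply: runs_seq; first by sym.
    apply: runs_seq.
      rewrite (_ : setk _ _ _ = St (stf [:: (kNB, rev (nbits n)); (kUN, utrue n); (kKB, rev (nbits m));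
                 (kMQ, rev (nbits m)); (kUM, utrue m)]) (enc_clauses phi) r).
        exact: runs_phase2.
      by st_eq; case: (m) Hm.
    apply: runs_seq; first exact: runs_phase3.
    apply: runs_seq; first by apply: runs_phase4.
    apply: runs_seq; first by apply: runs_phase5; exact: HL.
    exact: R6.
  - by [].
  - by rewrite /Tprogram -/K -/M -/w -/z; lia.
by exists t, s'.
Qed.

(** * Clauses as labelled points *)

Definition tritv (p : bool * bool) : 'I_3 :=
  if p.1 then @Ordinal 3 1 isT else if p.2 then @Ordinal 3 2 isT else @Ordinal 3 0 isT.

Definition vecpt N (v : seq (bool * bool)) : {ffun 'I_N -> 'I_3} :=
  [ffun i : 'I_N => tritv (nth ztrit v i)].

Definition nonzeros (v : seq (bool * bool)) := count (fun p => ~~ p.1) v.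
Definition wfvec N v := [&& size v == N, novv v & nonzeros v <= 3].

Lemma nonzeros_cat u v : nonzeros (u ++ v) = nonzeros u + nonzeros v.
Proof. exact: count_cat. Qed.

Lemma nonzeros_zeros k : nonzeros (zeros k) = 0.
Proof. by rewrite /nonzeros count_nseq. Qed.

Lemma nonzeros_subst cs v : nonzeros (subst_signs cs v) = nonzeros v.
Proof. by elim: v cs => //= -[[] y] v IH cs /=; rewrite IH. Qed.

Lemma novv_subst cs v : novv v -> novv (subst_signs cs v).
Proof.
by rewrite /novv; elim: v cs => //= -[[] y] v IH cs; rewrite !inE !negb_or => /andP [? /IH ->];
  rewrite ?andbT.
Qed.

Lemma sparse3_vecpt N v : wfvec N v -> sparse3 (vecpt N v).
Proof.
move=> /and3P [/eqP Hsz _ Hc]; rewrite /sparse3 card_classical_set.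
apply: leq_trans Hc; rewrite /nonzeros -sum1_count (big_nth ztrit) Hsz big_mkord [leqRHS]big_mkcond /=.
apply: leq_sum => i _; rewrite ffunE /tritv.
by case: (nth _ _ _) => [[] []].
Qed.

Lemma wfvec_zeros N : wfvec N (zeros N).
Proof. by rewrite /wfvec size_zeros eqxx novv_zeros nonzeros_zeros. Qed.

(* The zero vector if [v] is ill-formed. *)
Definition mkpoint N v : Cn3 N :=
  insubd (exist _ (vecpt N (zeros N)) (sparse3_vecpt (wfvec_zeros N)) : Cn3 N) (vecpt N v).

Lemma val_mkpoint N v : wfvec N v -> val (mkpoint N v) = vecpt N v.
Proof. by move=> H; rewrite /mkpoint val_insubd sparse3_vecpt. Qed.

Lemma enc_vecpt N v : size v = N -> novv v ->
  flatten [seq enc_trit (vecpt N v i) | i <- enum 'I_N] = unp v.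
Proof.
move=> Hsz Hv; rewrite /unp; congr flatten.
have -> : [seq [:: p.1; p.2] | p <- v] = [seq (fun p : bool * bool => [:: p.1; p.2]) (nth ztrit v (i : 'I_N)) | i <- enum 'I_N].
  rewrite (map_comp (fun p : bool * bool => [:: p.1; p.2]) (fun i : 'I_N => nth ztrit v i)).
  congr map; rewrite (map_comp (nth ztrit v) val) val_enum_ord -Hsz.
  by rewrite map_nth_iota0 ?take_size.
apply: eq_map => i; rewrite ffunE.
have Hp : nth ztrit v i != (true, true).
  by apply: contraNneq Hv => <-; rewrite mem_nth // Hsz.
by move: Hp; case: (nth ztrit v i) => [[] []].
Qed.

Lemma enc_point_mkpoint N v : wfvec N v ->
  enc_point (mkpoint N v) = enc_nat N ++ unp v.
Proof.
move=> H; rewrite /enc_point val_mkpoint //; congr cat.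
by move: H => /and3P [/eqP H1 H2 _]; exact: enc_vecpt.
Qed.

Section ClausePoints.
Variables (A n : nat).
Hypothesis HA : 3 <= A.

Lemma nonzeros_litv i j : nonzeros (litv n i j) = 1.
Proof. by rewrite /litv -cat1s !nonzeros_cat !nonzeros_zeros. Qed.

Lemma wfvec_clausev (C : clause n) : wfvec (A * n) (clausev A C).
Proof.
rewrite /wfvec size_clausev // eqxx novv_clausev /clausev nonzeros_cat nonzeros_zeros addn0 /=.
suff -> : nonzeros (flatten [seq litv n (l.1 : nat) l.2 | l : literal n <- tval C]) = size C.
  by rewrite size_tuple.
by elim: (tval C) => //= l s IH; rewrite nonzeros_cat nonzeros_litv IH.
Qed.

Lemma wfvec_subst cs N v : wfvec N v -> wfvec N (subst_signs cs v).
Proof.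
by move=> /and3P [H1 H2 H3]; rewrite /wfvec size_subst H1 novv_subst // nonzeros_subst.
Qed.

(** A sign [true] stands for the entry +1, that is, for an unnegated variable; hence the
    negation. *)
Definition resign (cs : seq bool) (C : clause n) : clause n :=
  [tuple ((tnth C i).1, ~~ nth false cs i) | i < 3].

Lemma subst_signs_zeros cs k : subst_signs cs (zeros k) = zeros k.
Proof. by elim: k => //= k ->. Qed.

Lemma subst_signs_litv cs i j v :
  subst_signs cs (litv n i j ++ v) = litv n i (~~ head false cs) ++ subst_signs (behead cs) v.
Proof.
have Hz : forall k u cs, subst_signs cs (zeros k ++ u) = zeros k ++ subst_signs cs u.
  by move=> k u cs'; elim: k => //= k ->.
by rewrite /litv -!catA Hz /= Hz negbK.
Qed.

Lemma tuple3 T (t : 3.-tuple T) : exists x y z, t = [tuple x; y; z].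
Proof.
case: t => [[|x [|y [|z [|? ?]]]] //= H]; exists x, y, z; exact: val_inj.
Qed.

Lemma clausev3 (l1 l2 l3 : literal n) : clausev A [tuple l1; l2; l3] =
  litv n l1.1 l1.2 ++ litv n l2.1 l2.2 ++ litv n l3.1 l3.2 ++ zeros ((A - 3) * n).
Proof.
by rewrite /clausev /= cats0 -(catA (litv n l1.1 l1.2)) -(catA (litv n l2.1 l2.2)).
Qed.

Lemma subst_clausev cs C : subst_signs cs (clausev A C) = clausev A (resign cs C).
Proof.
have [x [y [z ->]]] := tuple3 C.
have -> : resign cs [tuple x; y; z] =
    [tuple (x.1, ~~ nth false cs 0); (y.1, ~~ nth false cs 1); (z.1, ~~ nth false cs 2)].
  apply: eq_from_tnth => i; rewrite tnth_mktuple.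
  by case: i => [[|[|[|i]]] Hi] //; rewrite !(tnth_nth x).
rewrite !clausev3 !subst_signs_litv subst_signs_zeros.
by case: cs => [|? [|? [|? ?]]].
Qed.

Section Halfspace.
Variables (R : realType) (x : {ffun 'I_n -> bool}).

Definition asg (i : nat) : bool := if insub i is Some k then x k else false.
(** Periodicity repeats the assignment in every block; plain numbers as indices let sums be cut at
    the block borders. *)
Definition wt (k : nat) : R := if asg (k %% n) then 1%R else (-1)%R.

Definition vsum off (v : seq (bool * bool)) : R :=
  (\sum_(i < size v) wt (off + i) * coordval R (tritv (nth ztrit v i)))%R.

Lemma vsum_cat off u v : vsum off (u ++ v) = (vsum off u + vsum (off + size u) v)%R.
Proof.
rewrite /vsum size_cat big_split_ord /=; congr (_ + _)%R; apply: eq_bigr => i _.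
  by rewrite nth_cat ltn_ord.
by rewrite nth_cat ltnNge leq_addr /= addKn addnA.
Qed.

Lemma vsum_zeros off k : vsum off (zeros k) = 0%R.
Proof.
rewrite /vsum big1 // => i _; rewrite nth_nseq; case: ltnP => _;
  by rewrite /coordval /= subrr mulr0.
Qed.

Lemma vsum_litv p (l : literal n) :
  vsum (p * n) (litv n l.1 l.2) = (if lit_sat x l then 1 else -1)%R.
Proof.
rewrite /litv -cat1s !vsum_cat !vsum_zeros add0r addr0 /vsum /= big_ord1 addn0 size_zeros /=.
rewrite /wt modnMDl modn_small //.
rewrite /asg insubT //= => H; rewrite (_ : Sub _ _ = l.1); last exact: val_inj.
rewrite /coordval /lit_sat.
case: (x l.1); case: l.2 => /=; rewrite ?mul1r ?mulN1r ?sub0r ?opprK //;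
  by rewrite (_ : 2%:R = 1 + 1)%R // addrK.
Qed.

Lemma vsum_clausev C : vsum 0 (clausev A C) =
  (\sum_(l <- tval C) (if lit_sat x l then 1 else -1))%R.
Proof.
have [l1 [l2 [l3 ->]]] := tuple3 C.
rewrite clausev3 vsum_cat (vsum_cat _ (litv n l2.1 _)) (vsum_cat _ (litv n l3.1 _)).
rewrite !size_litv // vsum_zeros addr0 !big_cons big_nil addr0 add0n addnn -mul2n.
by rewrite -(vsum_litv 0 l1) -(vsum_litv 1 l2) -(vsum_litv 2 l3) mul0n mul1n.
Qed.

Definition sathalf : 'I_(A * n) -> R := fun k => wt k.

(** The inner product adds 1 for each true literal and -1 for each false one: it is -3 if the clause
    is violated and at least -1 otherwise, and the bias 2 separates the two cases. *)
Lemma halfspace_clausev C :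
  halfspace sathalf 2%R (mkpoint (A * n) (clausev A C)) = clause_sat x C.
Proof.
rewrite /halfspace val_mkpoint ?wfvec_clausev //.
have -> : (\sum_i sathalf i * coordval R (vecpt (A * n) (clausev A C) i))%R =
    vsum 0 (clausev A C).
  rewrite /vsum size_clausev //; apply: eq_bigr => i _.
  by rewrite /sathalf ffunE add0n.
rewrite vsum_clausev /clause_sat; have [l1 [l2 [l3 ->]]] := tuple3 C.
rewrite /= !big_cons big_nil /= orbF.
case: (lit_sat x l1); case: (lit_sat x l2); case: (lit_sat x l3) => /=; lra.
Qed.

(** Each literal is false for exactly one of its two signs, so one sign triple in eight falsifies
    all three, even if a variable is repeated. *)
Lemma count_resign C : count (fun cs => clause_sat x (resign cs C)) patterns = 7.
Proof.
have [l1 [l2 [l3 ->]]] := tuple3 C.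
have E cs : clause_sat x (resign cs [tuple l1; l2; l3]) =
    [|| x l1.1 (+) ~~ nth false cs 0, x l2.1 (+) ~~ nth false cs 1 |
        x l3.1 (+) ~~ nth false cs 2].
  have -> : resign cs [tuple l1; l2; l3] =
    [tuple (l1.1, ~~ nth false cs 0); (l2.1, ~~ nth false cs 1); (l3.1, ~~ nth false cs 2)].
    apply: eq_from_tnth => i; rewrite tnth_mktuple.
    by case: i => [[|[|[|i]]] Hi] //; rewrite !(tnth_nth l1).
  by rewrite /clause_sat /= orbF.
rewrite (eq_count E) /=.
by case: (x l1.1); case: (x l2.1); case: (x l3.1).
Qed.

End Halfspace.
End ClausePoints.

(** * Averages over coins and second moments *)

Section Averages.
Variable R : realType.
Local Open Scope ring_scope.
Implicit Types (F G : seq bool -> R).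

Lemma avgD t F G : avg t (fun r => F r + G r) = avg t F + avg t G.
Proof.
elim: t F G => //= t IH F G; rewrite !IH.
by field.
Qed.

Lemma avgZ t c F : avg t (fun r => c * F r) = c * avg t F.
Proof. by elim: t F => //= t IH F; rewrite !IH; field. Qed.

Lemma avg_sum t (I : finType) (F : I -> seq bool -> R) :
  avg t (fun r => \sum_i F i r) = \sum_i avg t (F i).
Proof.
elim: t F => //= t IH F; rewrite !IH -big_split /= mulr_suml.
by apply: eq_bigr.
Qed.

Lemma le_avg t F G : (forall r, size r = t -> F r <= G r) -> avg t F <= avg t G.
Proof.
elim: t F G => [|t IH] F G H /=; first exact: H.
rewrite ler_pM2r ?invr_gt0 ?ltr0n //; apply: lerD; apply: IH => r Hr; apply: H;
  by rewrite /= Hr.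
Qed.

Lemma avg_addn k l F : avg (k + l) F = avg k (fun u => avg l (fun t => F (u ++ t))).
Proof. by elim: k F => //= k IH F; rewrite !IH. Qed.

Lemma avg_index K (G : nat -> R) :
  avg K (fun u => G (bval 0 u)) = (\sum_(i < 2 ^ K) G i) / (2 ^ K)%:R.
Proof.
(* The induction needs an arbitrary prefix [a], as each coin is absorbed into the accumulator of
   [bval]. *)
suff H a : avg K (fun u => G (bval a u)) = (\sum_(i < 2 ^ K) G (a * 2 ^ K + i)%N) / (2 ^ K)%:R.
  by rewrite H; congr (_ / _); apply: eq_bigr => i _; rewrite mul0n add0n.
elim: K a => [|K IH] a /=; first by rewrite big_ord1 -[RHS]/(G (a * 1 + 0)%N / 1) muln1 addn0 divr1.
have E2 : (2 ^ K.+1 = 2 ^ K + 2 ^ K)%N by rewrite expnS mul2n addnn.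
rewrite !IH E2 big_split_ord /=.
rewrite natrD.
have H2 : ((2 ^ K)%:R : R) != 0 by rewrite pnatr_eq0 -lt0n expn_gt0.
have -> : \sum_(i < 2 ^ K) G ((a.*2 + true) * 2 ^ K + i)%N =
   \sum_(i < 2 ^ K) G (a * (2 ^ K + 2 ^ K) + (2 ^ K + i))%N.
  by apply: eq_bigr => i _; congr G; rewrite -muln2 /=; ring.
have -> : \sum_(i < 2 ^ K) G ((a.*2 + false) * 2 ^ K + i)%N =
   \sum_(i < 2 ^ K) G (a * (2 ^ K + 2 ^ K) + i)%N.
  by apply: eq_bigr => i _; congr G; rewrite -muln2 /=; ring.
move: H2; move: ((2 ^ K)%:R : R) => N HN.
rewrite -[(N + N)%R]mulr2n -[(N *+ 2)%R]mulr_natr.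
by field.
Qed.

Section Pushforward.
Variables (T : finType) (k : nat) (ex : seq bool -> T).

Definition pushforward (z : T) : R := avg k (fun ch => (ex ch == z)%:R).

Lemma avg_pushforward (F : T -> R) :
  avg k (fun ch => F (ex ch)) = \sum_z pushforward z * F z.
Proof.
under eq_bigr => z _ do rewrite mulrC -avgZ.
rewrite -avg_sum; apply: eq_avg => ch _.
rewrite (bigD1 (ex ch)) //= eqxx mulr1 big1 ?addr0 // => z Hz.
by rewrite eq_sym (negbTE Hz) mulr0.
Qed.

Lemma pushforward_distr : is_distr pushforward.
Proof.
split.
  move=> z; rewrite -(avg_const k (0 : R)); apply: le_avg => r _; exact: ler0n.
rewrite -[RHS](avg_const k (1 : R)) (avg_pushforward (fun=> 1)).
by apply: eq_bigr => z _; rewrite mulr1.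
Qed.

(** Disjoint blocks of coins give independent draws, hence a product distribution. [G] takes
    sequences so that the induction can change the length. *)
Lemma avg_chunks M (G : seq T -> R) :
  avg (M * k) (fun r => G [seq ex ch | ch <- chunks k M r]) =
  \sum_(S : M.-tuple T) (\prod_(z <- tval S) pushforward z) * G S.
Proof.
elim: M G => [|M IH] G.
  rewrite /= (big_pred1 [tuple]) /=; first by rewrite big_nil mul1r.
  by move=> S; apply/esym/eqP; exact: tuple0.
rewrite mulSn avg_addn.
rewrite (@eq_avg _ _ _ (fun u => \sum_(S : M.-tuple T) (\prod_(z <- tval S) pushforward z) * G (ex u :: S))); last first.
  move=> u Hu; rewrite -(IH (fun s => G (ex u :: s))); apply: eq_avg => r _.
  by rewrite /= take_size_cat // drop_size_cat.
rewrite (avg_pushforward (fun x => \sum_(S : M.-tuple T) (\prod_(z <- tval S) pushforward z) * G (x :: S))).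
rewrite [RHS](reindex (fun p : T * M.-tuple T => [tuple of p.1 :: p.2])) /=; last first.
  exists (fun r : M.+1.-tuple T => (thead r, [tuple of behead r])).
    by case=> b r _; congr pair; apply: val_inj.
  by move=> r _; rewrite [RHS]tuple_eta.
rewrite -(pair_bigA _ (fun x (S : M.-tuple T) => (\prod_(z <- x :: S) pushforward z) * G (x :: S))) /=.
apply: eq_bigr => x _; rewrite mulr_sumr; apply: eq_bigr => S _.
by rewrite big_cons mulrA.
Qed.

Lemma size_chunks M r : size (chunks k M r) = M.
Proof. by elim: M r => //= M IH r; rewrite IH. Qed.

Definition draws M r : M.-tuple T := tcast (size_chunks M r) (map_tuple ex (in_tuple (chunks k M r))).

Lemma val_draws M r : tval (draws M r) = map ex (chunks k M r).
Proof. by rewrite /draws val_tcast. Qed.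

Lemma avg_draws M (G : M.-tuple T -> R) :
  avg (M * k) (fun r => G (draws M r)) =
  \sum_(S : M.-tuple T) (\prod_(i < M) pushforward (tnth S i)) * G S.
Proof.
pose G' (s : seq T) : R := if insub s is Some u then G u else 0.
rewrite (@eq_avg _ _ _ (fun r => G' [seq ex ch | ch <- chunks k M r])); last first.
  by move=> r _; rewrite -val_draws /G' valK.
rewrite avg_chunks; apply: eq_bigr => S _.
by rewrite /G' valK big_tuple.
Qed.

End Pushforward.
End Averages.

Section SecondMoment.
Variables (R : realType) (n m : nat).
Local Open Scope ring_scope.
Variable h : formula n m -> clause n -> bool.

(* The error of [g] on the sixteen examples made of [C], eight copies of [(C, +)]
   and one [(C', -)] for each of the eight ways [C'] of signing [C], is
   [1 / 2 - score g C / 16]. *)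
Definition score (g : clause n -> bool) (C : clause n) : R :=
  8 * (g C)%:R - \sum_(cs <- patterns) (g (resign cs C))%:R.

(** Unlike [resign], which overwrites the signs, this is a bijection and can be used to reindex a
    sum over all formulas. *)
Definition flip (cs : seq bool) (C : clause n) : clause n :=
  [tuple ((tnth C i).1, (tnth C i).2 (+) nth false cs i) | i < 3].

Definition twist (j : 'I_m) cs (phi : formula n m) : formula n m :=
  [tuple if i == j then flip cs (tnth phi i) else tnth phi i | i < m].

Lemma flip3 cs (l1 l2 l3 : literal n) : flip cs [tuple l1; l2; l3] =
  [tuple (l1.1, l1.2 (+) nth false cs 0); (l2.1, l2.2 (+) nth false cs 1);
         (l3.1, l3.2 (+) nth false cs 2)].
Proof.
apply: eq_from_tnth => i; rewrite tnth_mktuple.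
by case: i => [[|[|[|i]]] Hi] //; rewrite !(tnth_nth l1).
Qed.

Lemma resign3 cs (l1 l2 l3 : literal n) : resign cs [tuple l1; l2; l3] =
  [tuple (l1.1, ~~ nth false cs 0); (l2.1, ~~ nth false cs 1); (l3.1, ~~ nth false cs 2)].
Proof.
apply: eq_from_tnth => i; rewrite tnth_mktuple.
by case: i => [[|[|[|i]]] Hi] //; rewrite !(tnth_nth l1).
Qed.

(** Both parts of the score add up to eight times the sum of [g] over the eight signings of [C], the
    second because [resign] forgets the signs of its argument. *)
Lemma sum_score_flip g C : \sum_(cs <- patterns) score g (flip cs C) = 0.
Proof.
have [l1 [l2 [l3 ->]]] := tuple3 C.
rewrite /patterns /= !big_cons !big_nil /score /= !big_cons !big_nil !flip3 !resign3 /=.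
case: l1 l2 l3 => [v1 b1] [v2 b2] [v3 b3] /=.
by case: b1; case: b2; case: b3 => /=; ring.
Qed.

(** The bound is 7 and not 8 because [C] is one of its own signings, so [g C] occurs with both
    signs. *)
Lemma score_bound g C : `|score g C| <= 7.
Proof.
have [l1 [l2 [l3 ->]]] := tuple3 C.
case: l1 l2 l3 => [v1 b1] [v2 b2] [v3 b3].
rewrite /score /patterns /= !big_cons !big_nil !resign3 /=.
pose G c1 c2 c3 : R := (g [tuple (v1, c1); (v2, c2); (v3, c3)])%:R.
have HG c1 c2 c3 : 0 <= G c1 c2 c3 <= 1 by rewrite /G; case: (g _); rewrite /= ?lexx ler01.
rewrite -!/(G _ _ _) ler_norml.
move: (HG true true true) (HG true true false) (HG true false true) (HG true false false)
  (HG false true true) (HG false true false) (HG false false true) (HG false false false).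
clear HG; move: (G) => {}G.
by case: b1; case: b2; case: b3 => *; apply/andP; split; lra.
Qed.

Lemma flip_involutive cs : involutive (flip cs).
Proof.
move=> C; apply: eq_from_tnth => i; rewrite !tnth_mktuple /= addbK.
by case: (tnth C i).
Qed.

Lemma twist_involutive j cs : involutive (twist j cs).
Proof.
move=> phi; apply: eq_from_tnth => i; rewrite !tnth_mktuple.
by case: eqP => // _; rewrite flip_involutive.
Qed.

(** For each sign pattern [twist] permutes the formulas, so each of the eight patterns contributes
    the full sum. *)
Lemma sum_twist j (F : formula n m -> R) :
  8 * \sum_phi F phi = \sum_phi \sum_(cs <- patterns) F (twist j cs phi).
Proof.
rewrite [RHS]exchange_big /= [RHS](eq_bigr (fun=> \sum_phi F phi)); last first.
  move=> cs _; rewrite [RHS](reindex_inj (inv_inj (twist_involutive j cs))).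
  by [].
by rewrite /patterns /= !big_cons big_nil; ring.
Qed.

Variable T : pred nat.
Hypothesis hT : forall phi phi' : formula n m,
  (forall j : 'I_m, T j -> tnth phi j = tnth phi' j) -> h phi =1 h phi'.

Notation sc phi j := (score (h phi) (tnth phi j)).

Lemma eq_score g g' C : g =1 g' -> score g C = score g' C.
Proof.
by move=> E; rewrite /score E; congr (_ - _); apply: eq_bigr => cs _; rewrite E.
Qed.

(* Flipping signs in the untouched clause [j] affects neither the hypothesis nor
   clause [k], and the scores of the eight flipped clauses add up to 0. *)
Lemma cross_term (j k : 'I_m) : ~~ T j -> k != j ->
  \sum_phi sc phi j * sc phi k = 0.
Proof.
move=> Hj Hk; apply: (@mulfI _ 8); first by rewrite pnatr_eq0.
rewrite mulr0 (sum_twist j) big1 // => phi _.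
have E cs : h (twist j cs phi) =1 h phi.
  apply: hT => i Hi; rewrite tnth_mktuple ifF //.
  by apply/eqP => Eij; rewrite Eij (negbTE Hj) in Hi.
rewrite (eq_bigr (fun cs => score (h phi) (flip cs (tnth phi j)) * sc phi k)).
  by rewrite -mulr_suml sum_score_flip mul0r.
move=> cs _; rewrite !(eq_score _ (E cs)) !tnth_mktuple eqxx.
by rewrite (negbTE Hk).
Qed.

Definition fresh_sum phi := \sum_(j < m | ~~ T j) sc phi j.

(** Only the diagonal survives: at most [m] terms, each at most [7 ^ 2] for every formula. *)
Lemma second_moment :
  \sum_phi fresh_sum phi ^+ 2 <= 49 * m%:R * #|{: formula n m}|%:R.
Proof.
have -> : \sum_phi fresh_sum phi ^+ 2 =
    \sum_(j < m | ~~ T j) \sum_(k < m | ~~ T k) \sum_phi sc phi j * sc phi k.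
  rewrite (eq_bigr (fun phi => \sum_(j < m | ~~ T j) \sum_(k < m | ~~ T k) sc phi j * sc phi k)).
    by rewrite exchange_big /=; apply: eq_bigr => j _; rewrite exchange_big.
  by move=> phi _; rewrite expr2 /fresh_sum mulr_suml; apply: eq_bigr => j _; rewrite mulr_sumr.
have Hjj (j : 'I_m) : ~~ T j ->
    \sum_(k < m | ~~ T k) \sum_phi sc phi j * sc phi k <= 49 * #|{: formula n m}|%:R.
  move=> Hj; rewrite (bigD1 j) //= [X in _ + X]big1 ?addr0; last first.
    by move=> k /andP [_ Hk]; exact: cross_term.
  apply: le_trans (_ : \sum_(phi : formula n m) 49 <= _).
    apply: ler_sum => phi _; have := score_bound (h phi) (tnth phi j).
    by rewrite ler_norml => /andP [H1 H2]; nra.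
  by rewrite sumr_const mulr_natr.
apply: le_trans (ler_sum _ Hjj) _.
rewrite sumr_const -[X in X <= _]mulr_natr [X in _ <= X]mulrAC.
rewrite ler_wpM2l ?mulr_ge0 ?ler0n // ler_nat.
by rewrite -[leqRHS]card_ord max_card.
Qed.

(** Chebyshev's inequality at the level [m / 4], with [784 = 49 * 16]. *)
Lemma chebyshev (P : pred (formula n m)) : (0 < m)%N ->
  (forall phi, P phi -> m%:R <= 4 * fresh_sum phi) ->
  (#|{: formula n m}|%:R)^-1 * \sum_phi (P phi)%:R <= 784 / m%:R :> R.
Proof.
move=> Hm HP.
have Hm' : 0 < m%:R :> R by rewrite ltr0n.
have H1 : \sum_phi (P phi)%:R * (m%:R / 4) ^+ 2 <= \sum_phi fresh_sum phi ^+ 2.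
  apply: ler_sum => phi _; case HPp : (P phi); last by rewrite mul0r sqr_ge0.
  have := HP _ HPp => H; rewrite mul1r ler_sqr ?nnegrE; first by lra.
    by apply: divr_ge0; rewrite ?ler0n.
  by lra.
have H2 := le_trans H1 second_moment.
rewrite -mulr_suml in H2.
set X := \sum_phi _ in H2 *; set N := (#|_|)%:R in H2 *.
have HN : 0 <= N by exact: ler0n.
(* If there is no formula at all, the inverse of 0 is 0 by convention. *)
have [N0|N0] := eqVneq N 0.
  by rewrite N0 invr0 mul0r divr_ge0 ?ler0n.
have HN' : 0 < N by rewrite lt_def N0 HN.
rewrite mulrC ler_pdivrMr // mulrAC ler_pdivlMr //.
have H3 : X * m%:R * (m%:R / 16) <= 784 * N * (m%:R / 16).
  have -> : X * m%:R * (m%:R / 16) = X * (m%:R / 4) ^+ 2 by field.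
  have -> : 784 * N * (m%:R / 16) = 49 * m%:R * N by field.
  exact: H2.
by rewrite ler_pM2r in H3; last by rewrite divr_gt0 ?ltr0n.
Qed.

End SecondMoment.

(** * Analysis of the refuter *)

Section Reduction.
Variables (R : realType) (L Ev : TM) (c k c' k' a e : nat).
Hypothesis HL : forall n m (S : m.-tuple (example n)),
  det_halts_within L (enc_sample S) (Defs.poly c k (size (enc_sample S))).
Hypothesis HE : forall n m (S : m.-tuple (example n)) (x : Cn3 n),
  let sS := enc_sample S in
  let z := det_output L sS (Defs.poly c k (size sS)) in
  det_halts_within Ev (enc_pair z (enc_point x)) (Defs.poly c' k' (size sS + size (enc_point x))).
Hypothesis HA : 3 <= 2 ^ a.

Section Instance.
Variables (n m : nat).
Hypotheses (Hn : 0 < n) (Hm : 0 < m).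
Let A := 2 ^ a.
Let N := 2 ^ a * n.
Let K := size (nbits m).
Let M := m %/ 2 ^ e.
Implicit Types (phi : formula n m) (C : clause n) (r ch : seq bool).

Definition exampleof phi ch : example N :=
  (mkpoint N (exvec (clauses A phi) K ch), exlab K ch).
Definition sampleof phi r : M.-tuple (example N) := draws (K + 4) (exampleof phi) M r.

Lemma size_clausesK phi : 2 ^ K <= size (clauses A phi).
Proof. by rewrite size_clauses; have /andP [] := nbits_size_bounds Hm. Qed.

Lemma bval_take_lt ch : bval 0 (take K ch) < 2 ^ K.
Proof.
apply: leq_trans (bval_lt _ _) _; rewrite mul1n leq_exp2l //.
by rewrite size_take; case: ltnP => // /ltnW.
Qed.

Lemma wfvec_exvec phi ch : wfvec N (exvec (clauses A phi) K ch).
Proof.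
have Hlt := leq_trans (bval_take_lt ch) (size_clausesK phi).
have Hwf : wfvec N (nth [::] (clauses A phi) (bval 0 (take K ch))).
  move: Hlt; move: (bval _ _) => i Hi; have := mem_nth [::] Hi.
  rewrite {2}/clauses mem_cat => /orP [/mapP [C _ ->]|].
    exact: wfvec_clausev.
  by rewrite mem_nseq => /andP [_ /eqP ->]; exact: wfvec_zeros.
by rewrite /exvec; case: ifP => // _; exact: wfvec_subst.
Qed.

Lemma enc_natN : enc_nat N = delim (nseq a false ++ nbits n).
Proof. by rewrite /enc_nat nbits_shift. Qed.

Lemma enc_sampleof phi r : enc_sample (sampleof phi r) = samplestr a phi M K r.
Proof.
rewrite /enc_sample enc_natN /samplestr; congr (_ ++ (_ ++ flatten _)).
rewrite val_draws -map_comp; apply: eq_map => ch /=; congr (_ ++ _).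
rewrite val_mkpoint ?wfvec_exvec //.
by have /and3P [/eqP H1 H2 _] := wfvec_exvec phi ch; exact: enc_vecpt.
Qed.

(** The code of a sample has the same length for all formulas and coins, so the time bounds [tL] and
    [tE] depend on [n] and [m] only. *)
Definition szsample := size (enc_nat N) + size (enc_nat M) + M * (2 * N + 1).

Lemma size_samplestr phi r : size (samplestr a phi M K r) = szsample.
Proof.
rewrite /samplestr /szsample -enc_natN -/(enc_nat M) size_cat size_cat addnA; congr (_ + _).
have -> : forall l, size (flatten [seq unp (exvec (clauses (2 ^ a) phi) K ch) ++ [:: exlab K ch] | ch <- l])
    = size l * (2 * N + 1).
  elim=> //= ch l IH; rewrite size_cat IH mulSn size_cat size_unp.
  by have /and3P [/eqP -> _ _] := wfvec_exvec phi ch.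
by rewrite size_chunks.
Qed.

Definition szpoint := size (enc_nat N) + 2 * N.

Lemma size_enc_point (x : Cn3 N) : size (enc_point x) = szpoint.
Proof.
rewrite /enc_point size_cat /szpoint; congr (_ + _).
rewrite -[N in 2 * N](size_enum_ord N); elim: (enum _) => //= i s IH.
by rewrite IH mulnS.
Qed.

Definition tL := Defs.poly c k szsample.
Definition tE := Defs.poly c' k' (szsample + szpoint).
Definition hdesc phi r := det_output L (samplestr a phi M K r) tL.
Definition learnt phi r : Cn3 N -> bool := hyp L Ev c k c' k' (sampleof phi r).
Definition onclause (h : Cn3 N -> bool) C := h (mkpoint N (clausev A C)).

Lemma evinE z v : wfvec N v -> evin a (nbits n) z v = enc_pair z (enc_point (mkpoint N v)).
Proof. by move=> H; rewrite enc_point_mkpoint // enc_natN. Qed.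

Lemma learntE phi r v : wfvec N v ->
  learnt phi r (mkpoint N v) = evout Ev a tE (nbits n) (hdesc phi r) v.
Proof.
move=> H; rewrite /learnt /hyp enc_sampleof size_samplestr size_enc_point.
by rewrite /evout evinE.
Qed.

Lemma halts_L phi r : det_halts_within L (samplestr a phi M K r) tL.
Proof. by rewrite /tL -(size_samplestr phi r) -enc_sampleof; exact: HL. Qed.

Lemma halts_Ev phi r v : wfvec N v ->
  det_halts_within Ev (evin a (nbits n) (hdesc phi r) v) tE.
Proof.
move=> H; rewrite evinE //; have := HE (sampleof phi r) (mkpoint N v).
by rewrite /= enc_sampleof size_samplestr size_enc_point.
Qed.

Definition total (h : Cn3 N -> bool) phi : R :=
  (\sum_(j < m) score R (onclause h) (tnth phi j))%R.
Definition accepts phi r : bool := (m%:R <= 2 * total (learnt phi r) phi)%R.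

Lemma total_seq h phi : total h phi = (\sum_(C <- tval phi) score R (onclause h) C)%R.
Proof. by rewrite big_tuple. Qed.

Lemma accepts_score phi r :
  let hv := evout Ev a tE (nbits n) (hdesc phi r) in
  let vs := map (clausev (n := n) A) phi in
  (score_neg hv vs + m <= score_pos hv vs) = accepts phi r.
Proof.
move=> hv vs; rewrite /accepts total_seq.
have Hg C : hv (clausev A C) = onclause (learnt phi r) C.
  by rewrite /onclause learntE // wfvec_clausev.
have -> : score_pos hv vs = 16 * \sum_(C <- tval phi) onclause (learnt phi r) C.
  rewrite /score_pos /vs count_map; congr (16 * _).
  by rewrite -sum1_count big_mkcond /=; apply: eq_bigr => C _; rewrite Hg; case: onclause.
have -> : score_neg hv vs = 2 * \sum_(C <- tval phi) \sum_(cs <- patterns) onclause (learnt phi r) (resign cs C).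
  rewrite /score_neg /vs big_map; congr (2 * _); apply: eq_bigr => C _.
  rewrite -sum1_count big_mkcond /=; apply: eq_bigr => cs _.
  by rewrite subst_clausev Hg; case: onclause.
rewrite -(ler_nat R) natrD !natrM !natr_sum /score sumrB -mulr_sumr.
rewrite (eq_bigr (fun C => (\sum_(cs <- patterns) (onclause (learnt phi r) (resign cs C))%:R : R)%R)); last first.
  by move=> C _; rewrite natr_sum.
move: (\sum_(C <- _) _)%R (\sum_(C <- _) _)%R => x y.
by apply/idP/idP; lra.
Qed.

Definition Dphi phi : example N -> R := pushforward R (K + 4) (exampleof phi).

Local Open Scope ring_scope.

(** For a fixed index the last four coins run through its sixteen examples, giving error
    [1 / 2 - score / 16]; the index coins then average this over [2 ^ K] entries. *)
Lemma Err_Dphi phi (h : Cn3 N -> bool) :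
  Err (Dphi phi) h = 1 / 2 - total h phi / (16 * (2 ^ K)%:R).
Proof.
rewrite /Err /Dphi -(avg_pushforward (K + 4) (exampleof phi) (fun z => (h z.1 != z.2)%:R)).
pose vs := clauses A phi.
pose hv v := h (mkpoint N v).
pose sc v : R := 8 * (hv v)%:R - \sum_(cs <- patterns) (hv (subst_signs cs v))%:R.
rewrite avg_addn (@eq_avg _ _ _ (fun u => (fun i => 1 / 2 - sc (nth [::] vs i) / 16) (bval 0%N u))); last first.
  move=> u Hu.
  rewrite /exampleof /exvec /exlab /= !take_size_cat // !drop_size_cat //= -/vs.
  move: (nth _ _ _) => v.
  have E b : (b != false) = b by case: b.
  have E' b : (b != true) = ~~ b by case: b.
  rewrite !E !E' /sc /hv /patterns /= !big_cons !big_nil.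
  by case: (h (mkpoint N v)); rewrite /=; field.
rewrite (avg_index K (fun i => 1 / 2 - sc (nth [::] vs i) / 16)).
rewrite sumrB sumr_const card_ord -mulr_suml.
have -> : \sum_(i < 2 ^ K) sc (nth [::] vs i) = total h phi.
  have /andP [H1 H2] := nbits_size_bounds Hm.
  rewrite -(big_mkord xpredT (fun i => sc (nth [::] vs i))) (@big_cat_nat _ _ _ m) //=; last exact: ltnW.
  rewrite [X in _ + X]big_nat_cond [X in _ + X]big1 ?addr0; last first.
    move=> i /andP [/andP [Hi1 Hi2] _].
    have -> : nth [::] vs i = zeros N.
      rewrite /vs /clauses nth_cat size_map size_tuple ltnNge Hi1 /=.
      by rewrite nth_nseq ifT //; move: H2; rewrite -/K; lia.
    (* Every signing of a zero vector is the vector itself, so its score is [8 h - 8 h]. *)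
    rewrite /sc /patterns /= !big_cons big_nil !subst_signs_zeros.
    by ring.
  rewrite big_mkord /total; apply: eq_bigr => j _.
  have -> : nth [::] vs j = clausev A (tnth phi j).
    rewrite /vs /clauses nth_cat size_map size_tuple ltn_ord.
    by rewrite (nth_map (tnth phi j)) ?size_tuple // -tnth_nth.
  rewrite /sc /score; congr (_ - _); apply: eq_bigr => cs _.
  by rewrite subst_clausev.
have : ((2 ^ K)%:R : R) != 0 by rewrite pnatr_eq0 -lt0n expn_gt0.
rewrite -[1 / 2 *+ _]mulr_natr; move: ((2 ^ K)%:R : R) => P HP.
by field.
Qed.

(** A satisfied clause scores [8 - 7] and a violated one [0 - 7], the 7 coming from
    [count_resign]. *)
Lemma total_sat phi (x : {ffun 'I_n -> bool}) :
  total (halfspace (@sathalf A n R x) 2) phi = 8 * (nsat x phi)%:R - 7 * m%:R.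
Proof.
rewrite total_seq (eq_bigr (fun C => 8 * (clause_sat x C)%:R - 7)); last first.
  move=> C _; rewrite /score /onclause halfspace_clausev //; congr (_ - _).
  rewrite (eq_bigr (fun cs => (clause_sat x (resign cs C))%:R)); last first.
    by move=> cs _; rewrite halfspace_clausev.
  rewrite -natr_sum; congr (_%:R); rewrite -(count_resign x C) -sum1_count [RHS]big_mkcond /=.
  by apply: eq_bigr => cs _; case: clause_sat.
rewrite sumrB big_const_seq count_predT size_tuple iter_addr_0 -[7 *+ m]mulr_natr.
rewrite -mulr_sumr /nsat -sum1_count [in RHS]big_mkcond natr_sum.
by congr (_ * _ - _).
Qed.

Lemma bound2K : (2 ^ K)%:R <= 2 * m%:R :> R.
Proof. by rewrite -natrM ler_nat; have /andP [] := nbits_size_bounds Hm. Qed.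

Lemma OptErr_le phi (x : {ffun 'I_n -> bool}) :
  OptErr (Dphi phi) <= Err (Dphi phi) (halfspace (@sathalf A n R x) 2).
Proof.
have Hd := pushforward_distr R (K + 4) (exampleof phi).
apply: ge_inf; last by exists (@sathalf A n R x), 2.
exists 0 => _ [w [b ->]]; apply: sumr_ge0 => z _.
by apply: mulr_ge0; [exact: (proj1 Hd)|exact: ler0n].
Qed.

(** A coin string is accepted or gives a bad sample. Indeed [8 * (31 / 32) - 7 = 3 / 4], and a good
    sample loses at most [16 * 2 ^ K * eps <= m / 4] against the satisfying halfspace, so its total
    reaches [m / 2]. Bad samples have probability below 1/10. *)
Lemma soundness phi (eps : R) : 0 < eps -> eps <= 1 / 128 -> val_ge phi (1 - 1 / 32 : R) ->
  Pr_sample (Dphi phi) M (fun S => OptErr (Dphi phi) + eps < Err (Dphi phi) (hyp L Ev c k c' k' S)) < 1 / 10 ->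
  3 / 4 <= avg (M * (K + 4)) (fun r => (accepts phi r)%:R) :> R.
Proof.
move=> He0 He [x Hx] HP.
set bad := fun S : M.-tuple (example N) => OptErr (Dphi phi) + eps < Err (Dphi phi) (hyp L Ev c k c' k' S).
have Hbad : Pr_sample (Dphi phi) M bad = avg (M * (K + 4)) (fun r => (bad (sampleof phi r))%:R).
  by rewrite (avg_draws (K + 4) (exampleof phi) (fun S => (bad S)%:R)).
have Hle : avg (M * (K + 4)) (fun=> 1) <=
   avg (M * (K + 4)) (fun r => (accepts phi r)%:R) + avg (M * (K + 4)) (fun r => (bad (sampleof phi r))%:R) :> R.
  rewrite -avgD; apply: le_avg => r _.
  case: (boolP (accepts phi r)) => Hacc; first by rewrite lerDl ler0n.
  rewrite add0r; case: (boolP (bad _)) => //; rewrite /bad -leNgt -/(learnt phi r) => Hgood.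
  exfalso; move: Hacc; rewrite /accepts -ltNge => Hacc.
  have Hopt := le_trans Hgood (lerD (OptErr_le phi x) (lexx eps)).
  rewrite !Err_Dphi total_sat in Hopt.
  have HK := bound2K.
  have HP0 : (0 : R) < (2 ^ K)%:R by rewrite ltr0n expn_gt0.
  have Hmm : (0 : R) < m%:R by rewrite ltr0n.
  move: Hopt Hacc Hx HK HP0 Hmm.
  move: (total _ _) ((2 ^ K)%:R : R) ((nsat x phi)%:R : R) (m%:R : R) => t P s mm.
  move=> Hopt Hacc Hx HK HP0 Hmm.
  have Hopt' : (8 * s - 7 * mm) / (16 * P) - t / (16 * P) <= eps by lra.
  rewrite -mulrBl ler_pdivrMr in Hopt'; last by apply: mulr_gt0.
  have : eps * (16 * P) <= 1 / 128 * (16 * (2 * mm)).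
    by apply: ler_pM => //; [exact: ltW|apply: mulr_ge0 => //; exact: ltW|rewrite ler_pM2l].
  by lra.
rewrite avg_const -Hbad in Hle.
by rewrite -/bad in HP; lra.
Qed.

Definition touched r (j : nat) : bool := j \in [seq bval 0 (take K ch) | ch <- chunks (K + 4) M r].

(** Indices, signs and labels come from the coins, so the formula enters the sample only through the
    clauses drawn. *)
Lemma sampleof_touched r phi phi' :
  (forall j : 'I_m, touched r j -> tnth phi j = tnth phi' j) -> sampleof phi r = sampleof phi' r.
Proof.
move=> H; apply: val_inj; rewrite /= !val_draws; apply/eq_in_map => ch Hch.
rewrite /exampleof /exvec.
suff -> : nth [::] (clauses A phi) (bval 0 (take K ch)) = nth [::] (clauses A phi') (bval 0 (take K ch)) by [].
have : touched r (bval 0 (take K ch)) by apply/mapP; exists ch.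
move: (bval _ _) => i Hi; rewrite /clauses !nth_cat !size_map !size_tuple.
(* An index from [m] on selects a zero vector, the same for both formulas. *)
case: (ltnP i m) => // Him.
have E := H (Ordinal Him) Hi.
by rewrite !(nth_map (tnth phi (Ordinal Him))) ?size_tuple // -!(tnth_nth _ _ (Ordinal Him)) E.
Qed.

Lemma card_touched r : (#|[pred j : 'I_m | touched r j]| <= M)%N.
Proof.
rewrite -(size_chunks (K + 4) M r) -(size_map (fun ch => bval 0 (take K ch))) cardE -(size_map val).
apply: uniq_leq_size; first by rewrite (map_inj_uniq val_inj) enum_uniq.
by move=> i /mapP [j]; rewrite mem_enum => Hj ->.
Qed.

(** At most [m / 32] clauses are touched, each scoring at most 7; if the total reaches [m / 2], the
    others contribute at least [m / 2 - 7 * m / 32 >= m / 4]. With the coins fixed, the touched set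
    is the same for all formulas. *)
Lemma completeness r : (5 <= e)%N ->
  (#|{: formula n m}|%:R)^-1 * \sum_phi (accepts phi r)%:R <= 784 / m%:R :> R.
Proof.
move=> He.
apply: (@chebyshev R n m (fun phi => onclause (learnt phi r)) (touched r)) => //.
  move=> phi phi' H C; rewrite /onclause /learnt.
  by rewrite (sampleof_touched H).
move=> phi; rewrite /accepts /total (bigID (fun j : 'I_m => touched r j)) /= => Hacc.
have Ht : \sum_(j < m | touched r j) score R (onclause (learnt phi r)) (tnth phi j) <= 7 * M%:R.
  apply: le_trans (_ : \sum_(j < m | touched r j) 7 <= _).
    by apply: ler_sum => j _; have := score_bound R (onclause (learnt phi r)) (tnth phi j); rewrite ler_norml => /andP [].
  rewrite sumr_const -[7 *+ _]mulr_natr ler_pM2l // ler_nat.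
  exact: card_touched.
have HM : 32 * M%:R <= m%:R :> R.
  rewrite -natrM ler_nat mulnC; apply: leq_trans (leq_divM m (2 ^ e)).
  by apply: leq_mul => //; rewrite -[32%N]/(2 ^ 5)%N leq_exp2l.
rewrite /fresh_sum.
move: Hacc Ht; have Hm0 : 0 <= m%:R :> R by exact: ler0n.
move: (\sum_(j < m | touched r j) _) (\sum_(j < m | ~~ touched r j) _) => u v.
by move: HM Hm0; move: (m%:R : R) (M%:R : R) => x y; lra.
Qed.

End Instance.
End Reduction.

(** * Stack usage and polynomial running time *)

Lemma cuses_nrep K j c : cuses K c -> cuses K (nrep j c).
Proof. by move=> H; elim: j => //= j ->; rewrite H. Qed.

Lemma cuses_seq K c1 c2 : cuses K c1 -> cuses K c2 -> cuses K (c1 ;; c2).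
Proof. by move=> /= -> ->. Qed.

Lemma cuses_popcell K j f : j < K -> (forall b, cuses K (f b)) -> cuses K (popcell j f).
Proof. by move=> Hj Hf; rewrite /= Hj !Hf. Qed.

Lemma cuses_simulate M : cuses nstacks (simulate M).
Proof.
rewrite /= /simulate; elim: (enum _) => //= q qs ->; rewrite andbT /handler.
case: ifP => // _; apply: cuses_popcell => // b.
case: tm_delta => [[q' b'] mv]; rewrite /act /pushstate.
have Hq : cuses nstacks (nrep q' (CPush kSQ true)) by exact: cuses_nrep.
by case: mv; rewrite /= Hq.
Qed.

Lemma cuses_evalv Ev a md cs tok j : tok < nstacks -> size cs <= 3 ->
  cuses nstacks (evalv Ev a md cs tok j).
Proof.
move=> Ht Hcs; rewrite /evalv.
have H1 : cuses nstacks (pushCS cs) by elim: cs {Hcs} => //= b cs ->.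
have H2 := cuses_nrep j (_ : cuses nstacks (CPush tok true)).
have H3 := cuses_simulate Ev.
have H4 : cuses nstacks (hdr a).
  by have H := cuses_nrep a (_ : cuses nstacks (CPush kX true ;; CPush kX false)); rewrite /= H.
have H5 : cuses nstacks (ccopy md) by case: md => [[]|].
have H6 : cuses nstacks (reward tok j) by rewrite /= H2.
apply: cuses_seq; first by [].
apply: cuses_seq; first exact: H4.
apply: cuses_seq; first exact: H1.
apply: cuses_seq; first exact: H5.
apply: cuses_seq; first by [].
apply: cuses_seq; last exact: H6.
by apply: cuses_seq; [|exact: H3].
Qed.

Lemma cuses_program L Ev a e : cuses nstacks (program L Ev a e).
Proof.
have HT : cuses nstacks (testclause Ev a).
  apply: cuses_seq; first by [].
  apply: cuses_seq; first by apply: cuses_evalv.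
  apply: cuses_seq; last by [].
  have : all (fun cs => size cs <= 3) patterns by [].
  elim: patterns => // cs ps IH /andP [Hcs Hps].
  by apply: cuses_seq; [apply: cuses_evalv|exact: IH].
have H2 : cuses nstacks (phase2 e).
  by have H := cuses_nrep e (_ : cuses nstacks popV); rewrite /= H.
have Hz j : cuses nstacks (nrep j zblock) by exact: cuses_nrep.
have H3 : cuses nstacks (phase3 (2 ^ a)) by rewrite /= !Hz.
have H4 : cuses nstacks (phase4 a).
  by have H := cuses_nrep a (_ : cuses nstacks (CPush kX true ;; CPush kX false)); rewrite /= H.
have H5 : cuses nstacks (phase5 L).
  apply: cuses_seq; last by [].
  by apply: cuses_seq; [|exact: cuses_simulate].
have H6 : cuses nstacks (phase6 Ev a) by apply: cuses_seq; [exact: HT|].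
apply: cuses_seq => //.
suff H : cuses nstacks (CPush kUM true ;; phase2 e ;; phase3 (2 ^ a) ;; phase4 a ;; phase5 L ;; phase6 Ev a).
  by rewrite -[cuses _ _]/(cuses nstacks (CPush kUM true ;; phase2 e ;; phase3 (2 ^ a) ;; phase4 a ;; phase5 L ;; phase6 Ev a)).
by do 5![apply: cuses_seq => //].
Qed.

Section PolynomiallyBounded.
Variables (I : Type) (sz : I -> nat).

(** [I] will be the type of all formulas, for all [n] at once, since a single pair of constants has
    to serve them all. *)
Definition pb (f : I -> nat) := exists c k, forall i, f i <= Defs.poly c k (sz i).

Lemma pb_le f g : (forall i, f i <= g i) -> pb g -> pb f.
Proof. by move=> H [c [k Hg]]; exists c, k => i; apply: leq_trans (H i) (Hg i). Qed.

Lemma pb_const c : pb (fun=> c).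
Proof. by exists c, 0 => i; rewrite /Defs.poly expn0 muln1. Qed.

Lemma pb_size : pb sz.
Proof. by exists 1, 1 => i; rewrite /Defs.poly expn1 mul1n. Qed.

Lemma pb_add f g : pb f -> pb g -> pb (fun i => f i + g i).
Proof.
move=> [c [k Hf]] [c' [k' Hg]]; exists (c + c'), (k + k') => i.
rewrite /Defs.poly mulnDl; apply: leq_add.
  by apply: leq_trans (Hf i) _; rewrite leq_mul2l leq_pexp2l ?leq_addr ?orbT.
by apply: leq_trans (Hg i) _; rewrite leq_mul2l leq_pexp2l ?leq_addl ?orbT.
Qed.

Lemma pb_mul f g : pb f -> pb g -> pb (fun i => f i * g i).
Proof.
move=> [c [k Hf]] [c' [k' Hg]]; exists (c * c'), (k + k') => i.
by rewrite /Defs.poly expnD mulnACA; apply: leq_mul.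
Qed.

Lemma pb_succ f : pb f -> pb (fun i => (f i).+1).
Proof.
by move=> Hf; apply: (pb_le (g := fun i => f i + 1)) (pb_add Hf (pb_const 1)) => i; rewrite addn1.
Qed.

Lemma pb_poly c k f : pb f -> pb (fun i => Defs.poly c k (f i)).
Proof.
move=> /pb_succ Hf; rewrite /Defs.poly; apply: pb_mul (pb_const c) _.
elim: k => [|k IH]; first by apply: pb_le (pb_const 1).
by apply: pb_le (pb_mul Hf IH) => i; rewrite expnS.
Qed.

End PolynomiallyBounded.

Ltac pb_tac :=
  lazymatch goal with
  | |- pb _ (fun _ => ?c) => exact: pb_const
  | |- pb _ (fun i => addn (@?f i) (@?g i)) => apply: (@pb_add _ _ f g); pb_tac
  | |- pb _ (fun i => muln (@?f i) (@?g i)) => apply: (@pb_mul _ _ f g); pb_tac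
  | |- pb _ (fun i => S (@?f i)) => apply: (@pb_succ _ _ f); pb_tac
  | |- pb _ (fun i => Defs.poly ?c ?k (@?f i)) => apply: (@pb_poly _ _ c k f); pb_tac
  | _ => assumption
  end.

Lemma size_read_bits y : size (read_bits y) <= size y.
Proof. by elim: y => [|[b|] y IH]. Qed.

(** Read off from the space bound of the simulator, whose right stack holds the output. *)
Lemma size_det_output M w t : det_halts_within M w t ->
  size (det_output M w t) <= size w + 2 * t.
Proof.
move=> Hh; pose s := St (stf [:: (kX, rev w)]) [::] [::].
have Hw : rev (stk s kX) = w by rewrite /= revK.
have [yl [yr [_ Hr _ Hyr]]] := @runs_simulate M t s
  (ltac:(by rewrite Hw)) erefl erefl erefl erefl.
by rewrite Hw in Hyr Hr; rewrite -Hr; apply: leq_trans (size_read_bits _) Hyr.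
Qed.

Section TimeBound.
Variables (L Ev : TM) (c k c' k' a e : nat).

(** [ts + 2 * tl] bounds the length of the learner's output, so that the count depends on [n] and
    [m] only. *)
Definition steps n m :=
  let ts := szsample a e n m in let tl := tL c k a e n m in
  Tprogram L Ev a e n m (size (nbits m)) (m %/ 2 ^ e) ts (ts + 2 * tl) tl (tE c' k' a e n m).

Definition time n m s :=
  3 + (steps n m).+1 * (2 * (steps n m).+1 * nstacks.+1 + 2 * nstacks + 2 * s + 4) + 2.

Lemma pb_time (I : Type) (sz fn fm : I -> nat) : pb sz fn -> pb sz fm ->
  pb sz (fun i => time (fn i) (fm i) (sz i)).
Proof.
move=> Hn Hm.
have Hnb f : pb sz f -> pb sz (fun i => size (nbits (f i))).
  by apply: pb_le => i; exact: size_nbits.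
have HM : pb sz (fun i => fm i %/ 2 ^ e) by apply: pb_le Hm => i; exact: leq_div.
have HK := Hnb _ Hm.
have HN : pb sz (fun i => 2 ^ a * fn i) by pb_tac.
have HencN f : pb sz f -> pb sz (fun i => size (enc_nat (f i))).
  move=> Hf; apply: (@pb_le _ _ _ (fun i => 2 * size (nbits (f i)) + 2)).
    by move=> i; rewrite /enc_nat size_delim.
  by have := Hnb _ Hf => ?; pb_tac.
have H1 := HencN _ HN; have H2 := HencN _ HM.
have Hs := pb_size sz.
have Hts : pb sz (fun i => szsample a e (fn i) (fm i)) by rewrite /szsample; pb_tac.
have HtL : pb sz (fun i => tL c k a e (fn i) (fm i)) by rewrite /tL; pb_tac.
have HtE : pb sz (fun i => tE c' k' a e (fn i) (fm i)) by rewrite /tE /szpoint; pb_tac.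
have Hst : pb sz (fun i => steps (fn i) (fm i)).
  rewrite /steps /Tprogram /Tphase1 /Tphase2 /Tphase3 /Tphase4 /Tphase5 /Tphase6 /Teval
    /Tsample /Tlit /Tzb; by pb_tac.
by rewrite /time; pb_tac.
Qed.

Lemma Tprogram_le n m K M ts zs zs' tl te : zs <= zs' ->
  Tprogram L Ev a e n m K M ts zs tl te <= Tprogram L Ev a e n m K M ts zs' tl te.
Proof.
move=> Hz; rewrite /Tprogram !leq_add2r !leq_add2l /Tphase6 leq_add2r leq_add2r leq_mul2l.
by apply/orP; right; rewrite /Teval; lia.
Qed.

End TimeBound.

Lemma enc_formula_nnil n m (phi : formula n m) : enc_formula phi != [::].
Proof. by rewrite /enc_formula /enc_nat /delim; case: (flatten _). Qed.

Lemma size_enc_formula n m (phi : formula n m) : m <= size (enc_formula phi).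
Proof.
rewrite enc_formulaE !size_cat; apply: leq_trans (leq_addl _ _); apply: leq_trans (leq_addl _ _).
rewrite -{1}(size_tuple phi) /enc_clauses; elim: (tval phi) => //= C Cs IH.
rewrite size_cat -add1n leq_add //.
have [l1 [l2 [l3 ->]]] := tuple3 C; rewrite /= size_cat /enc_lit size_cat /=; lia.
Qed.

(** * The acceptance probability of the refuter *)

Section Refuter.
Variables (R : realType) (L Ev : TM) (c k c' k' a e : nat).
Hypothesis HL : forall n m (S : m.-tuple (example n)),
  det_halts_within L (enc_sample S) (Defs.poly c k (size (enc_sample S))).
Hypothesis HE : forall n m (S : m.-tuple (example n)) (x : Cn3 n),
  let sS := enc_sample S in
  let z := det_output L sS (Defs.poly c k (size sS)) in
  det_halts_within Ev (enc_pair z (enc_point x)) (Defs.poly c' k' (size sS + size (enc_point x))).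
Hypothesis HA : 3 <= 2 ^ a.

Definition refuter := machine nstacks kOUT (program L Ev a e).

Lemma refuter_correct n m (phi : formula n m) t : (m = 0 -> n = 0) -> (0 < m -> 0 < n) ->
  time L Ev c k c' k' a e n m (size (enc_formula phi)) <= t ->
  halts_within refuter (enc_formula phi) t /\
  Pr_exceptional R refuter t (enc_formula phi) =
    if m == 0 then 1%R else
    avg (m %/ 2 ^ e * (size (nbits m) + 4))
      (fun r => ((accepts R L Ev c k c' k' a e phi r)%:R)%R).
Proof.
move=> Hm0 Hmn Ht.
have Hc := cuses_program L Ev a e.
case: (posnP m) => [E0|Hm].
  subst m; have [|H1 H2] := @machine_correct R nstacks kOUT (program L Ev a e) (enc_formula phi) t 0
    (steps L Ev c k c' k' a e n 0) (fun=> true) (enc_formula_nnil phi) isT Hc _ Ht.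
    move=> r Hr; have [t' [s' [Ht' He Hcs Ho]]] := program_correct0 L Ev a e phi Hr.
    by exists t', s'; split=> //; apply: leq_trans Ht' _; rewrite /steps /Tprogram; lia.
  by split=> //; rewrite H2.
have Hn := Hmn Hm.
have [|H1 H2] := @machine_correct R nstacks kOUT (program L Ev a e) (enc_formula phi) t
    (m %/ 2 ^ e * (size (nbits m) + 4))
    (steps L Ev c k c' k' a e n m) (accepts R L Ev c k c' k' a e phi) (enc_formula_nnil phi) isT Hc _ Ht.
  move=> r Hr.
  have HhL := halts_L e HL HA Hn Hm phi r.
  have Hvs v : v \in map (clausev (n := n) (2 ^ a)) phi -> wfvec (2 ^ a * n) v.
    by move=> /mapP [C _ ->]; exact: wfvec_clausev.
  have [|t' [s' [Ht' He Hcs Ho]]] := @program_correct L Ev a e n m phi r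
      (tL c k a e n m) (tE c' k' a e n m) Hm HA Hr HhL.
    move=> v Hv; split; first by apply: (halts_Ev e HE HA Hn Hm); exact: Hvs.
    by move=> cs _; apply: (halts_Ev e HE HA Hn Hm); apply: wfvec_subst; exact: Hvs.
  exists t', s'; split=> //.
    apply: leq_trans Ht' _; rewrite (size_samplestr e HA Hn Hm); apply: Tprogram_le.
    by rewrite -{1}(size_samplestr e HA Hn Hm phi r); exact: size_det_output.
  by rewrite Ho -(accepts_score R L Ev c k c' k' e HA Hn Hm phi r).
split=> //; rewrite H2 ifF //; apply/eqP; lia.
Qed.

End Refuter.

(** * Choice of the ratio and rates of convergence *)

Section Asymptotics.
Variables (R : realType) (mu : R).
Local Open Scope ring_scope.
Hypothesis Hmu : 0 <= mu.

Lemma le1_1Dmu : 1 <= 1 + mu. Proof. by rewrite lerDl. Qed.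

Lemma natr_powR_ge (n : nat) : (0 < n)%N -> n%:R <= n%:R `^ (1 + mu) :> R.
Proof. by move=> Hn; apply: le1r_powR; [rewrite ler1n|exact: le1_1Dmu]. Qed.

Lemma nclauses0 Delta : nclauses Delta mu 0 = 0%N.
Proof.
rewrite /nclauses powR0 ?mulr0 ?truncn0 //.
by apply: lt0r_neq0; apply: lt_le_trans le1_1Dmu.
Qed.

Lemma nclauses_ge Delta n : (0 < Delta)%N -> (n <= nclauses Delta mu n)%N.
Proof.
move=> HD; case: (posnP n) => [-> //|Hn].
have H := natr_powR_ge Hn.
have HD1 : (1 : R) <= Delta%:R by rewrite ler1n.
have H0 : 0 <= n%:R `^ (1 + mu) :> R by apply: powR_ge0.
rewrite /nclauses truncn_ge_nat; first by nra.
by apply: mulr_ge0.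
Qed.

(** Rounding down loses less than 1 and the division by 32 a remainder of at most 31, together less
    than 32; the [+ 1] beside [B] absorbs this, as the power of [n] is at least 1. *)
Lemma sample_size Delta n (B : R) : 0 <= B -> (0 < n)%N -> 32 * (B + 1) <= Delta%:R ->
  B * n%:R `^ (1 + mu) < (nclauses Delta mu n %/ 2 ^ 5)%:R.
Proof.
move=> HB Hn HD; set X := n%:R `^ (1 + mu).
have HX : 1 <= X.
  by apply: le_trans (natr_powR_ge Hn); rewrite ler1n.
set m := nclauses Delta mu n.
have Hm : Delta%:R * X < m%:R + 1 by rewrite natr1; exact: truncnS_gt.
have Hd : (m <= 32 * (m %/ 2 ^ 5) + 31)%N.
  by have := divn_eq m 32; have := ltn_pmod m (isT : (0 < 32)%N); rewrite -[(2 ^ 5)%N]/32%N; lia.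
have {}Hd : m%:R <= 32 * (m %/ 2 ^ 5)%:R + 31 :> R by rewrite -natrM -natrD ler_nat.
move: ((m %/ 2 ^ 5)%:R : R) Hd => q Hd.
nra.
Qed.

Lemma cvg_bound :
  ((fun n : nat => (1568 * n.+1%:R^-1 : R)%R) n @[n --> \oo] --> (0 : R)%R)%classic.
Proof.
by rewrite -(mulr0 (1568 : R)%R); apply: cvgMl_tmp; exact: cvg_harmonic.
Qed.

End Asymptotics.

Local Open Scope ring_scope.

(* Points live in dimension [2 ^ a * n], which is at least [N0] for every
   [n > 0], so that the asymptotic bound on [mfun] always applies. *)
Lemma refutes_of_learner (R : realType) (mu : R) (L Ev : TM) (mfun : nat -> R -> R)
    (C eps0 : R) (N0 Delta c k c' k' : nat) :
  let a := N0.+2 in let eps := Num.min (1 / 128) (eps0 / 2) in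
  0 <= mu -> 0 < eps0 -> (0 < Delta)%N ->
  32 * (`|C| * (2 ^ a)%:R `^ (1 + mu) / eps ^+ 2 + 1) <= Delta%:R ->
  (forall n (eps : R), (N0 <= n)%N -> 0 < eps -> eps < eps0 ->
     mfun n eps <= C * (n%:R `^ (1 + mu)) / eps ^+ 2) ->
  (forall n m (S : m.-tuple (example n)),
     det_halts_within L (enc_sample S) (Defs.poly c k (size (enc_sample S)))) ->
  (forall n m (S : m.-tuple (example n)) (x : Cn3 n),
     let sS := enc_sample S in
     let z := det_output L sS (Defs.poly c k (size sS)) in
     det_halts_within Ev (enc_pair z (enc_point x))
       (Defs.poly c' k' (size sS + size (enc_point x)))) ->
  (forall n (eps : R), 0 < eps ->
     forall D : example n -> R, is_distr D ->
     forall m : nat, mfun n eps < m%:R ->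
       Pr_sample D m (fun S => OptErr D + eps < Err D (hyp L Ev c k c' k' S)) < 1 / 10) ->
  refutes (refuter L Ev a 5) (1 / 32 : R) (nclauses Delta mu).
Proof.
move=> a eps Hmu He0 HD HDB HO HL HE Hlearn.
have He : 0 < eps by rewrite lt_min divr_gt0 //= divr_gt0.
have He1 : eps <= 1 / 128 by rewrite ge_min lexx.
have He2 : eps < eps0 by rewrite gt_min; apply/orP; right; lra.
(* Two above [N0], the exponent gives at least four blocks, enough for the three literals. *)
have HA : (3 <= 2 ^ a)%N.
  by rewrite /a !expnS mulnA; have := expn_gt0 2 N0; lia.
have HaN n : (0 < n)%N -> (N0 <= 2 ^ a * n)%N.
  move=> Hn; apply: leq_trans (leq_pmulr _ Hn); apply: leq_trans (ltnW (ltn_expl N0 (isT : 1 < 2)%N)) _.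
  by rewrite leq_exp2l // /a; lia.
set mcl := nclauses Delta mu.
have Hm0 n : mcl n = 0%N -> n = 0%N by move=> E; have := nclauses_ge Hmu n HD; rewrite -/mcl E leqn0 => /eqP.
have Hmn n : (0 < mcl n)%N -> (0 < n)%N.
  by case: n => // H; move: H; rewrite /mcl (nclauses0 Hmu).
have [tc [tk Ht]] : pb (fun i : {n : nat & formula n (mcl n)} => size (enc_formula (projT2 i)))
    (fun i => time L Ev c k c' k' a 5 (projT1 i) (mcl (projT1 i)) (size (enc_formula (projT2 i)))).
  apply: pb_time.
    apply: pb_le (pb_size _) => -[n phi] /=.
    by apply: leq_trans (size_enc_formula phi); exact: nclauses_ge.
  by apply: pb_le (pb_size _) => -[n phi] /=; exact: size_enc_formula.
have Hcor n (phi : formula n (mcl n)) :=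
  @refuter_correct R L Ev c k c' k' a 5 HL HE HA n (mcl n) phi _ (Hm0 n) (Hmn n) (Ht (existT _ n phi)).
exists tc, tk => /=; split; first by move=> n phi; have [] := Hcor n phi.
split.
  move=> n phi Hval; rewrite (proj2 (Hcor n phi)); case: ifP => [_|/negbT]; first by lra.
  rewrite -lt0n => Hm; have Hn := Hmn _ Hm.
  apply: (soundness HA Hn Hm He He1 Hval).
  apply: Hlearn => //; first exact: pushforward_distr.
  apply: le_lt_trans (HO _ _ (HaN _ Hn) He He2) _.
  apply: le_lt_trans (sample_size Hmu _ Hn HDB).
    (* The larger dimension costs the constant factor [(2 ^ a) ^ (1 + mu)], already part of the
       bound on [Delta]; [C] may be negative, hence its absolute value there. *)
    rewrite natrM powRM ?ler0n // mulrA -[leRHS]mulrAC ler_pM2r ?invr_gt0 ?exprn_gt0 //.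
    rewrite ler_wpM2r ?powR_ge0 // ler_wpM2r ?powR_ge0 //; exact: ler_norm.
  by rewrite !mulr_ge0 ?powR_ge0 ?invr_ge0 ?exprn_ge0 // ltW.
(* For [n > 0], [784 / m <= 784 / n <= 1568 / (n + 1)]; the shift avoids dividing by 0. *)
exists (fun n => 1568 * n.+1%:R^-1); split; first exact: cvg_bound.
move=> n; case: (posnP (mcl n)) => [E0|Hm].
  have En := Hm0 _ E0.
  (* Without clauses [n = 0], and the required bound is [1 - 1568], which is negative. *)
  apply: le_trans (_ : 0 <= _).
    by rewrite En invr1; lra.
  apply: mulr_ge0; first by rewrite invr_ge0 ler0n.
  apply: sumr_ge0 => phi _; rewrite (proj2 (Hcor n phi)) ifT ?subrr //.
  exact/eqP.
have Hn := Hmn _ Hm.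
have EP (phi : formula n (mcl n)) : Pr_exceptional R (refuter L Ev a 5) (Defs.poly tc tk (size (enc_formula phi))) (enc_formula phi)
   = avg (mcl n %/ 2 ^ 5 * (size (nbits (mcl n)) + 4))
      (fun r => ((accepts R L Ev c k c' k' a 5 phi r)%:R)).
  by rewrite (proj2 (Hcor n phi)) ifF //; apply/negbTE; rewrite -lt0n.
under eq_bigr => phi _ do rewrite EP.
have Hcard : (0 : R) < #|{: formula n (mcl n)}|%:R.
  rewrite ltr0n; apply/card_gt0P.
  by exists [tuple [tuple (Ordinal Hn, false) | i < 3] | j < mcl n].
rewrite sumrB mulrBr.
rewrite (_ : \sum_(phi : formula n (mcl n)) 1 = #|{: formula n (mcl n)}|%:R); last by rewrite sumr_const.
rewrite mulVf ?gt_eqF // lerB //.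
(* The averages over coins and over formulas are exchanged, so that [completeness] applies to each
   coin string. *)
rewrite -avg_sum -avgZ.
apply: le_trans (_ : 784 / (mcl n)%:R <= _).
  rewrite -[leRHS](avg_const (mcl n %/ 2 ^ 5 * (size (nbits (mcl n)) + 4))).
  by apply: le_avg => r _; exact: completeness.
have H1 : (n%:R : R) <= (mcl n)%:R by rewrite ler_nat; exact: nclauses_ge.
have H2 : (1 : R) <= n%:R by rewrite ler1n.
rewrite -natr1 ler_pdivrMr; last by lra.
rewrite mulrAC ler_pdivlMr; last by lra.
by lra.
Qed.

Theorem theorem1 (R : realType) (mu : R) :
  0 <= mu -> mu <= 1 / 2 -> R3SAT_hardness mu ->
  ~ exists (L Ev : TM) (mfun : nat -> R -> R),
      bigO_sample mu mfun /\ efficiently_learns L Ev mfun.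
Proof.
move=> Hmu _ Hhard [L [Ev [mfun [[C [N0 [eps0 [He0 HO]]]] [c [k [c' [k' [HL [HE Hlearn]]]]]]]]]].
have H1 : 0 < 1 / 32 :> R by lra.
have H2 : 1 / 32 < 1 / 4 :> R by lra.
have [Delta0 HDelta] := Hhard _ H1 H2.
pose B : R := `|C| * (2 ^ N0.+2)%:R `^ (1 + mu) / Num.min (1 / 128) (eps0 / 2) ^+ 2.
(* The ratio must exceed both the threshold of the assumption and what [sample_size] asks for; the
   absolute value covers a negative threshold. *)
pose x := `|Delta0| + 32 * (B + 1).
have HB : 0 <= B.
  by rewrite !mulr_ge0 ?powR_ge0 ?invr_ge0 ?exprn_ge0 // le_min; apply/andP; split; lra.
have Hx := truncnS_gt x.
have HD0 := ler_norm Delta0; have HD1 := normr_ge0 Delta0.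
apply: (HDelta (Num.truncn x).+1); first by rewrite /x in Hx *; lra.
exists (refuter L Ev N0.+2 5).
apply: (refutes_of_learner (C := C) (eps0 := eps0) (mfun := mfun)) HO HL HE Hlearn => //.
by rewrite -/B; rewrite /x in Hx *; lra.
Qed.
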